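(* Let $\mathfrak g$ be a complex simple Lie algebra of rank $\ge3$ and $\lambda,\hbar\in\mathbb C$. Let $V$ be a finite-dimensional representation of $D_\lambda(\mathfrak g)$ whose restriction to $\mathfrak g$ is small. Assume that the central element $Z$ acts on $V$ by the scalar $\hbar-\frac\lambda2(2h_l^\vee+h_s^\vee)$, and that the parameters $c$ of the rational Cherednik algebra $H_{\hbar,c}$ of $W$ satisfy $2c_\alpha=\frac\lambda2(\alpha,\alpha)^2$ for all $\alpha\in\Phi$. (1) The canonical $W$-action on the zero weight space $V[0]$ together with the assignment $x_u\mapsto Q(u)$, $y_{u}\mapsto K(u)$ ($u\in\mathfrak h$) yields an action of the rational Cherednik algebra $H_{\hbar,c}$ on $V[0]$. (2) The elliptic Casimir connection $$\nabla_{Ell,C}=d-\frac\lambda2\sum_{\alpha\in\Phi^+}k\Big(\alpha,\operatorname{ad}\tfrac{Q(\alpha^\vee)}2\Big|\tau\Big)(\kappa_\alpha)\,d\alpha-\sum_{\alpha\in\Phi^+}\frac{\theta'(\alpha|\tau)}{\theta(\alpha|\tau)}\frac Z{h^\vee}\,d\alpha+\sum_iK(u^i)\,du_i$$ with values in $\operatorname{End}(V[0])$ is equal to the sum of the elliptic KZ connection (evaluated in the $H_{\hbar,c}$-module $V[0]$ of (1)) $$\nabla_{H_{\hbar,c}}=d+\sum_{\alpha\in\Phi^+}\frac{2c_\alpha}{(\alpha,\alpha)}k\Big(\alpha,\operatorname{ad}\tfrac{x_{\alpha^\vee}}2\Big|\tau\Big)(s_\alpha)\,d\alpha-\sum_{\alpha\in\Phi^+}\frac\hbar{h^\vee}\frac{\theta'(\alpha|\tau)}{\theta(\alpha|\tau)}\,d\alpha+\sum_iy_{u^i}\,du_i$$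 and the scalar valued one-form $$\mathcal A=\frac\lambda2\sum_{\alpha\in\Phi^+}\Big(\frac{2h_l^\vee+h_s^\vee}{h^\vee}-(\alpha,\alpha)\Big)\frac{\theta'(\alpha|\tau)}{\theta(\alpha|\tau)}\,d\alpha .$$
   Context: Conventions: $\mathfrak h\subset\mathfrak g$ Cartan subalgebra, $\Phi$ roots, $\Phi^+$ positive roots, $W$ the Weyl group with reflections $s_\alpha$, $h^\vee$ the dual Coxeter number. $(\cdot,\cdot)$ is the invariant form with long roots of squared length $2$ (so short roots, if any, have squared length $1$); it identifies $\mathfrak h\cong\mathfrak h^*$. $X_\alpha\in\mathfrak g_\alpha$ with $(X_\alpha,X_{-\alpha})=1$, $H_\alpha=[X_\alpha,X_{-\alpha}]$, $\alpha^\vee=2H_\alpha/(\alpha,\alpha)$, $S(a,b)=ab+ba$, $\kappa_\alpha=X_\alpha X_{-\alpha}+X_{-\alpha}X_\alpha$; $\{u_i\},\{u^i\}$ dual bases of $\mathfrak h^*,\mathfrak h$. Write $\Phi^+=\Phi^+_l\sqcup\Phi^+_s$ (long and short; all roots are long if $\Phi$ is simply laced). $h^\vee_l,h^\vee_s$ are the constants with $\sum_{\alpha\in\Phi^+_l}\alpha(u)\alpha(v)=h_l^\vee(u,v)$ and $\sum_{\alpha\in\Phi^+_s}\alpha(u)\alpha(v)=h_s^\vee(u,v)$ for $u,v\in\mathfrak h$ ($h_s^\vee=0$ in types ADE). $D_\lambda(\mathfrak g)$ is the unital associative algebra generated by $X,K(X),Q(X),P(X)$ ($X\in\mathfrak g$),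 such that: $X\mapsto X$, $X\otimes v\mapsto K(X)$ extend to an algebra map from $U(\mathfrak g[v])$; $X\mapsto X$, $X\otimes u\mapsto Q(X)$ extend to an algebra map from $U(\mathfrak g[u])$; $P(X)$ is linear in $X$, $[X,P(X')]=P([X,X'])$; and for root vectors with $\beta_1\ne-\beta_2$, $$[K(X_{\beta_1}),Q(X_{\beta_2})]=P([X_{\beta_1},X_{\beta_2}])-\lambda\tfrac{(\beta_1,\beta_2)}{4}S(X_{\beta_1},X_{\beta_2})+\tfrac{\lambda}{4}\sum_{\alpha\in\Phi}S([X_{\beta_1},X_\alpha],[X_{-\alpha},X_{\beta_2}]).$$ $Z=\frac1{(\beta,\beta)}\big([K(H_\beta),Q(H_\beta)]-\frac\lambda4\sum_{\alpha\in\Phi}S([H_\beta,X_\alpha],[X_{-\alpha},H_\beta])\big)$ is central and independent of $\beta\in\Phi$. A $\mathfrak g$-module is small if $2\alpha$ is not a weight for any root $\alpha$. $W$ acts canonically on $V[0]$: $s_\alpha$ acts by $\exp(e)\exp(-f)\exp(e)$ for an $\mathfrak{sl}_2$-triple of $\alpha$. Rational Cherednik algebra: given a $W$-invariant function $\alpha\mapsto c_\alpha$ on $\Phi$, $H_{\hbar,c}$ is generated by $\mathbb CW$, $\mathfrak h$ and $\mathfrak h^*$, with the semidirect product relations of $W$ with $\mathfrak h$, $\mathfrak h^*$, and $[x,x']=0$, $[y,y']=0$, $[y,x]=\hbar\langle y,x\rangle-\sum_{\alpha\in\Phi^+}c_\alpha\langle\alpha,y\rangle\langle\alpha^\vee,x\rangle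 s_\alpha$ for $x,x'\in\mathfrak h^*$, $y,y'\in\mathfrak h$. For $u\in\mathfrak h$, $y_u$ is the generator $u\in\mathfrak h$ and $x_u$ the generator in $\mathfrak h^*$ corresponding to $u$ under $(\cdot,\cdot)$. Functions: for $\operatorname{Im}\tau>0$, $\theta(z|\tau)$ is the odd entire function with zero set $\Lambda_\tau=\mathbb Z+\mathbb Z\tau$, $\theta'(0|\tau)=1$, $\theta(z+1|\tau)=-\theta(z|\tau)$, $\theta(z+\tau|\tau)=-e^{-\pi i\tau}e^{-2\pi iz}\theta(z|\tau)$; $k(z,x|\tau)=\frac{\theta(z+x|\tau)}{\theta(z|\tau)\theta(x|\tau)}-\frac1x$, expanded as a power series in $x$. Both connections are obtained by substituting the indicated $\operatorname{ad}$ operators for $x$ in this power series, and are connections on the complement of $\{\alpha(z)\in\Lambda_\tau\}$ in $\mathfrak h$. *)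

(* Defs.v *)
From HB Require Import structures.
From mathcomp Require Import all_boot all_order all_algebra.
From mathcomp Require Import complex.
From mathcomp Require Import all_classical all_reals.
From mathcomp Require Import topology normedtype sequences derive exp trigo.

Set Implicit Arguments.
Unset Strict Implicit.
Unset Printing Implicit Defensive.

Import Order.TTheory GRing.Theory Num.Theory.
Import numFieldNormedType.Exports.

Local Open Scope classical_set_scope.
Local Open Scope complex_scope.
Local Open Scope ring_scope.

Section Operators.
Context {R : realType}.
Local Notation C := (R[i]).

Definition comm (M : vectType C) (A B : 'End(M)) : 'End(M) :=
  (A \o B)%VF - (B \o A)%VF.

Definition symm (M : vectType C) (A B : 'End(M)) : 'End(M) :=
  (A \o B)%VF + (B \o A)%VF.

(* The exponential of a nilpotent operator: its powers from dim M on vanish. *)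
Definition nilexp (M : vectType C) (A : 'End(M)) : 'End(M) :=
  \sum_(k < (\dim {:M}).+1)
    (k`!%:R : C)^-1 *: iter k (fun B : 'End(M) => (A \o B)%VF) \1%VF.

(* The operator induced on a subspace U. The projection [vsproj] is only used
   to change type: all operators below to which this is applied preserve U. *)
Definition restr (M : vectType C) (U : {vspace M}) (A : 'End(M)) :
    'End(subvs_of U) :=
  (linfun (vsproj U) \o A \o linfun vsval)%VF.

Definition diagonalizable_op (M : vectType C) (A : 'End(M)) : Prop :=
  exists2 b : seq M, basis_of {:M} b &
    forall v, v \in b -> exists a : C, A v = a *: v.

(* Order-N truncation of f(ad T)(S) for the power series f = \sum_n a_n x^n. *)
Definition ad_psum (M : vectType C) (a : nat -> C) (T S : 'End(M)) (N : nat) :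
    'End(M) :=
  \sum_(n < N) a n *: iter n (comm T) S.

(* f(ad T)(S) converges to L. The topology of the finite-dimensional space
   End(M) is tested on linear functionals. *)
Definition ad_series (M : vectType C) (a : nat -> C) (T S L : 'End(M)) : Prop :=
  forall phi : 'Hom('End(M), C^o),
    (fun N => phi (ad_psum a T S N) : C^o) @ \oo --> (phi L : C^o).

End Operators.

Section LieAlgebras.
Context {R : realType}.
Local Notation C := (R[i]).

Record lie_algebra := LieAlgebra {
  lie_space :> vectType C;
  bracket : 'Hom(lie_space, 'End(lie_space));
  bracket_alt : forall x, bracket x x = 0;
  bracket_jacobi : forall x y z,
    bracket x (bracket y z) + bracket y (bracket z x)
      + bracket z (bracket x y) = 0 }.

Definition is_ideal (g : lie_algebra) (I : {vspace g}) : Prop :=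
  forall x y, y \in I -> bracket g x y \in I.

Definition is_simple (g : lie_algebra) : Prop :=
  (exists x y, bracket g x y <> 0) /\
  (forall I : {vspace g}, is_ideal I -> I = 0%VS \/ I = fullv).

Definition is_abelian (g : lie_algebra) (U : {vspace g}) : Prop :=
  forall x y, x \in U -> y \in U -> bracket g x y = 0.

(* Cartan subalgebra of a semisimple complex Lie algebra: a maximal abelian
   subalgebra all of whose elements are ad-semisimple. *)
Definition is_cartan (g : lie_algebra) (h : {vspace g}) : Prop :=
  [/\ is_abelian h,
      forall U : {vspace g}, is_abelian U -> (h <= U)%VS -> U = h &
      forall x, x \in h -> diagonalizable_op (bracket g x)].

Definition dual (g : lie_algebra) (h : {vspace g}) := 'Hom(subvs_of h, C^o).

Definition weight_space (g : lie_algebra) (h : {vspace g}) (V : vectType C)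
    (rho : 'Hom(g, 'End(V))) (mu : dual h) : {vspace V} :=
  (\bigcap_(u <- vbasis {:subvs_of h})
     lker (rho (vsval u) - (mu u : C) *: \1%VF))%VS.

Definition is_root (g : lie_algebra) (h : {vspace g}) (a : dual h) : bool :=
  (a != 0) && (weight_space (bracket g) a != 0%VS).

(* u |-> (u, .) from h to h^*. A nonzero invariant form on a simple algebra is
   nondegenerate on h, so [sharp] is a true inverse. *)
Definition flat (g : lie_algebra) (h : {vspace g})
    (form : 'Hom(g, 'Hom(g, C^o))) : 'Hom(subvs_of h, dual h) :=
  linfun (fun u : subvs_of h => (form (vsval u) \o linfun vsval)%VF).

Definition sharp (g : lie_algebra) (h : {vspace g})
    (form : 'Hom(g, 'Hom(g, C^o))) : 'Hom(dual h, subvs_of h) :=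
  ((flat h form)^-1)%VF.

Definition dual_form (g : lie_algebra) (h : {vspace g})
    (form : 'Hom(g, 'Hom(g, C^o))) (xi eta : dual h) : C :=
  form (vsval (sharp h form xi)) (vsval (sharp h form eta)).

Lemma flatE (g : lie_algebra) (h : {vspace g}) (form : 'Hom(g, 'Hom(g, C^o)))
    (u v : subvs_of h) :
  flat h form u v = form (vsval u) (vsval v).
Proof.
pose f (u : subvs_of h) : dual h := (form (vsval u) \o linfun vsval)%VF.
have f_lin : linear f.
  move=> a x y; apply/lfunP => z.
  by rewrite /f !lfunE /= !lfunE /= !lfunE /= !linearP /= !lfunE /= !lfunE.
pose fM := GRing.isLinear.Build C _ _ *:%R f f_lin.
pose fL : {linear subvs_of h -> dual h} := HB.pack f fM.
have -> : flat h form = linfun fL by [].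
by rewrite lfunE /= /f lfunE /= lfunE.
Qed.

(* A complex simple Lie algebra with a Cartan subalgebra, (an enumeration of)
   its roots, a system of positive roots, the invariant form for which the
   long roots have squared length 2, and normalized root vectors. *)
Record simple_lie := SimpleLie {
  gg :> lie_algebra;
  sg_simple : is_simple gg;
  sh : {vspace gg};
  sh_cartan : is_cartan sh;

  Phi : seq (dual sh);
  Phi_uniq : uniq Phi;
  mem_Phi : forall a, (a \in Phi) = is_root a;

  Phip : seq (dual sh);
  Phip_uniq : uniq Phip;
  Phip_sub : {subset Phip <= Phi};
  Phip_half : forall a, a \in Phi -> (- a \in Phip) = (a \notin Phip);
  Phip_closed : forall a b, a \in Phip -> b \in Phip -> a + b \in Phi ->
    a + b \in Phip;

  form : 'Hom(gg, 'Hom(gg, C^o));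
  form_sym : forall x y, form x y = form y x;
  form_inv : forall x y z, form (bracket gg x y) z = form x (bracket gg y z);
  form_norm_le : forall a, a \in Phi -> dual_form form a a <= 2;
  form_norm_eq : exists2 a, a \in Phi & dual_form form a a = 2;

  rootv : dual sh -> gg;
  rootvP : forall a, a \in Phi -> rootv a \in weight_space (bracket gg) a;
  rootv_norm : forall a, a \in Phi -> form (rootv a) (rootv (- a)) = 1 }.

End LieAlgebras.

Section RootData.
Context {R : realType}.
Local Notation C := (R[i]).
Variable G : @simple_lie R.

Definition cartan : vectType C := subvs_of (sh G).
Definition cartan_dual : vectType C := 'Hom(cartan, C^o).

Definition rank : nat := \dim (sh G).

Definition ip (a b : cartan_dual) : C := dual_form (form G) a b.

Definition is_long (a : cartan_dual) : bool := ip a a == 2.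

Definition Hroot (a : cartan_dual) : G := bracket G (rootv a) (rootv (- a)).

Definition coroot (a : cartan_dual) : G := (2 / ip a a) *: Hroot a.

(* [coroot a] as an element of the type [cartan]; it does lie in [sh G]. *)
Definition coroot_h (a : cartan_dual) : cartan := vsproj (sh G) (coroot a).

Definition refl (a : cartan_dual) : 'End(cartan) :=
  linfun (fun u : cartan => u - (a u : C) *: coroot_h a).

Inductive weyl : 'End(cartan) -> Prop :=
| weyl1 : weyl \1%VF
| weylM a w : a \in Phi G -> weyl w -> weyl (refl a \o w)%VF.

(* W acts on h^* by w.xi = xi \o w^-1. *)
Definition weyl_invariant (c : cartan_dual -> C) : Prop :=
  forall w a, weyl w -> a \in Phi G -> c (a \o w)%VF = c a.

(* 1 + <rho, theta^vee> for rho the half-sum of the positive roots and theta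
   the highest root. *)
Definition is_dual_coxeter (hv : C) : Prop :=
  exists theta : cartan_dual,
    [/\ theta \in Phip G,
        forall a, a \in Phip G -> theta + a \notin Phi G &
        hv = 1 + 2^-1 * \sum_(a <- Phip G) (a (coroot_h theta) : C)].

(* The constant k with \sum_(a in Phi^+, P a) a(u) a(v) = k (u, v) on h. *)
Definition is_trace_constant (P : pred cartan_dual) (k : C) : Prop :=
  forall u v : cartan,
    \sum_(a <- Phip G | P a) (a u : C) * (a v : C)
      = k * form G (vsval u) (vsval v).

Definition dual_bases (u : 'I_rank -> cartan) (ud : 'I_rank -> cartan_dual) :
    Prop :=
  forall i j, ud i (u j) = (i == j)%:R.

End RootData.

Section DModules.
Context {R : realType}.
Local Notation C := (R[i]).
Variable G : @simple_lie R.

(* x |-> a x, x (x) t |-> b x extend to an algebra map U(g[t]) -> End(V), that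
   is, to a Lie algebra map x (x) t^n |-> psi n x on g[t]. *)
Definition extends_to_current (V : vectType C) (a b : 'Hom(G, 'End(V))) : Prop :=
  exists psi : nat -> 'Hom(G, 'End(V)),
    [/\ psi 0%N = a, psi 1%N = b &
        forall m n x y, comm (psi m x) (psi n y) = psi (m + n)%N (bracket G x y)].

Definition root_sum (V : vectType C) (opX : 'Hom(G, 'End(V))) (x y : G) :
    'End(V) :=
  \sum_(a <- Phi G)
    symm (opX (bracket G x (rootv a))) (opX (bracket G (rootv (- a)) y)).

(* A finite-dimensional module over the algebra D_lambda(g) presented by
   generators x, K(x), Q(x), P(x), i.e. operators satisfying its relations. *)
Record D_module (lambda : C) := DModule {
  D_space :> vectType C;
  opX : 'Hom(G, 'End(D_space));
  opK : 'Hom(G, 'End(D_space));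
  opQ : 'Hom(G, 'End(D_space));
  opP : 'Hom(G, 'End(D_space));
  D_K : extends_to_current opX opK;
  D_Q : extends_to_current opX opQ;
  D_P : forall x y, comm (opX x) (opP y) = opP (bracket G x y);
  D_KQ : forall b1 b2, b1 \in Phi G -> b2 \in Phi G -> b1 != - b2 ->
    comm (opK (rootv b1)) (opQ (rootv b2)) =
      opP (bracket G (rootv b1) (rootv b2))
      - (lambda * (ip b1 b2 / 4)) *: symm (opX (rootv b1)) (opX (rootv b2))
      + (lambda / 4) *: root_sum opX (rootv b1) (rootv b2) }.

Variables (lambda : C) (V : D_module lambda).

Definition opZ (b : cartan_dual G) : 'End(V) :=
  (ip b b)^-1 *: (comm (opK V (Hroot b)) (opQ V (Hroot b))
                  - (lambda / 4) *: root_sum (opX V) (Hroot b) (Hroot b)).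

Definition kappa (a : cartan_dual G) : 'End(V) :=
  symm (opX V (rootv a)) (opX V (rootv (- a))).

Definition is_small : Prop :=
  forall a : cartan_dual G, a \in Phi G -> weight_space (opX V) (a + a) = 0%VS.

Definition zero_space : {vspace V} :=
  weight_space (opX V) (0 : dual (sh G)).

Definition V0 : vectType C := subvs_of zero_space.

Definition sl2_pair (a : cartan_dual G) (e f : G) : Prop :=
  [/\ e \in weight_space (bracket G) (a : dual (sh G)),
      f \in weight_space (bracket G) (- a : dual (sh G)) &
      bracket G e f = coroot a].

Definition tits (e f : G) : 'End(V) :=
  (nilexp (opX V e) \o nilexp (- opX V f) \o nilexp (opX V e))%VF.

End DModules.

Section Cherednik.
Context {R : realType}.
Local Notation C := (R[i]).
Variable G : @simple_lie R.

(* An action of H_{hbar,c} on M: operators for the generators w in W, x in h^*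
   and y in h that satisfy the defining relations; the values of [ch_w]
   outside W are irrelevant. *)
Record cherednik_module (hbar : C) (c : cartan_dual G -> C) (M : vectType C) :=
CherednikModule {
  ch_w : 'End(cartan G) -> 'End(M);
  ch_x : 'Hom(cartan_dual G, 'End(M));
  ch_y : 'Hom(cartan G, 'End(M));
  ch_w1 : ch_w \1%VF = \1%VF;
  ch_wM : forall w w', weyl w -> weyl w' ->
    ch_w (w \o w')%VF = (ch_w w \o ch_w w')%VF;
  ch_wx : forall w xi, weyl w ->
    (ch_w w \o ch_x (xi \o w)%VF)%VF = (ch_x xi \o ch_w w)%VF;
  ch_wy : forall w u, weyl w ->
    (ch_w w \o ch_y u)%VF = (ch_y (w u) \o ch_w w)%VF;
  ch_xx : forall xi eta, comm (ch_x xi) (ch_x eta) = 0;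
  ch_yy : forall u v, comm (ch_y u) (ch_y v) = 0;
  ch_yx : forall u xi,
    comm (ch_y u) (ch_x xi) =
      (hbar * (xi u : C)) *: \1%VF
      - \sum_(a <- Phip G)
          (c a * (a u : C) * (xi (coroot_h a) : C)) *: ch_w (refl a) }.

(* x_u : the element (u, .) of h^* *)
Definition ch_xu (hbar : C) (c : cartan_dual G -> C) (M : vectType C)
    (N : cherednik_module hbar c M) (u : cartan G) : 'End(M) :=
  ch_x N (flat (sh G) (form G) u).

End Cherednik.

Section Theta.
Context {R : realType}.
Local Notation C := (R[i]).

Definition cexp (z : C) : C :=
  (expR (complex.Re z))%:C * (cos (complex.Im z) +i* sin (complex.Im z)).

Definition lattice (tau : C) : set C :=
  [set z | exists m n : int, z = m%:~R + n%:~R * tau].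

Definition cderive (f : C -> C) : C -> C := derive1 (f : C^o -> C^o).

Definition is_theta (tau : C) (theta : C -> C) : Prop :=
  [/\ forall z : C, derivable (theta : C^o -> C^o) z 1,
      forall z, theta (- z) = - theta z,
      forall z, theta z = 0 <-> lattice tau z,
      cderive theta 0 = 1 &
      (forall z, theta (z + 1) = - theta z) /\
      (forall z, theta (z + tau) =
         - cexp (- ((pi : R)%:C * 'i * tau))
           * cexp (- (2 * (pi : R)%:C * 'i * z)) * theta z)].

Definition dlog (theta : C -> C) (z : C) : C := cderive theta z / theta z.

Definition kfun (theta : C -> C) (z x : C) : C :=
  theta (z + x) / (theta z * theta x) - x^-1.

(* f extends to 0 with power series expansion \sum_n a_n x^n there. *)
Definition has_expansion (f : C -> C) (a : nat -> C) : Prop :=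
  exists2 r : C, 0 < r & forall x, x != 0 -> `|x| < r ->
    (series (fun n => a n * x ^+ n : C^o) : nat -> C^o) @ \oo --> (f x : C^o).

(* [kc z n] is the coefficient of x^n in k(z,x|tau). *)
Definition is_k_coeff (tau : C) (theta : C -> C) (kc : C -> nat -> C) : Prop :=
  forall z, ~ lattice tau z -> has_expansion (kfun theta z) (kc z).

End Theta.

(* A connection d + A on a trivial bundle over an open subset of h is given by
   the value at (z, w) of its 1-form A, z in h and w a tangent vector. The
   functions L stand for the values of k(a(z), ad .)(.): substituting
   truncations gives the order-N truncation of the connection, substituting
   limits (where they exist) gives its value. *)
Section Connections.
Context {R : realType}.
Local Notation C := (R[i]).
Variable G : @simple_lie R.
Variables (theta : C -> C) (kc : C -> nat -> C) (hv : C).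
Variables (u : 'I_(rank G) -> cartan G) (ud : 'I_(rank G) -> cartan_dual G).

Definition regular (tau : C) (z : cartan G) : Prop :=
  forall a, a \in Phi G -> ~ lattice tau (a z : C).

Section Casimir.
Variables (lambda : C) (V : D_module G lambda) (b : cartan_dual G).

Local Notation on_V0 A := (restr (zero_space V) A).

Definition casimir_form (L : cartan_dual G -> 'End(V0 V)) (z w : cartan G) :
    'End(V0 V) :=
  - ((lambda / 2) *: \sum_(a <- Phip G) (a w : C) *: L a)
  - \sum_(a <- Phip G)
      (dlog theta (a z) * (hv^-1 * (a w : C))) *: on_V0 (opZ V b)
  + \sum_i (ud i w : C) *: on_V0 (opK V (vsval (u i))).

Definition casimir_arg (a : cartan_dual G) : 'End(V0 V) :=
  2^-1 *: on_V0 (opQ V (coroot a)).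

Definition casimir_trunc (N : nat) (z : cartan G) : cartan G -> 'End(V0 V) :=
  casimir_form
    (fun a => ad_psum (kc (a z)) (casimir_arg a) (on_V0 (kappa V a)) N) z.

Definition casimir_conn (z w : cartan G) (A : 'End(V0 V)) : Prop :=
  exists2 L, forall a, a \in Phip G ->
      ad_series (kc (a z)) (casimir_arg a) (on_V0 (kappa V a)) (L a) &
    A = casimir_form L z w.

End Casimir.

Section KZ.
Variables (hbar : C) (c : cartan_dual G -> C) (M : vectType C).
Variable N : cherednik_module hbar c M.

Definition kz_form (L : cartan_dual G -> 'End(M)) (z w : cartan G) : 'End(M) :=
  \sum_(a <- Phip G) (2 * c a / ip a a * (a w : C)) *: L a
  - \sum_(a <- Phip G)
      (hbar / hv * dlog theta (a z) * (a w : C)) *: \1%VF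
  + \sum_i (ud i w : C) *: ch_y N (u i).

Definition kz_arg (a : cartan_dual G) : 'End(M) :=
  2^-1 *: ch_xu N (coroot_h a).

Definition kz_trunc (n : nat) (z : cartan G) : cartan G -> 'End(M) :=
  kz_form (fun a => ad_psum (kc (a z)) (kz_arg a) (ch_w N (refl a)) n) z.

Definition kz_conn (z w : cartan G) (B : 'End(M)) : Prop :=
  exists2 L, forall a, a \in Phip G ->
      ad_series (kc (a z)) (kz_arg a) (ch_w N (refl a)) (L a) &
    B = kz_form L z w.

End KZ.

Definition scalar_form (lambda hl hs : C) (z w : cartan G) : C :=
  lambda / 2 * \sum_(a <- Phip G)
    ((2 * hl + hs) / hv - ip a a) * dlog theta (a z) * (a w : C).

End Connections.

Arguments casimir_conn {R G} theta kc hv u ud {lambda} V b z w A.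
Arguments kz_conn {R G} theta kc hv u ud {hbar c M} N z w B.

(* Main.v *)
(* On the zero weight space of a small module, kappa_a = (a, a)(1 - s_a), where s_a
   is the Tits operator of the root a. This matches the two connections term by
   term once one knows that k(z, x) has constant term theta'(z)/theta(z), because
   k(z, ad T)(1) is that constant term.
   The operators s_a on V[0] satisfy s_a^2 = 1 and s_a s_b = s_{s_a b} s_a; these
   relations suffice to run the deletion argument of Coxeter groups, so s_a extends
   to an action of the Weyl group.
   For [K(u), Q(v)], complete the given relation on root vectors by the Cartan part
   of the Casimir tensor: the defect F(x, y) = [K(x), Q(y)] - P([x, y])
   - (lambda/4) Omega(x, y) is g-equivariant and vanishes on pairs of root vectors
   of non-opposite roots. Applying root vectors to these zeros gives F(h, X_b) = 0
   and F(h, H_b) = b(h) F(X_{-b}, X_b), and irreducibility makes the last factor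
   independent of b: F(u, v) = (u, v) Z on h. In rank at least 3 no two root lengths
   have ratio 3, so short roots have squared length 1 and the scalar term is
   sum_a (a, a) a(u) a(v) = (2 hl + hs)(u, v). *)
From HB Require Import structures.
From mathcomp Require Import all_boot all_order all_algebra.
From mathcomp Require Import complex.
From mathcomp Require Import all_classical all_reals.
From mathcomp Require Import topology normedtype sequences derive.
From mathcomp Require Import ssrAC ring zify.
Require Import Defs.

Set Implicit Arguments.
Unset Strict Implicit.
Unset Printing Implicit Defensive.

Import Order.TTheory GRing.Theory Num.Theory.
Import numFieldNormedType.Exports.

Local Open Scope complex_scope.
Local Open Scope ring_scope.

(** * Exponentials and sl2-chains *)

(** The input is a bare simple Lie algebra with an invariant form, so one-dimensionality of root
    spaces, Cartan integers and stability of the roots under reflections are all derived from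
    sl2-chains. Positivity of the form is not given either: the identity sum over positive roots
    a(u) a(v) = (hl + hs)(u, v) supplies it. The obstacle in (1) is that V[0] need not be faithful:
    a relation between products of reflections on h must be lifted to the operators s_a. Hence the
    word combinatorics, carried out in W and on V[0] at once. Origin of the constants: on V[0] the
    root sum in [K(u), Q(v)] contributes lambda/2 times the sum over positive a of (a, a) a(u) a(v)
    (1 - s_a). Its s_a-part dictates c_a = lambda (a, a)^2 / 4; its identity part is lambda/2 (2 hl
    + hs)(u, v), exactly what is subtracted from hbar in the scalar of Z. In (2) no convergence of
    the ad-series is presupposed: the connections are compared on truncations, and on limits in both
    directions, the existence of one limit giving that of the other. *)

Section Nilpotency.
Import VectorInternalTheory.
Variable F : numFieldType.

(* The minimal polynomial p of A satisfies p | X p', so that p = X^d. *)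
Lemma mx_shift_nilpotent (n : nat) (A H : 'M[F]_n) (c : F) :
  c != 0 -> H *m A - A *m H = c *: A ->
  exists2 d, (d <= n)%N & forall x : 'rV_n, iter d (mulmxr A) x = 0.
Proof.
case: n A H => [|n] A H c0 HA; first by exists 0%N => // x; apply/matrixP => ? [].
have {}HA : H * A - A * H = c *: A by [].
have derX k : H * A ^+ k - A ^+ k * H = (c * k%:R) *: A ^+ k.
  elim: k => [|k IH]; first by rewrite mulr1 mul1r subrr mulr0 scale0r.
  have -> : H * A ^+ k.+1 - A ^+ k.+1 * H
    = (H * A - A * H) * A ^+ k + A * (H * A ^+ k - A ^+ k * H).
    by rewrite exprS mulrBl mulrBr !mulrA addrA subrK.
  rewrite HA IH -scalerAl -scalerAr -exprS -scalerDl.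
  by rewrite -[k.+1]add1n natrD mulrDr mulr1.
have hornE E m : horner_mx A (\poly_(i < m) E i) = \sum_(i < m) E i *: A ^+ i.
  rewrite poly_def rmorph_sum; apply: eq_bigr => i _ /=.
  by rewrite linearZ /= rmorphXn /= horner_mx_X.
pose p := mxminpoly A.
have pA0 : horner_mx A p = 0 by exact: mx_root_minpoly.
have p_monic : p \is monic by exact: mxminpoly_monic.
have p0 : p != 0 by exact: monic_neq0.
pose d := degree_mxminpoly A.
have szp : size p = d.+1 by exact: size_mxminpoly.
have dn : (d <= n.+1)%N.
  rewrite -ltnS -szp -(size_char_poly A) dvdp_leq //.
    exact/monic_neq0/char_poly_monic.
  exact: mxminpoly_dvd_char.
(* [q] is X p'. The derivation [H, .] multiplies A^k by c k, so it sends p(A) = 0 to c q(A). *)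
pose q := \poly_(i < d.+1) (i%:R * p`_i).
have qA0 : horner_mx A q = 0.
  apply: (scalerI c0); rewrite scaler0 hornE scaler_sumr.
  have pE : \sum_(i < d.+1) p`_i *: A ^+ i = 0 by rewrite -hornE -szp coefK.
  transitivity (H * (\sum_(i < d.+1) p`_i *: A ^+ i)
      - (\sum_(i < d.+1) p`_i *: A ^+ i) * H); last by rewrite pE mulr0 mul0r subrr.
  rewrite mulr_sumr mulr_suml -sumrB; apply: eq_bigr => i _.
  rewrite -scalerAr -scalerAl -scalerBr derX !scalerA; congr (_ *: _); ring.
have r0 : q - d%:R *: p = 0.
  apply/eqP; apply: contraTT (leqnn d) => r0; rewrite -ltnNge.
  have : p %| q - d%:R *: p.
    by apply: mxminpoly_min; rewrite rmorphB /= qA0 linearZ /= pA0 scaler0 subrr.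
  move/(dvdp_leq r0); rewrite szp => /leq_trans; apply.
  apply/leq_sizeP => j dj; rewrite coefB coefZ coef_poly ltnS.
  case: ltngtP dj => // [jd _|-> _]; last by rewrite subrr.
  by rewrite nth_default ?szp // mulr0 subrr.
exists d => //.
have pE : p = 'X^d.
  apply/polyP => i; rewrite coefXn; case: (ltngtP i d) => [id_|di|->].
  - have /eqP := congr1 (fun s : {poly F} => s`_i) r0.
    rewrite coefB coefZ coef_poly ltnS (ltnW id_) -mulrBl coef0 mulf_eq0.
    by rewrite subr_eq0 eqr_nat (ltn_eqF id_) => /eqP.
  - by rewrite nth_default ?szp.
  - by have /monicP := p_monic; rewrite /lead_coef szp.
move: pA0; rewrite pE rmorphXn /= horner_mx_X => Ad0 x.
rewrite -[RHS](mulmx0 _ x) -Ad0; elim: (d) => [|k /= ->].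
  by rewrite expr0 mulmx1.
by rewrite exprSr mulmxA.
Qed.

Lemma iter0_le (U : nmodType) (A : {additive U -> U}) k m v :
  iter k A v = 0 -> (k <= m)%N -> iter m A v = 0.
Proof.
move=> kA /subnK <-; rewrite iterD kA.
by elim: (m - k)%N => //= i ->; rewrite raddf0.
Qed.

Lemma lfun_shift_nilpotent (V : vectType F) (A H : 'End(V)) (c : F) k v :
    c != 0 -> (forall x, H (A x) - A (H x) = c *: A x) ->
  (\dim {:V} <= k)%N -> iter k A v = 0.
Proof.
move=> c0 HA kV.
(* [f2mx] acts on row vectors from the right; products are reversed and the commutator changes sign,
   hence [- c]. *)
have [||d dV Ad] := @mx_shift_nilpotent _ (f2mx A) (f2mx H) (- c).
- by rewrite oppr_eq0.
- apply/row_matrixP => i; rewrite !rowE; set x := delta_mx _ _.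
  have := HA (r2v x); rewrite unlock /= !r2vK -linearB -linearZ => /(can_inj r2vK).
  by rewrite -!mulmxA mulmxBr scaleNr mulmxN -scalemxAr => <-; rewrite opprB.
apply: (@iter0_le _ A d); last by rewrite (leq_trans dV) // -dimvf.
have AE x : v2r (A x) = v2r x *m f2mx A by rewrite unlock /= r2vK.
apply: (can_inj v2rK); rewrite linear0 -[RHS](Ad (v2r v)).
by elim: (d) => //= j <-; rewrite AE.
Qed.
End Nilpotency.

Section Sl2Chain.
Variables (F : numFieldType) (V : vectType F) (e f h : 'End(V)) (d : F).
Hypothesis ef : forall x, e (f x) = f (e x) + h x.
Hypothesis hf : forall x, h (f x) = f (h x) - d *: f x.

(** The normalization is that of the triple X_a, X_{-a}, H_a, where d = (a, a); for d = 2 the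
    coefficient is the usual (k + 1)(mu - k). *)
Lemma sl2_chain (mu : F) v k : e v = 0 -> h v = mu *: v ->
  e (iter k.+1 f v) = (k.+1%:R * (mu - k%:R * (d / 2))) *: iter k f v.
Proof.
move=> ev hv.
have hk j : h (iter j f v) = (mu - j%:R * d) *: iter j f v.
  elim: j => [|j IH]; first by rewrite mul0r subr0.
  rewrite /= hf IH linearZ -scalerBl; congr (_ *: _).
  by rewrite -natr1; ring.
elim: k => [|k IH]; first by rewrite /= ef ev linear0 add0r hv mul1r mul0r subr0.
rewrite iterS ef IH hk linearZ -scalerDl; congr (_ *: _).
by rewrite -!natr1; field.
Qed.

(** At the first power of [f] that kills v, the coefficient in the chain formula has to vanish. *)
Lemma sl2_highest_weight (mu : F) v N : e v = 0 -> h v = mu *: v -> v != 0 ->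
  iter N f v = 0 -> exists2 k, (k < N)%N & mu = k%:R * (d / 2).
Proof.
move=> ev hv v0 fN; have exN : exists n, iter n f v == 0 by exists N; rewrite fN.
case: (ex_minnP exN) => -[|k] /eqP fk kmin; 
  first by move: v0; rewrite -[v]/(iter 0 f v) fk eqxx.
exists k; first by apply: kmin; rewrite fN.
have /eqP := sl2_chain k ev hv; rewrite fk linear0 eq_sym scaler_eq0.
case/orP => [|/eqP fk0]; last by have := kmin k; rewrite fk0 ltnn eqxx => /(_ isT).
by rewrite mulf_eq0 pnatr_eq0 subr_eq0 => /eqP.
Qed.
End Sl2Chain.

Section Exponential.
Variables (F : numFieldType) (U V W : vectType F).
Variables (m : 'Hom(U, 'Hom(V, W))) (eU : 'End(U)) (eV : 'End(V)) (eW : 'End(W)).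
Hypothesis eWm : forall x v, eW (m x v) = m (eU x) v + m x (eV v).

Definition dpow (T : vectType F) (A : 'End(T)) k v := k`!%:R^-1 *: iter k A v.

Lemma dpowS (T : vectType F) (A : 'End(T)) k v :
  A (dpow A k v) = k.+1%:R *: dpow A k.+1 v.
Proof.
rewrite /dpow linearZ scalerA; congr (_ *: _).
by rewrite factS natrM invfM mulrA divff ?mul1r // pnatr_eq0.
Qed.

Lemma dpow_leibniz n x v :
  dpow eW n (m x v) = \sum_(i < n.+1) m (dpow eU i x) (dpow eV (n - i) v).
Proof.
elim: n => [|n IH].
  by rewrite big_ord1 /dpow /= fact0 invr1 !scale1r.
have mZl a y w : m (a *: y) w = a *: m y w by rewrite linearZ /= scale_lfunE.
have mZr a y w : m y (a *: w) = a *: m y w by rewrite linearZ.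
apply: (@scalerI _ _ n.+1%:R); first by rewrite pnatr_eq0.
rewrite -dpowS IH linear_sum /=.
under eq_bigr => i _ do rewrite eWm !dpowS mZl.
rewrite big_split /= scaler_sumr.
(* The factor n + 1 is split as i + (n + 1 - i), one summand for each half of the derivation
   rule. *)
rewrite [RHS](eq_bigr (fun i : 'I_n.+2 =>
   i%:R *: m (dpow eU i x) (dpow eV (n.+1 - i) v)
   + (n.+1 - i)%:R *: m (dpow eU i x) (dpow eV (n.+1 - i) v))); last first.
  by move=> i _; rewrite -scalerDl -natrD subnKC // -ltnS.
rewrite big_split /=; congr (_ + _).
  rewrite [RHS]big_ord_recl scale0r add0r; apply: eq_bigr => i _.
  by rewrite lift0 subSS.
rewrite [RHS]big_ord_recr /= subnn scale0r addr0; apply: eq_bigr => i _ /=.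
by rewrite mZr subSn // -ltnS.
Qed.

(** The order is a parameter because operators on three spaces of different dimensions are compared
    at a common order. *)
Definition expn_op (T : vectType F) N (A : 'End(T)) v := \sum_(k < N) dpow A k v.

Lemma expn_op_cut (T : vectType F) (A : 'End(T)) N M v :
  iter N A v = 0 -> (N <= M)%N -> expn_op M A v = expn_op N A v.
Proof.
move=> AN NM; rewrite /expn_op -(subnKC NM) big_split_ord /= [X in _ + X]big1 ?addr0 //.
by move=> i _; rewrite /dpow (iter0_le AN) ?scaler0 // leq_addr.
Qed.

(** Cauchy product: the antidiagonals of index below 2N cover the square that supports [g]. *)
Lemma big_triangle (g : nat -> nat -> W) N :
    (forall i j, (N <= i)%N || (N <= j)%N -> g i j = 0) ->
  \sum_(n < N + N) \sum_(i < n.+1) g i (n - i)%N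
    = \sum_(i < N) \sum_(j < N) g i j.
Proof.
move=> g0.
under eq_bigr => n _ do
  rewrite (big_ord_widen (N + N) (fun i => g i (n - i)%N)) ?ltn_ord //.
rewrite (exchange_big_dep xpredT) //= big_split_ord /= [X in _ + X]big1 ?addr0.
  apply: eq_bigr => i _.
  have iN : (i <= N + N)%N by rewrite (leq_trans (ltnW (ltn_ord i))) ?leq_addr.
  under eq_bigl do rewrite ltnS.
  rewrite -(big_geq_mkord _ _ xpredT (fun n => g i (n - i)%N)).
  rewrite -[X in index_iota X]add0n big_addn big_mkord.
  have iNN : (N <= N + N - i)%N by rewrite leq_subRL // [(i + _)%N]addnC leq_add2l ltnW.
  rewrite -(subnKC iNN) big_split_ord /= [X in _ + X]big1 ?addr0.
    by apply: eq_bigr => j _; rewrite addnK.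
  by move=> j _; rewrite addnK g0 // leq_addr orbT.
by move=> i _; rewrite big1 // => n _; rewrite g0 // leq_addr.
Qed.

(** The exponential of a derivation is multiplicative. Order 2N catches every product of two terms
    of degree below N. *)
Lemma expn_op_bilin x v N : iter N eU x = 0 -> iter N eV v = 0 ->
  expn_op (N + N) eW (m x v) = m (expn_op (N + N) eU x) (expn_op (N + N) eV v).
Proof.
move=> xN vN; rewrite (@expn_op_cut U _ N) ?(@expn_op_cut V _ N) ?leq_addr // /expn_op.
under eq_bigr => n _ do rewrite dpow_leibniz.
rewrite (@big_triangle (fun i j => m (dpow eU i x) (dpow eV j v)) N).
  rewrite [m (\sum_(k < N) _)]linear_sum sum_lfunE.
  by apply: eq_bigr => i _; rewrite linear_sum.
move=> i j /orP [] ij; first by rewrite /dpow (iter0_le xN) // scaler0 linear0 lfunE.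
by rewrite /dpow [iter j eV v](iter0_le vN) // scaler0 linear0.
Qed.
End Exponential.

(** * Root decomposition *)

Lemma mem_bigcap_seq (K : fieldType) (T : vectType K) (I : eqType) (s : seq I)
    (U : I -> {vspace T}) x :
  reflect (forall i, i \in s -> x \in U i) (x \in (\bigcap_(i <- s) U i)%VS).
Proof.
apply: (iffP idP) => [|sU].
  elim: s => // i s IH; rewrite big_cons memv_cap => /andP [xi xs] j.
  by rewrite inE => /predU1P [->|/(IH xs)].
elim: s sU => [|i s IH] sU; first by rewrite big_nil memvf.
rewrite big_cons memv_cap sU ?mem_head // IH // => j js.
by rewrite sU // inE js orbT.
Qed.

Section Weights.
Context {R : realType}.
Local Notation C := (R[i]).
Variables (g : @lie_algebra R) (h : {vspace g}) (V : vectType C).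
Variable rho : 'Hom(g, 'End(V)).

Lemma weight_spaceP (mu : dual h) x :
  x \in weight_space rho mu <->
  forall u : subvs_of h, rho (vsval u) x = (mu u : C) *: x.
Proof.
split=> [/mem_bigcap_seq wx u|wx].
  have /coord_vbasis -> : u \in {:subvs_of h}%VS by rewrite memvf.
  rewrite !linear_sum /= sum_lfunE scaler_suml; apply: eq_bigr => i _.
  rewrite !linearZ /= lfunE /=.
  have /wx : (vbasis {:subvs_of h})`_i \in vbasis {:subvs_of h}.
    by rewrite mem_nth // size_tuple.
  rewrite memv_ker add_lfunE opp_lfunE scale_lfunE id_lfunE subr_eq0 => /eqP ->.
  by rewrite scalerA.
apply/mem_bigcap_seq => u _.
by rewrite memv_ker add_lfunE opp_lfunE scale_lfunE id_lfunE wx subrr.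
Qed.

End Weights.

Section Brackets.
Context {R : realType}.
Variable g : @lie_algebra R.
Local Notation br := (bracket g).

Lemma bracket_anti x y : br x y = - br y x.
Proof.
have := bracket_alt (l := g) (x + y); rewrite !linearD /= !add_lfunE !bracket_alt.
by rewrite add0r addr0 => /eqP; rewrite addrC addr_eq0 => /eqP.
Qed.

Lemma bracket_deriv x y z : br x (br y z) = br (br x y) z + br y (br x z).
Proof.
have := bracket_jacobi x y z; rewrite [br z (br x y)]bracket_anti.
rewrite [br z x]bracket_anti linearN /= -addrA -opprD => /eqP.
by rewrite subr_eq0 addrC => /eqP.
Qed.

End Brackets.

Section Joint.
Import VectorInternalTheory.
Context {R : realType}.
Local Notation C := (R[i]).
Variable T : vectType C.

Lemma v2rE (A : 'End(T)) x : v2r (A x) = v2r x *m f2mx A.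
Proof. by rewrite unlock /= r2vK. Qed.

Lemma diagonalizable_f2mx (A : 'End(T)) :
  diagonalizable_op A -> diagonalizable (f2mx A).
Proof.
case=> b bb bA; apply/codiagonalizable1/codiagonalizablePfull.
have [b_free b_full] := (basis_free bb, span_basis bb).
exists (size b); pose P := \matrix_(i < size b) v2r b`_i; exists P.
  rewrite -sub1mx; apply/row_subP => i; rewrite -[row i _]r2vK.
  have bx : r2v (row i 1%:M) \in <<in_tuple b>>%VS by rewrite b_full memvf.
  rewrite (coord_span bx) linear_sum /=.
  apply: summx_sub => j _; rewrite linearZ /= scalemx_sub //.
  by apply: (submx_trans _ (row_sub j P)); rewrite rowK.
rewrite /= andbT.
have [d dE] : exists d : 'rV_(size b), forall i : 'I_(size b), A b`_i = d 0 i *: b`_i.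
  have /choice [d dE] : forall i : 'I_(size b), exists a, A b`_i = a *: b`_i.
    by move=> i; apply: bA; rewrite mem_nth.
  by exists (\row_i d i) => i; rewrite mxE.
apply/diagonalizable_forPex; exists d; apply: simmxW.
  apply: inj_row_free => w wP; apply/rowP => i; rewrite mxE.
  have /freeP := b_free : free (in_tuple b); apply.
  apply: (can_inj v2rK); rewrite linear0 -wP linear_sum mulmx_sum_row.
  by apply: eq_bigr => j _; rewrite linearZ /= rowK.
apply/row_matrixP => i; rewrite !row_mul rowK -v2rE dE linearZ /=.
by rewrite row_diag_mx -scalemxAl -rowE rowK.
Qed.

(** Commuting diagonalizable operators have a common eigenbasis. The conclusion is phrased as a
    spanning principle, so that no basis has to be named. *)
Lemma joint_eigenvectors (s : seq 'End(T)) (U : {vspace T}) :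
    (forall A B x, A \in s -> B \in s -> A (B x) = B (A x)) ->
    (forall A, A \in s -> diagonalizable_op A) ->
    (forall x, (forall A, A \in s -> exists a : C, A x = a *: x) -> x \in U) ->
  U = fullv.
Proof.
move=> sC sD sU.
have [] : codiagonalizable [seq f2mx A | A <- s].
  apply/codiagonalizableP; split.
    move=> _ _ /mapP [A As ->] /mapP [B Bs ->]; apply/row_matrixP => i.
    rewrite !row_mul !rowE -[delta_mx _ _]r2vK -!v2rE.
    by rewrite sC.
  by move=> _ /mapP [A As ->]; apply/diagonalizable_f2mx/sD.
move=> P Pu /allP Pd; apply/eqP; rewrite eqEsubv subvf /=; apply/subvP => x _.
have -> : x = \sum_i (v2r x *m invmx P) 0 i *: r2v (row i P).
  apply: (can_inj v2rK); rewrite linear_sum -[LHS](mulmxKV Pu) mulmx_sum_row.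
  by apply: eq_bigr => i _; rewrite linearZ /= r2vK.
apply: memv_suml => i _; apply: memvZ; apply: sU => A As.
have /diagonalizable_forPex [d /(simmxP Pu) PA] := Pd _ (map_f _ As).
exists (d 0 i); apply: (can_inj v2rK); rewrite v2rE r2vK -row_mul PA.
by rewrite row_mul row_diag_mx -scalemxAl -rowE linearZ /= r2vK.
Qed.
End Joint.

(** * Root space decomposition and nondegeneracy of the form *)

Section Structure.
Context {R : realType}.
Local Notation C := (R[i]).
Variable G : @simple_lie R.
Local Notation br := (bracket G).
Local Notation gsp := (@weight_space R G (sh G) G br).
Local Notation sharpG := (sharp (sh G) (form G)).
Implicit Types (a b : cartan_dual G) (u : cartan G) (x y z : G).

Definition is_rep (V : vectType C) (rho : 'Hom(G, 'End(V))) : Prop :=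
  forall x y v, rho (br x y) v = rho x (rho y v) - rho y (rho x v).

Lemma bracket_rep : is_rep br.
Proof. by move=> x y z; rewrite bracket_deriv addrK. Qed.

(** Covers the action itself as well as [opK] and [opQ], so that weight shifts and conjugation by
    Tits operators are treated once for all of them. *)
Definition equivariant (V : vectType C) (rho Y : 'Hom(G, 'End(V))) : Prop :=
  forall x y v, rho x (Y y v) = Y (br x y) v + Y y (rho x v).

Lemma rep_equivariant (V : vectType C) (rho : 'Hom(G, 'End(V))) :
  is_rep rho -> equivariant rho rho.
Proof. by move=> rhoP x y v; rewrite rhoP subrK. Qed.

Lemma weight_space_shift (V : vectType C) (rho Y : 'Hom(G, 'End(V)))
    (a b : dual (sh G)) x v : equivariant rho Y ->
  x \in gsp a -> v \in weight_space rho b -> Y x v \in weight_space rho (a + b).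
Proof.
move=> eqv /weight_spaceP xa /weight_spaceP vb; apply/weight_spaceP => u.
by rewrite eqv xa vb !linearZ /= scale_lfunE add_lfunE scalerDl.
Qed.

Lemma weight_space_bracket a b x y : x \in gsp a -> y \in gsp b -> br x y \in gsp (a + b).
Proof. exact/weight_space_shift/rep_equivariant/bracket_rep. Qed.

Lemma cartan_weight0 x : x \in sh G -> x \in gsp 0.
Proof.
move=> xh; apply/weight_spaceP => u; rewrite lfunE /= scale0r.
by case: (sh_cartan G) => ab _ _; apply: ab => //; apply: subvsP.
Qed.

(** Adjoining to h an element of its centralizer keeps it abelian, so maximality applies. *)
Lemma weight0_cartan x : x \in gsp 0 -> x \in sh G.
Proof.
move=> /weight_spaceP wx; case: (sh_cartan G) => ab mx _.
have <- : (sh G + <[x]>)%VS = sh G; last by rewrite memvE addvSr.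
apply: mx (addvSl _ _) => s1 s2 /memv_addP [y yh [_ /vlineP [k ->] ->]].
move=> /memv_addP [z zh [_ /vlineP [l ->] ->]].
have hx t : t \in sh G -> br t x = 0.
  by move=> th; rewrite -(vsprojK th) wx lfunE /= scale0r.
rewrite !linearD !linearZ /= !add_lfunE !scale_lfunE bracket_alt scaler0 addr0.
by rewrite hx // scaler0 addr0 ab // add0r bracket_anti hx // oppr0 scaler0.
Qed.

Lemma root_decomp (U : {vspace G}) : (sh G <= U)%VS ->
  (forall a, a \in Phi G -> (gsp a <= U)%VS) -> U = fullv.
Proof.
move=> hU aU; case: (sh_cartan G) => ab _ dg.
apply: (@joint_eigenvectors R G [seq br (vsval u) | u <- vbasis {:cartan G}]).
- move=> _ _ x /mapP [u _ ->] /mapP [v _ ->].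
  by rewrite bracket_deriv (ab (vsval u)) ?subvsP // linear0 lfunE /= add0r.
- by move=> _ /mapP [u _ ->]; apply/dg/subvsP.
move=> x xE; have [->|x0] := eqVneq x 0; first exact: mem0v.
have {}xE u : exists k : C, br (vsval u) x = k *: x.
  have /coord_vbasis -> : u \in {:cartan G}%VS by rewrite memvf.
  have /choice [k kE] : forall i : 'I_(\dim {:cartan G}),
      exists k : C, br (vsval (vbasis {:cartan G})`_i) x = k *: x.
    by move=> i; apply/xE/map_f/mem_nth; rewrite size_tuple.
  exists (\sum_i coord (vbasis {:cartan G}) i u * k i).
  rewrite !linear_sum /= sum_lfunE scaler_suml; apply: eq_bigr => i _.
  by rewrite !linearZ /= scale_lfunE kE scalerA.
pose X := [tuple x]; have X_free : free X by rewrite seq1_free.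
(* The eigenvalue of u on x as a linear functional: the x-coordinate of [u, x], written through
   [x, u] to be linear in u by construction. *)
pose mu : dual (sh G) :=
  - ((linfun (coord X 0 : G -> C^o) : 'Hom(G, C^o)) \o (br x \o linfun vsval))%VF.
have xmu : x \in gsp mu.
  apply/weight_spaceP => u; have [k kE] := xE u; rewrite kE; congr (_ *: _).
  rewrite opp_lfunE !comp_lfunE !lfunE /= bracket_anti kE linearN opprK linearZ /=.
  by rewrite (coord_free 0 0 X_free) mulr1.
have [mu0|mu0] := eqVneq mu 0.
  by apply: (subvP hU); apply: weight0_cartan; rewrite -mu0.
apply: (subvP (aU mu _)) => //; rewrite mem_Phi /is_root mu0.
by apply: contraNneq x0 => w0; move: xmu; rewrite w0 memv0.
Qed.

Lemma formZl k x y : form G (k *: x) y = k * (form G x y : C).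
Proof. by rewrite linearZ /= scale_lfunE. Qed.
Lemma formZr k x y : form G x (k *: y) = k * (form G x y : C).
Proof. by rewrite linearZ. Qed.
Lemma formDl x y z : form G (x + y) z = form G x z + form G y z.
Proof. by rewrite linearD add_lfunE. Qed.
Lemma formNl x y : form G (- x) y = - form G x y.
Proof. by rewrite linearN opp_lfunE. Qed.
Lemma formNr x y : form G x (- y) = - form G x y.
Proof. by rewrite linearN. Qed.
Lemma brZl k x y : br (k *: x) y = k *: br x y.
Proof. by rewrite linearZ /= scale_lfunE. Qed.
Lemma brZr k x y : br x (k *: y) = k *: br x y.
Proof. by rewrite linearZ. Qed.
Lemma brDl x y z : br (x + y) z = br x z + br y z.
Proof. by rewrite linearD add_lfunE. Qed.
Lemma brDr x y z : br z (x + y) = br z x + br z y.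
Proof. by rewrite linearD. Qed.
Lemma brNr x y : br x (- y) = - br x y.
Proof. by rewrite linearN. Qed.

Lemma form_weight a b x y : a + b != 0 -> x \in gsp a -> y \in gsp b ->
  form G x y = 0.
Proof.
move=> ab0 /weight_spaceP xa /weight_spaceP yb; apply/eqP; apply: contraNT ab0.
move=> xy0; apply/eqP/lfunP => u; rewrite add_lfunE lfunE /=.
have := form_inv x (vsval u) y.
rewrite [br x _]bracket_anti xa yb formNl formZl formZr => E.
by apply: (mulIf xy0); rewrite mul0r mulrDl -[X in _ + X]E subrr.
Qed.

(** The radical is an ideal, and it is proper because some root has squared length 2. *)
Lemma form_nondegenerate x : (forall y, form G x y = 0) -> x = 0.
Proof.
move=> x0; have idI : is_ideal (lker (form G)).
  move=> y z; rewrite !memv_ker => /eqP z0; apply/eqP/lfunP => t.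
  by rewrite bracket_anti linearN opp_lfunE form_inv z0 !lfunE /= oppr0.
have xK : x \in lker (form G).
  by rewrite memv_ker; apply/eqP/lfunP => y; rewrite x0 lfunE.
have [_ /(_ _ idI) [K0|K1]] := sg_simple G; first by move: xK; rewrite K0 memv0 => /eqP.
have [a _ /eqP] := form_norm_eq G; rewrite /dual_form.
have /eqP -> : form G (vsval (sharpG a)) == 0 by rewrite -memv_ker K1 memvf.
by rewrite lfunE /= eq_sym pnatr_eq0.
Qed.

Lemma form_eq0_on x : (forall y, y \in sh G -> form G x y = 0) ->
  (forall a y, a \in Phi G -> y \in gsp a -> form G x y = 0) -> x = 0.
Proof.
move=> xh xa; apply: form_nondegenerate => y; apply/eqP; rewrite -memv_ker.
suff -> : lker (form G x) = fullv by rewrite memvf.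
apply: root_decomp => [|a aP]; apply/subvP => z zP; rewrite memv_ker; apply/eqP.
  exact: xh.
exact: xa aP zP.
Qed.

Lemma root_neq0 a : a \in Phi G -> a != 0.
Proof. by rewrite mem_Phi => /andP []. Qed.

Lemma flat_inj : injective (flat (sh G) (form G)).
Proof.
move=> u v uv; apply/eqP; rewrite -subr_eq0; apply/eqP/val_inj.
rewrite linear0 /=; apply: form_eq0_on => [y yh|a y /root_neq0 a0 ya].
  by rewrite linearB -(vsprojK yh) add_lfunE opp_lfunE -!flatE uv subrr.
apply: (form_weight (a := 0) _ _ ya); first by rewrite add0r.
by apply: cartan_weight0; rewrite rpredB ?subvsP.
Qed.

Lemma flatK : cancel (flat (sh G) (form G)) sharpG.
Proof. exact/lker0_lfunK/lker0P/flat_inj. Qed.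

Lemma sharpK : cancel sharpG (flat (sh G) (form G)).
Proof.
have bij : lker (flat (sh G) (form G)) == 0%VS by apply/lker0P/flat_inj.
move=> a; have : a \in limg (flat (sh G) (form G)).
  suff -> : limg (flat (sh G) (form G)) = fullv by rewrite memvf.
  apply/eqP; rewrite eqEdim subvf /= limg_dim_eq; last first.
    by rewrite (eqP bij) capv0.
  by rewrite !dimvf /= -[X in (_ <= X)%N]muln1; apply: leqnn.
by case/memv_imgP => u _ ->; rewrite flatK.
Qed.

Lemma form_sharp a u : form G (vsval (sharpG a)) (vsval u) = a u.
Proof. by rewrite -flatE sharpK. Qed.

Lemma ipE a b : ip a b = a (sharpG b).
Proof. by rewrite /ip /dual_form form_sharp. Qed.

Lemma ip_sym a b : ip a b = ip b a.
Proof. by rewrite /ip /dual_form form_sym. Qed.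

End Structure.

Local Opaque weight_space.

(** * Cartan integers and root strings *)

Section RootSystem.
Context {R : realType}.
Local Notation C := (R[i]).
Variable G : @simple_lie R.
Local Notation br := (bracket G).
Local Notation gsp := (@weight_space R G (sh G) G br).
Local Notation sharpG := (sharp (sh G) (form G)).
Implicit Types (a b : cartan_dual G) (u : cartan G) (x y z : G).

Lemma bracket_opp a x y : x \in gsp a -> y \in gsp (- a) ->
  br x y = form G x y *: vsval (sharpG a).
Proof.
move=> xa ya; have xyh : br x y \in sh G.
  by apply: weight0_cartan; have := weight_space_bracket xa ya; rewrite subrr.
suff E : vsproj (sh G) (br x y) = form G x y *: sharpG a.
  by rewrite -{1}(vsprojK xyh) E.
apply: flat_inj; apply/lfunP => u.
rewrite linearZ /= scale_lfunE sharpK flatE vsprojK // form_inv bracket_anti.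
have /weight_spaceP -> := ya.
by rewrite opp_lfunE scaleNr opprK formZr [_ *: _]mulrC.
Qed.

Lemma rootv_neq0 a : a \in Phi G -> rootv a != 0.
Proof.
move=> aP; apply: contra_eq_neq (rootv_norm aP) => ->.
by rewrite linear0 lfunE /= eq_sym oner_neq0.
Qed.

Lemma weight_root a x : a != 0 -> x \in gsp a -> x != 0 -> a \in Phi G.
Proof.
move=> a0 xa x0; rewrite mem_Phi /is_root a0; apply: contraNneq x0 => w0.
by move: xa; rewrite w0 memv0.
Qed.

(** Otherwise [rootv a] would be orthogonal to h and to every root space. *)
Lemma Phi_opp a : a \in Phi G -> - a \in Phi G.
Proof.
move=> aP; have a0 := root_neq0 aP; have ra := rootvP aP.
apply: contraNT (rootv_neq0 aP) => aN.
apply/eqP/form_eq0_on => [y yh|b y bP yb].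
  have a00 : a + 0 != 0 by rewrite addr0.
  exact: (form_weight a00 ra (cartan_weight0 yh)).
apply: (form_weight _ ra yb); apply: contraNneq aN => ab0.
by have -> : - a = b by apply/eqP; rewrite eq_sym -addr_eq0 addrC ab0.
Qed.

Lemma rootv_opp a : a \in Phi G -> rootv (- a) \in gsp (- a).
Proof. by move/Phi_opp/rootvP. Qed.

Lemma Hroot_sharp a : a \in Phi G -> Hroot a = vsval (sharpG a).
Proof.
move=> aP; rewrite /Hroot (bracket_opp (rootvP aP) (rootv_opp aP)).
by rewrite rootv_norm // scale1r.
Qed.

Lemma rep_nilpotent (V : vectType C) (rho : 'Hom(G, 'End(V))) a x k v :
    is_rep rho -> a != 0 -> x \in gsp a -> (\dim {:V} <= k)%N ->
  iter k (rho x) v = 0.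
Proof.
move=> rhoP a0 /weight_spaceP xa; have [u au] : exists u, a u != 0.
  apply: contrapT => au; case/eqP: a0; apply/lfunP => u; rewrite lfunE /=.
  by apply: contrapT => /eqP au0; apply: au; exists u.
apply: (lfun_shift_nilpotent (H := rho (vsval u)) _ au) => w.
by rewrite -rhoP xa linearZ /= scale_lfunE.
Qed.

Lemma last_nonzero_iter (V : vectType C) (A : 'End(V)) v N : v != 0 ->
  iter N A v = 0 -> exists2 j, iter j A v != 0 & A (iter j A v) = 0.
Proof.
move=> v0 AN; have exN : exists n, iter n A v == 0 by exists N; rewrite AN.
case: (ex_minnP exN) => -[|j] /eqP Aj jmin; first by rewrite -Aj /= eqxx in v0.
by exists j => //; apply/negP => /jmin; rewrite ltnn.
Qed.

Lemma center_trivial x : (forall y, br x y = 0) -> x = 0.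
Proof.
move=> x0; have idI : is_ideal (lker br).
  move=> y z; rewrite !memv_ker => /eqP z0.
  by rewrite bracket_anti z0 lfunE /= oppr0 linear0.
have xK : x \in lker br by rewrite memv_ker; apply/eqP/lfunP => y; rewrite x0 lfunE.
have [[y [z yz]] /(_ _ idI) [K0|K1]] := sg_simple G.
  by move: xK; rewrite K0 memv0 => /eqP.
by case: yz; have /eqP -> : br y == 0; rewrite ?lfunE // -memv_ker K1 memvf.
Qed.

Lemma cartan_eq0 u : (forall b, b \in Phi G -> b u = 0) -> u = 0.
Proof.
move=> u0; apply/val_inj; rewrite linear0; apply: center_trivial => y.
apply/eqP; rewrite -memv_ker; suff -> : lker (br (vsval u)) = fullv by rewrite memvf.
apply: root_decomp => [|a aP]; apply/subvP => z zP; rewrite memv_ker; apply/eqP.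
  have /weight_spaceP -> := cartan_weight0 zP.
  by rewrite lfunE /= scale0r.
by have /weight_spaceP -> := zP; rewrite u0 // scale0r.
Qed.

Lemma sharpN a : sharpG (- a) = - sharpG a. Proof. exact: linearN. Qed.

Lemma sharpD a b : sharpG (a + b) = sharpG a + sharpG b.
Proof. exact: linearD. Qed.

Lemma sharpZ (k : C) a : sharpG (k *: a) = k *: sharpG a.
Proof. exact: linearZ. Qed.

Lemma ipDl a b c : ip (a + b) c = ip a c + ip b c.
Proof. by rewrite !ipE add_lfunE. Qed.
Lemma ipDr a b c : ip a (b + c) = ip a b + ip a c.
Proof. by rewrite ip_sym ipDl !(ip_sym a). Qed.
Lemma ipNl a b : ip (- a) b = - ip a b.
Proof. by rewrite !ipE opp_lfunE. Qed.
Lemma ipNr a b : ip a (- b) = - ip a b.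
Proof. by rewrite ip_sym ipNl ip_sym. Qed.
Lemma ipZl (k : C) a b : ip (k *: a) b = k * ip a b.
Proof. by rewrite !ipE scale_lfunE. Qed.
Lemma ipZr (k : C) a b : ip a (k *: b) = k * ip a b.
Proof. by rewrite ip_sym ipZl ip_sym. Qed.
Lemma ipMnl a b n : ip (a *+ n) b = n%:R * ip a b.
Proof. by rewrite -scaler_nat ipZl. Qed.

Lemma ip_subZ (k : C) a b :
  ip (a - k *: b) (a - k *: b) = ip a a - 2 * k * ip a b + k ^+ 2 * ip b b.
Proof. rewrite ipDl ipNl !ipDr !ipNr !ipZl !ipZr [ip b a]ip_sym; ring. Qed.

Section Representation.
Variables (V : vectType C) (rho : 'Hom(G, 'End(V))).
Hypothesis rhoP : is_rep rho.

Lemma rep_weight_iter (a b : dual (sh G)) x v k : x \in gsp a ->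
  v \in weight_space rho b -> iter k (rho x) v \in weight_space rho (b + a *+ k).
Proof.
move=> xa vb; elim: k => [|k IH]; first by rewrite addr0.
rewrite mulrS addrCA; apply: weight_space_shift => //.
exact: rep_equivariant.
Qed.

(** Stated without dividing by (a, a): that roots are not isotropic is deduced from this lemma, by
    way of [root_integer]. *)
Lemma highest_weight_nat a b v : a \in Phi G -> v \in weight_space rho b ->
  v != 0 -> rho (rootv a) v = 0 ->
  exists2 k, (k < \dim {:V})%N & ip b a = k%:R * (ip a a / 2).
Proof.
rewrite [ip b a]ipE => aP vb v0 ev; have a0 := root_neq0 aP.
have fa := rootv_opp aP.
apply: (@sl2_highest_weight _ V (rho (rootv a)) (rho (rootv (- a)))
  (rho (vsval (sharpG a))) _ _ _ _ v) => //.
- move=> x; apply/eqP; rewrite addrC -subr_eq -rhoP.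
  by rewrite -Hroot_sharp.
- move=> x; apply/eqP; rewrite addrC -subr_eq -rhoP.
  have /weight_spaceP -> := fa.
  by rewrite linearZ /= scale_lfunE opp_lfunE ipE scaleNr.
- by have /weight_spaceP -> := vb.
apply: (rep_nilpotent _ rhoP _ fa); rewrite ?oppr_eq0 //.
Qed.
End Representation.

Lemma ad_top a b x : a \in Phi G -> x \in gsp b -> x != 0 ->
  exists j : nat, [/\ iter j (br (rootv a)) x != 0,
    br (rootv a) (iter j (br (rootv a)) x) = 0 &
    exists k : nat, ip (b + a *+ j) a = k%:R * (ip a a / 2)].
Proof.
move=> aP xb x0; have a0 := root_neq0 aP; have ra := rootvP aP.
have nil := rep_nilpotent x (@bracket_rep R G) a0 ra (leqnn _).
have [j j0 ej] := last_nonzero_iter x0 nil.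
have [k _ kE] := highest_weight_nat (@bracket_rep R G) aP
  (rep_weight_iter (@bracket_rep R G) j ra xb) j0 ej.
by exists j; split=> //; exists k.
Qed.

(** Raising X_b by X_a ends in a highest weight vector of weight b + j a, whose natural number k
    gives the Cartan integer k - 2j. *)
Lemma root_integer a b : a \in Phi G -> b \in Phi G ->
  exists n : int, ip b a = n%:~R * (ip a a / 2).
Proof.
move=> aP bP; have [j [_ _ [k]]] := ad_top aP (rootvP bP) (rootv_neq0 bP).
rewrite ipDl ipMnl => E.
exists (k%:Z - (2 * j)%:Z); by rewrite rmorphB /= mulrBl -!pmulrn -E natrM; field.
Qed.

(** By integrality an isotropic root would be orthogonal to all roots. *)
Lemma ip_neq0 a : a \in Phi G -> ip a a != 0.
Proof.
move=> aP; apply/negP => /eqP aa0; have := root_neq0 aP.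
suff ta0 : sharpG a = 0 by rewrite -(sharpK a) ta0 linear0 eqxx.
apply: cartan_eq0 => b bP; rewrite -ipE.
by have [n ->] := root_integer aP bP; rewrite aa0 mul0r mulr0.
Qed.

(** The part y of x orthogonal to X_{-a} is killed by X_{-a}. If nonzero, it is a highest weight
    vector for the root -a whose weight a pairs with -a to -(a, a), a negative multiple of (a,
    a)/2. *)
Lemma root_space_line a x : a \in Phi G -> x \in gsp a -> exists k : C, x = k *: rootv a.
Proof.
move=> aP xa; have ra := rootvP aP; have rNa := rootv_opp aP.
exists (form G x (rootv (- a))).
pose y := x - form G x (rootv (- a)) *: rootv a.
suff : y = 0 by move/eqP; rewrite subr_eq0 => /eqP.
have ya : y \in gsp a := rpredB xa (rpredZ _ ra).
have y0 : form G y (rootv (- a)) = 0.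
  by rewrite formDl formNl formZl rootv_norm // mulr1 subrr.
apply: contrapT => /eqP yn0.
have fy : br (rootv (- a)) y = 0.
  by rewrite bracket_anti (bracket_opp ya rNa) y0 scale0r oppr0.
have [k _] := highest_weight_nat (@bracket_rep R G) (Phi_opp aP) ya yn0 fy.
rewrite !ipNr !ipNl opprK => /eqP; rewrite eqr_oppLR -mulrN.
have -> : k%:R * - (ip a a / 2) = - (k%:R / 2) * ip a a by field.
rewrite -{1}[ip a a]mul1r => /eqP /(mulIf (ip_neq0 aP)) E.
by have : (0 : C) < 1 := ltr01; rewrite E oppr_gt0 le_gtF // divr_ge0 // ler0n.
Qed.

(* From a vector of weight 2a, raise to a highest weight vector v of weight
   (2 + j)a and lower back to the line of e = [rootv a]: as [e, e] = 0, the chain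
   formula would end there, before the highest weight of v allows it. *)
Lemma double_root a : a \in Phi G -> a + a \notin Phi G.
Proof.
move=> aP; apply/negP => aaP.
have [j [j0 ej _]] := ad_top aP (rootvP aaP) (rootv_neq0 aaP).
have rhoP := @bracket_rep R G; have ra := rootvP aP; have rNa := rootv_opp aP.
set v := iter j _ _ in j0 ej.
have vw : v \in gsp (a + a + a *+ j) := rep_weight_iter rhoP j ra (rootvP aaP).
pose f := br (rootv (- a)).
have fv m : iter m f v \in gsp (a + a + a *+ j + (- a) *+ m).
  exact: (rep_weight_iter rhoP m rNa vw).
have ef x : br (rootv a) (f x) = f (br (rootv a) x) + br (vsval (sharpG a)) x.
  by apply/eqP; rewrite addrC -subr_eq -rhoP -Hroot_sharp.
have hf x : br (vsval (sharpG a)) (f x)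
    = f (br (vsval (sharpG a)) x) - ip a a *: f x.
  apply/eqP; rewrite addrC -subr_eq -rhoP.
  by have /weight_spaceP -> := rNa; rewrite brZl opp_lfunE ipE scaleNr.
have hv : br (vsval (sharpG a)) v = ((2 + j%:R) * ip a a) *: v.
  have /weight_spaceP -> := vw; congr (_ *: _).
  rewrite -ipE !ipDl ipMnl; ring.
have aa0 := ip_neq0 aP.
have fj0 : iter j f v = 0.
  have [c cE] : exists c : C, iter j.+1 f v = c *: rootv a.
    have w : a + a + a *+ j + (- a) *+ j.+1 = a.
      by rewrite mulNrn mulrSr opprD addrA !addrK.
    by have := fv j.+1; rewrite w => /(root_space_line aP).
  have := sl2_chain ef hf j ej hv; rewrite cE brZr bracket_alt scaler0.
  move/esym/eqP; rewrite scaler_eq0 => /orP [|/eqP //].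
  have -> : j.+1%:R * ((2 + j%:R) * ip a a - j%:R * (ip a a / 2))
    = (j.+1 * (4 + j))%:R / 2 * ip a a :> C by rewrite natrM natrD; field.
  by rewrite !mulf_eq0 (negPf aa0) invr_eq0 !pnatr_eq0.
have [m mj] := sl2_highest_weight ef hf ej hv j0 fj0.
have -> : m%:R * (ip a a / 2) = m%:R / 2 * ip a a by field.
move/(mulIf aa0) => E.
have /eqP : ((2 + j) * 2)%:R = m%:R :> C by rewrite natrM natrD E; field.
by rewrite eqr_nat; move: mj; clear; lia.
Qed.

(** Here X_b is itself a highest weight vector for a; what matters later is the sign of the Cartan
    integer. *)
Lemma root_string a b : a \in Phi G -> b \in Phi G -> a + b != 0 ->
  a + b \notin Phi G -> exists k : nat, ip b a = k%:R * (ip a a / 2).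
Proof.
move=> aP bP ab0 abP.
have e0 : br (rootv a) (rootv b) = 0.
  apply: contraNeq abP; apply: weight_root => //.
  by apply: weight_space_bracket; apply: rootvP.
have [k _ kE] := highest_weight_nat (@bracket_rep R G) aP (rootvP bP) (rootv_neq0 bP) e0.
by exists k.
Qed.

End RootSystem.

(** * Tits operators *)

Section Nilexp.
Context {R : realType}.
Local Notation C := (R[i]).

Lemma nilexpE (V : vectType C) (A : 'End(V)) v :
  nilexp A v = expn_op (\dim {:V}).+1 A v.
Proof.
rewrite /nilexp /expn_op sum_lfunE; apply: eq_bigr => k _.
rewrite scale_lfunE; congr (_ *: _); elim: (val k) => /= [|j <-].
  by rewrite id_lfunE.
by rewrite comp_lfunE.
Qed.

Lemma nilexp_cut (V : vectType C) (A : 'End(V)) N M v :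
    iter (\dim {:V}) A v = 0 -> iter N A v = 0 -> (N <= M)%N ->
  nilexp A v = expn_op M A v.
Proof.
move=> A0 AN NM; rewrite nilexpE; case: (leqP N (\dim {:V}).+1) => ND.
  by rewrite (expn_op_cut AN ND) (expn_op_cut AN NM).
have DM : (\dim {:V} <= M)%N := leq_trans (ltnW (ltnW ND)) NM.
by rewrite (expn_op_cut A0 (leqnSn _)) (expn_op_cut A0 DM).
Qed.

Lemma nilexp2 (V : vectType C) (A : 'End(V)) v :
  iter (\dim {:V}) A v = 0 -> A (A v) = 0 -> nilexp A v = v + A v.
Proof.
move=> A0 A2; rewrite (nilexp_cut A0 (N := 2) (M := 2)) //.
by rewrite /expn_op !big_ord_recl big_ord0 /dpow /= invr1 !scale1r addr0.
Qed.

Lemma nilexp3 (V : vectType C) (A : 'End(V)) v :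
    iter (\dim {:V}) A v = 0 -> A (A (A v)) = 0 ->
  nilexp A v = v + A v + 2^-1 *: A (A v).
Proof.
move=> A0 A3; rewrite (nilexp_cut A0 (N := 3) (M := 3)) //.
by rewrite /expn_op !big_ord_recl big_ord0 /dpow /= invr1 !scale1r addr0 addrA.
Qed.

Lemma nilexp_bilin (U V W : vectType C) (m : 'Hom(U, 'Hom(V, W)))
    (eU : 'End(U)) (eV : 'End(V)) (eW : 'End(W)) x v :
    (forall x v, eW (m x v) = m (eU x) v + m x (eV v)) ->
    iter (\dim {:U}) eU x = 0 -> iter (\dim {:V}) eV v = 0 ->
    iter (\dim {:W}) eW (m x v) = 0 ->
  nilexp eW (m x v) = m (nilexp eU x) (nilexp eV v).
Proof.
move=> eqv x0 v0 w0.
pose N := (\dim {:U} + (\dim {:V} + \dim {:W}))%N.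
have NU : (\dim {:U} <= N)%N by rewrite /N; lia.
have NV : (\dim {:V} <= N)%N by rewrite /N; lia.
have NW : (\dim {:W} <= N)%N by rewrite /N; lia.
rewrite !(nilexp_cut (N := N) (M := N + N)) ?leq_addr //; try exact: (iter0_le _ NU);
  try exact: (iter0_le _ NV); try exact: (iter0_le _ NW).
by apply: expn_op_bilin => //; [exact: (iter0_le _ NU)|exact: (iter0_le _ NV)].
Qed.
End Nilexp.

Section TitsAction.
Context {R : realType}.
Local Notation C := (R[i]).
Variable G : @simple_lie R.
Local Notation br := (bracket G).
Local Notation gsp := (@weight_space R G (sh G) G br).
Local Notation sharpG := (sharp (sh G) (form G)).
Implicit Types (a b : cartan_dual G) (u : cartan G) (x y z : G).

(** [tits] for an arbitrary representation, to be used on the adjoint one as well. *)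
Definition rep_tits (V : vectType C) (rho : 'Hom(G, 'End(V))) (e f : G) : 'End(V) :=
  (nilexp (rho e) \o nilexp (- rho f) \o nilexp (rho e))%VF.

(** Equivariance says that e and f act as derivations on the pairing x, v |-> Y x v, so each of the
    three exponentials is multiplicative on it. *)
Lemma rep_tits_equivariant (V : vectType C) (rho Y : 'Hom(G, 'End(V))) a e f x v :
    is_rep rho -> equivariant rho Y -> a \in Phi G -> sl2_pair a e f ->
  rep_tits rho e f (Y x v) = Y (rep_tits br e f x) (rep_tits rho e f v).
Proof.
move=> rhoP eqv aP [ea fa _].
have a0 := root_neq0 aP; have Na0 : - a != 0 by rewrite oppr_eq0.
have nfa : - f \in gsp (- a) by rewrite rpredN.
have nilE w : iter (\dim {:V}) (rho e) w = 0 := rep_nilpotent w rhoP a0 ea (leqnn _).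
have nilF w : iter (\dim {:V}) (- rho f) w = 0.
  by rewrite -linearN; apply: (rep_nilpotent w rhoP Na0 nfa (leqnn _)).
have nile y : iter (\dim {:G}) (br e) y = 0 :=
  rep_nilpotent y (@bracket_rep R G) a0 ea (leqnn _).
have nilf y : iter (\dim {:G}) (- br f) y = 0.
  by rewrite -linearN; apply: (rep_nilpotent y (@bracket_rep R G) Na0 nfa (leqnn _)).
have eqvN y w : (- rho f) (Y y w) = Y ((- br f) y) w + Y y ((- rho f) w).
  by rewrite !opp_lfunE eqv !linearN opprD opp_lfunE.
have stepE y w : nilexp (rho e) (Y y w) = Y (nilexp (br e) y) (nilexp (rho e) w).
  exact: nilexp_bilin (eqv e) (nile y) (nilE w) (nilE _).
have stepF y w : nilexp (- rho f) (Y y w)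
    = Y (nilexp (- br f) y) (nilexp (- rho f) w).
  exact: nilexp_bilin eqvN (nilf y) (nilF w) (nilF _).
by rewrite /rep_tits !comp_lfunE stepE stepF stepE.
Qed.

Lemma cartan_bracket u x a : x \in gsp a -> br (vsval u) x = a u *: x.
Proof. by move/weight_spaceP. Qed.

Lemma coroot_hE a : a \in Phi G -> coroot_h a = (2 / ip a a) *: sharpG a.
Proof. by move=> aP; rewrite /coroot_h /coroot Hroot_sharp // -linearZ vsvalK. Qed.

Lemma corootE a : a \in Phi G -> coroot a = vsval (coroot_h a).
Proof. by move=> aP; rewrite coroot_hE // /coroot Hroot_sharp. Qed.

Lemma root_coroot a b : a \in Phi G -> b (coroot_h a) = 2 * ip b a / ip a a.
Proof. by move=> aP; rewrite coroot_hE // linearZ /= -ipE [LHS]/(_ * _) mulrAC. Qed.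

Lemma root_coroot_self a : a \in Phi G -> a (coroot_h a) = 2.
Proof. by move=> aP; rewrite root_coroot // mulfK ?ip_neq0. Qed.

Lemma reflE a u : refl a u = u - a u *: coroot_h a.
Proof.
pose F (u : cartan G) : cartan G := u - a u *: coroot_h a.
have F_lin : linear F.
  move=> k x y; rewrite /F linearP scalerDl -scalerA scalerBr opprD !addrA.
  by congr (_ - _); rewrite addrAC.
pose FM := GRing.isLinear.Build C _ _ *:%R F F_lin.
pose FL : {linear cartan G -> cartan G} := HB.pack F FM.
by rewrite /refl (_ : linfun _ = linfun FL) // lfunE.
Qed.

Lemma sl2_pair_exists a : a \in Phi G ->
  sl2_pair a (rootv a) ((2 / ip a a) *: rootv (- a)).
Proof.
move=> aP; split; [exact: rootvP|exact/rpredZ/rootv_opp|].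
by rewrite brZr.
Qed.

(** A computation in the span of u, e, f and the coroot, where all exponential series stop at the
    quadratic term. *)
Lemma tits_cartan a e f u : a \in Phi G -> sl2_pair a e f ->
  rep_tits br e f (vsval u) = vsval (refl a u).
Proof.
move=> aP [ea fa ef]; have a0 := root_neq0 aP; have Na0 : - a != 0 by rewrite oppr_eq0.
have nfa : - f \in gsp (- a) by rewrite rpredN.
have nile y : iter (\dim {:G}) (br e) y = 0 :=
  rep_nilpotent y (@bracket_rep R G) a0 ea (leqnn _).
have nilf y : iter (\dim {:G}) (- br f) y = 0.
  by rewrite -linearN; apply: (rep_nilpotent y (@bracket_rep R G) Na0 nfa (leqnn _)).
set h := vsval (coroot_h a); have {}ef : br e f = h by rewrite ef corootE.
have ee : br e e = 0 := bracket_alt e; have ff : br f f = 0 := bracket_alt f.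
have fe : br f e = - h by rewrite bracket_anti ef.
have eh : br e h = - (2 *: e).
  by rewrite bracket_anti (cartan_bracket _ ea) root_coroot_self.
have fh : br f h = 2 *: f.
  by rewrite bracket_anti (cartan_bracket _ fa) opp_lfunE root_coroot_self // scaleNr opprK.
have eu w : br e (vsval w) = - (a w *: e) by rewrite bracket_anti (cartan_bracket _ ea).
have fu w : br f (vsval w) = a w *: f.
  by rewrite bracket_anti (cartan_bracket _ fa) opp_lfunE scaleNr opprK.
have Ee : nilexp (br e) e = e by rewrite nilexp2 ?ee ?linear0 ?addr0.
have Eu w : nilexp (br e) (vsval w) = vsval w - a w *: e.
  by rewrite nilexp2 // eu // brNr brZr ee scaler0 oppr0.
have Fu w : nilexp (- br f) (vsval w) = vsval w - a w *: f.
  by rewrite nilexp2 // !opp_lfunE fu // brNr brZr ff scaler0 !oppr0.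
have Fe : nilexp (- br f) e = e + h - f.
  rewrite nilexp3 // !opp_lfunE !fe ?brNr ?opprK /= ?fh ?brZr ?ff ?scaler0 ?oppr0 //.
  by rewrite scalerN scalerA mulVf ?pnatr_eq0 // scale1r.
have Ef : nilexp (br e) f = f + h - e.
  rewrite nilexp3 // !ef !eh ?brNr ?brZr ?ee ?scaler0 ?oppr0 //.
  by rewrite scalerN scalerA mulVf ?pnatr_eq0 // scale1r.
have -> : vsval (refl a u) = vsval u - a u *: h by rewrite reflE.
rewrite /rep_tits !comp_lfunE Eu.
move: (nilexp (br e)) (nilexp (- br f)) Ee Eu Fu Fe Ef => E F Ee Eu Fu Fe Ef.
have Eh : E h = h - 2 *: e by rewrite Eu root_coroot_self.
set t := a u.
have -> : F (vsval u - t *: e) = vsval u - t *: e - t *: h.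
  by rewrite linearB linearZ /= Fu Fe scalerBr scalerDr opprB addrA subrK opprD addrA.
rewrite 2!linearB !linearZ /= Eu Ee Eh -/t !scalerN scalerBr scalerA mulrC -scalerA opprB.
by rewrite -[_ - _ - t *: e]addrA -opprD addrA scaler_nat mulr2n subrK.
Qed.

Definition dual_refl a b : cartan_dual G := b - (2 * ip b a / ip a a) *: a.

Lemma dual_refl_refl a b u : a \in Phi G -> b (refl a u) = dual_refl a b u.
Proof.
move=> aP; rewrite reflE linearB linearZ /= root_coroot // /dual_refl add_lfunE opp_lfunE.
by rewrite scale_lfunE [_ *: _]mulrC.
Qed.

Lemma sharp_dual_refl a b : a \in Phi G -> sharpG (dual_refl a b) = refl a (sharpG b).
Proof.
move=> aP; rewrite reflE coroot_hE // linearB linearZ /= -ipE scalerA.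
by congr (_ - _ *: _); rewrite [ip a b]ip_sym [RHS]mulrCA mulrA.
Qed.

Lemma dual_refl_ip a b c : a \in Phi G -> ip (dual_refl a b) (dual_refl a c) = ip b c.
Proof.
move=> aP; have aa0 := ip_neq0 aP.
rewrite /dual_refl !(ipDl, ipDr, ipNl, ipNr, ipZl, ipZr) [ip a c]ip_sym; field.
exact: aa0.
Qed.

Lemma dual_reflN a b : dual_refl a (- b) = - dual_refl a b.
Proof. by rewrite /dual_refl ipNl mulrN mulNr scaleNr opprD. Qed.

Lemma dual_refl_self a : a \in Phi G -> dual_refl a a = - a.
Proof.
move=> aP; rewrite /dual_refl mulfK ?ip_neq0 // scaler_nat mulr2n opprD addrA subrr.
by rewrite add0r.
Qed.

Lemma dual_reflK a b : a \in Phi G -> dual_refl a (dual_refl a b) = b.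
Proof.
move=> aP; rewrite {1}/dual_refl.
have -> : ip (dual_refl a b) a = - ip b a.
  by rewrite -(dual_refl_ip b a aP) dual_refl_self // ipNr opprK.
by rewrite /dual_refl mulrN mulNr scaleNr opprK subrK.
Qed.

Lemma rep_titsE (V : vectType C) (rho : 'Hom(G, 'End(V))) e f v :
  rep_tits rho e f v = nilexp (rho e) (nilexp (- rho f) (nilexp (rho e) v)).
Proof. by rewrite /rep_tits !comp_lfunE. Qed.
End TitsAction.

(** * Reflections on the roots and on the zero weight space *)

Section Reflections.
Context {R : realType}.
Local Notation C := (R[i]).
Variable G : @simple_lie R.
Local Notation br := (bracket G).
Local Notation gsp := (@weight_space R G (sh G) G br).
Local Notation sharpG := (sharp (sh G) (form G)).
Implicit Types (a b : cartan_dual G) (u : cartan G) (x y z : G).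

Lemma reflK a u : a \in Phi G -> refl a (refl a u) = u.
Proof.
move=> aP; rewrite [refl a (refl a u)]reflE dual_refl_refl // dual_refl_self // opp_lfunE.
by rewrite scaleNr opprK reflE subrK.
Qed.

Lemma tits_adj_bracket a e f x y : a \in Phi G -> sl2_pair a e f ->
  rep_tits br e f (br x y) = br (rep_tits br e f x) (rep_tits br e f y).
Proof.
move=> aP ef; apply: (rep_tits_equivariant _ _ (@bracket_rep R G) _ aP ef).
exact/rep_equivariant/bracket_rep.
Qed.

Lemma tits_adj_form a e f x y : a \in Phi G -> sl2_pair a e f ->
  form G (rep_tits br e f x) (rep_tits br e f y) = form G x y.
Proof.
move=> aP [ea fa _].
have a0 := root_neq0 aP; have Na0 : - a != 0 by rewrite oppr_eq0.
have nfa : - f \in gsp (- a) by rewrite rpredN.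
have nile z : iter (\dim {:G}) (br e) z = 0 :=
  rep_nilpotent z (@bracket_rep R G) a0 ea (leqnn _).
have nilf z : iter (\dim {:G}) (- br f) z = 0.
  by rewrite -linearN; apply: (rep_nilpotent z (@bracket_rep R G) Na0 nfa (leqnn _)).
(* The form is an invariant pairing into the trivial module, where every exponential is the
   identity. *)
pose Z : 'End(C^o) := 0.
have nil0 (k : C^o) : iter (\dim {:C^o}) Z k = 0.
  by rewrite dimvf /= lfunE.
have Z1 (k : C^o) : nilexp Z k = k by rewrite nilexp2 // lfunE /= ?addr0.
have stepE z t : form G (nilexp (br e) z) (nilexp (br e) t) = form G z t.
  rewrite -(nilexp_bilin (eW := Z)) ?Z1 // => p q.
  by rewrite lfunE /= bracket_anti formNl form_inv addNr.
have stepF z t : form G (nilexp (- br f) z) (nilexp (- br f) t) = form G z t.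
  rewrite -(nilexp_bilin (eW := Z)) ?Z1 // => p q.
  rewrite lfunE /= !opp_lfunE [br f p]bracket_anti opprK form_inv formNr addrC.
  by rewrite addNr.
by rewrite !rep_titsE stepE stepF stepE.
Qed.

Lemma tits_adj_neq0 a e f x : a \in Phi G -> sl2_pair a e f -> x != 0 ->
  rep_tits br e f x != 0.
Proof.
move=> aP ef; apply: contraNneq => x0; apply/eqP/form_nondegenerate => y.
by rewrite -(tits_adj_form x y aP ef) x0 linear0 lfunE.
Qed.

Lemma tits_adj_weight a b e f x : a \in Phi G -> sl2_pair a e f -> x \in gsp b ->
  rep_tits br e f x \in gsp (dual_refl a b).
Proof.
move=> aP ef xb; apply/weight_spaceP => u.
rewrite -{1}(reflK u aP) -(tits_cartan _ aP ef) -(tits_adj_bracket _ _ aP ef).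
by rewrite (cartan_bracket _ xb) linearZ /= dual_refl_refl.
Qed.

(** The Tits operator of a preserves the form, hence carries X_b to a nonzero vector, and this
    vector has weight s_a b. *)
Lemma dual_refl_Phi a b : a \in Phi G -> b \in Phi G -> dual_refl a b \in Phi G.
Proof.
move=> aP bP; have ef := sl2_pair_exists aP.
apply: (weight_root _ (tits_adj_weight aP ef (rootvP bP))); last first.
  exact: tits_adj_neq0 ef (rootv_neq0 bP).
apply: contraNneq (root_neq0 bP) => s0.
by rewrite -(dual_reflK b aP) s0 /dual_refl ipE lfunE /= mulr0 mul0r scale0r subr0.
Qed.

Lemma coroot_dual_refl a b : a \in Phi G -> b \in Phi G ->
  coroot_h (dual_refl a b) = refl a (coroot_h b).
Proof.
move=> aP bP; rewrite !coroot_hE ?dual_refl_Phi // dual_refl_ip // sharp_dual_refl //.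
by rewrite [in RHS]linearZ.
Qed.

Lemma tits_adj_sl2_pair a b e f e' f' : a \in Phi G -> b \in Phi G ->
    sl2_pair a e f -> sl2_pair b e' f' ->
  sl2_pair (dual_refl a b) (rep_tits br e f e') (rep_tits br e f f').
Proof.
move=> aP bP ef [eb fb ef']; split.
- exact: tits_adj_weight aP ef eb.
- by rewrite -dual_reflN; apply: tits_adj_weight aP ef fb.
rewrite -(tits_adj_bracket _ _ aP ef) ef' !corootE ?dual_refl_Phi // (tits_cartan _ aP ef).
by rewrite coroot_dual_refl.
Qed.

Section SmallRep.
Variables (V : vectType C) (rho : 'Hom(G, 'End(V))).
Hypothesis rhoP : is_rep rho.
Hypothesis small : forall a, a \in Phi G -> weight_space rho (a + a : dual (sh G)) = 0%VS.
Local Notation V0 := (weight_space rho (0 : dual (sh G))).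

(* With f normalized so that (e, f) is an sl2-pair, this is 1 - f e. On the zero
   weight space of a small module f e f e = 2 f e, so it is an involution. *)
Definition zero_refl a : 'End(V) :=
  \1%VF - (2 / ip a a) *: (rho (rootv (- a)) \o rho (rootv a))%VF.

Lemma zero_reflE a v : zero_refl a v = v - (2 / ip a a) *: rho (rootv (- a)) (rho (rootv a) v).
Proof. by rewrite /zero_refl add_lfunE opp_lfunE scale_lfunE comp_lfunE id_lfunE. Qed.

Lemma rep_shift (a b : dual (sh G)) x v : x \in gsp a -> v \in weight_space rho b ->
  rho x v \in weight_space rho (a + b).
Proof. exact/weight_space_shift/rep_equivariant. Qed.

Lemma small_sq a x y v : a \in Phi G -> x \in gsp a -> y \in gsp a -> v \in V0 ->
  rho x (rho y v) = 0.
Proof.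
move=> aP xa ya v0; apply/eqP; rewrite -memv0 -(small aP).
by have := rep_shift xa (rep_shift ya v0); rewrite addr0.
Qed.

Lemma lower_raise_V0 a x y v : x \in gsp a -> y \in gsp (- a) -> v \in V0 -> rho y (rho x v) \in V0.
Proof.
by move=> xa ya v0; have := rep_shift ya (rep_shift xa v0); rewrite addr0 addNr.
Qed.

Lemma rep_cartan0 u v : v \in V0 -> rho (vsval u) v = 0.
Proof. by move/weight_spaceP => ->; rewrite lfunE /= scale0r. Qed.

(** Independence of the sl2-pair: e = k X_a and f = l X_{-a} with k l = 2 / (a, a), because [e, f]
    is the coroot. *)
Lemma sl2_pair_zero_refl a e f v : a \in Phi G -> sl2_pair a e f -> v \in V0 ->
  zero_refl a v = v - rho f (rho e v).
Proof.
move=> aP [ea fa ef] v0; rewrite zero_reflE; congr (_ - _).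
have [k eE] := root_space_line aP ea.
have [l fE] := root_space_line (Phi_opp aP) fa.
have kl : k * l = 2 / ip a a.
  have H0 : Hroot a != 0.
    rewrite Hroot_sharp //; apply: contraNneq (ip_neq0 aP) => s0.
    by rewrite /ip /dual_form s0 linear0.
  apply/eqP; rewrite -subr_eq0; apply: contraNT H0 => kl0.
  have /eqP := ef; rewrite eE fE brZl brZr scalerA -subr_eq0 -scalerBl.
  by rewrite scaler_eq0 (negPf kl0).
rewrite eE fE !linearZ /= !scale_lfunE linearZ /= scalerA [l * k]mulrC.
by rewrite kl.
Qed.

(** Smallness makes e^2 and f^2 vanish on V[0], where e and f also commute. Only v, e v, f v and f e
    v occur, with e f e v = 2 e v and f f e v = 2 f v. *)
Lemma tits_zero_refl a e f v : a \in Phi G -> sl2_pair a e f -> v \in V0 ->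
  rep_tits rho e f v = zero_refl a v.
Proof.
move=> aP efP v0; rewrite (sl2_pair_zero_refl aP efP v0) rep_titsE.
case: efP => ea fa ef.
have a0 := root_neq0 aP; have Na0 : - a != 0 by rewrite oppr_eq0.
have NaP := Phi_opp aP.
have nfa : - f \in gsp (- a) by rewrite rpredN.
have nile w : iter (\dim {:V}) (rho e) w = 0 := rep_nilpotent w rhoP a0 ea (leqnn _).
have nilf w : iter (\dim {:V}) (- rho f) w = 0.
  by rewrite -linearN; apply: (rep_nilpotent w rhoP Na0 nfa (leqnn _)).
have efE w : w \in V0 -> rho e (rho f w) = rho f (rho e w).
  move=> w0; apply/eqP; rewrite -subr_eq0 -rhoP ef corootE // rep_cartan0 //.
have ee w : w \in V0 -> rho e (rho e w) = 0 by move=> w0; exact: (small_sq aP ea ea w0).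
have ff w : w \in V0 -> rho f (rho f w) = 0 by move=> w0; exact: (small_sq NaP fa fa w0).
set x := rho f (rho e v); have xV : x \in V0 := lower_raise_V0 ea fa v0.
have ex : rho e x = 2 *: rho e v.
  apply/eqP; rewrite -subr_eq0 -(root_coroot_self aP) /x.
  have /weight_spaceP <- : rho e v \in weight_space rho (a : dual (sh G)).
    by have := rep_shift ea v0; rewrite addr0.
  by rewrite -corootE // -ef rhoP ee // linear0 subr0 subrr.
have fx : rho f x = 2 *: rho f v.
  have := rhoP e f (rho f v); rewrite ff // linear0 sub0r efE // -/x ef corootE //.
  have /weight_spaceP -> : rho f v \in weight_space rho (- a : dual (sh G)).
    by have := rep_shift fa v0; rewrite addr0.
  by rewrite opp_lfunE root_coroot_self // scaleNr => /oppr_inj ->.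
have FF w : (- rho f) ((- rho f) w) = rho f (rho f w).
  by rewrite !opp_lfunE linearN opprK.
have Ev w : w \in V0 -> nilexp (rho e) w = w + rho e w.
  by move=> w0; rewrite nilexp2 ?ee.
have Fv : nilexp (- rho f) v = v - rho f v.
  by rewrite nilexp2 ?FF ?ff // opp_lfunE.
have Fe : nilexp (- rho f) (rho e v) = rho e v - x + rho f v.
  rewrite nilexp3 ?FF //.
    by rewrite opp_lfunE -/x fx scalerA mulVf ?pnatr_eq0 // scale1r.
  by rewrite opp_lfunE -/x linearN linearN /= ff // oppr0.
have Ee : nilexp (rho e) (rho e v) = rho e v.
  by rewrite (nilexp2 (nile _)) (ee v v0) ?linear0 ?addr0.
rewrite (Ev v v0) linearD /= Fv Fe.
have -> : v - rho f v + (rho e v - x + rho f v) = v + rho e v - x.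
  by rewrite [_ - x + _]addrC addrA subrK addrA.
rewrite linearB linearD /= Ee (Ev v v0) (Ev x xV) ex scaler_nat mulr2n opprD.
by rewrite [- x - _]addrC addrA -[v + _ + _]addrA addrK.
Qed.

Lemma zero_refl_V0 a v : a \in Phi G -> v \in V0 -> zero_refl a v \in V0.
Proof.
move=> aP v0; rewrite zero_reflE.
exact: (rpredB v0 (rpredZ _ (lower_raise_V0 (rootvP aP) (rootv_opp aP) v0))).
Qed.

Lemma zero_reflK a v : a \in Phi G -> v \in V0 -> zero_refl a (zero_refl a v) = v.
Proof.
move=> aP v0; have sp := sl2_pair_exists aP; have [ea fa ef] := sp.
set e := rootv a in ea ef sp; set f := _ *: _ in fa ef sp.
rewrite (sl2_pair_zero_refl aP sp (zero_refl_V0 aP v0)) (sl2_pair_zero_refl aP sp v0).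
have ex : rho e (rho f (rho e v)) = 2 *: rho e v.
  apply/eqP; rewrite -subr_eq0 -(root_coroot_self aP).
  have /weight_spaceP <- : rho e v \in weight_space rho (a : dual (sh G)).
    by have := rep_shift ea v0; rewrite addr0.
  rewrite -corootE // -ef rhoP (small_sq aP ea ea v0) // linear0 subr0.
  by rewrite subrr.
set x := rho f (rho e v) in ex *.
have -> : rho f (rho e (v - x)) = - x.
  by rewrite (linearB (rho e)) /= ex scaler_nat mulr2n opprD addrA subrr add0r linearN.
by rewrite opprK subrK.
Qed.

Lemma zero_reflN a v : a \in Phi G -> v \in V0 -> zero_refl (- a) v = zero_refl a v.
Proof.
move=> aP v0; rewrite !zero_reflE opprK ipNr ipNl opprK; congr (_ - _ *: _).
apply/eqP; rewrite -subr_eq0 -rhoP.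
have /weight0_cartan xh : br (rootv a) (rootv (- a)) \in gsp 0.
  by have := weight_space_bracket (rootvP aP) (rootv_opp aP); rewrite subrr.
by rewrite -(vsprojK xh) rep_cartan0.
Qed.

(** The Tits operator of a transports an sl2-pair of b to one of s_a b, and [zero_refl] does not
    depend on the pair. *)
Lemma zero_refl_conj a b v : a \in Phi G -> b \in Phi G -> v \in V0 ->
  zero_refl a (zero_refl b v) = zero_refl (dual_refl a b) (zero_refl a v).
Proof.
move=> aP bP v0; have ef := sl2_pair_exists aP; have ef' := sl2_pair_exists bP.
have rr := rep_equivariant rhoP.
rewrite -(tits_zero_refl aP ef (zero_refl_V0 bP v0)) -(tits_zero_refl aP ef v0).
rewrite (sl2_pair_zero_refl bP ef' v0) linearB /=.
rewrite !(rep_tits_equivariant _ _ rhoP rr aP ef).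
rewrite (sl2_pair_zero_refl _ (tits_adj_sl2_pair aP bP ef ef')) ?dual_refl_Phi //.
by rewrite (tits_zero_refl aP ef v0) zero_refl_V0.
Qed.

Lemma cartan_op_V0 (Y : 'Hom(G, 'End(V))) u v : equivariant rho Y -> v \in V0 ->
  Y (vsval u) v \in V0.
Proof.
move=> eqv v0; have := weight_space_shift eqv (cartan_weight0 (subvsP u)) v0.
by rewrite addr0.
Qed.

Lemma zero_refl_equivariant (Y : 'Hom(G, 'End(V))) a u v : equivariant rho Y ->
  a \in Phi G -> v \in V0 ->
  zero_refl a (Y (vsval u) v) = Y (vsval (refl a u)) (zero_refl a v).
Proof.
move=> eqv aP v0; have ef := sl2_pair_exists aP.
rewrite -(tits_zero_refl aP ef (cartan_op_V0 _ eqv v0)) -(tits_zero_refl aP ef v0).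
by rewrite (rep_tits_equivariant _ _ rhoP eqv aP ef) (tits_cartan _ aP ef).
Qed.

End SmallRep.
End Reflections.

(** * Irreducibility and root lengths *)

Section Irreducible.
Context {R : realType}.
Local Notation C := (R[i]).
Variable G : @simple_lie R.
Local Notation br := (bracket G).
Local Notation gsp := (@weight_space R G (sh G) G br).
Local Notation sharpG := (sharp (sh G) (form G)).
Implicit Types (a b c : cartan_dual G) (u : cartan G) (x y z : G).

(** A functional that vanishes on every [sharpG a] is zero: by symmetry of the form its own [sharpG]
    is killed by all roots. *)
Lemma sharp_span (U : {vspace cartan G}) :
  (forall a, a \in Phi G -> sharpG a \in U) -> U = fullv.
Proof.
move=> aU; apply/eqP; rewrite eqEsubv subvf /=; apply/subvP => u0 _.
pose q : 'End(cartan G) := (\1 - projv U)%VF.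
have qU w : w \in U -> q w = 0.
  by move=> wU; rewrite add_lfunE opp_lfunE id_lfunE projv_id // subrr.
suff : q u0 = 0.
  rewrite add_lfunE opp_lfunE id_lfunE => /eqP; rewrite subr_eq0 => /eqP ->.
  exact: memv_proj.
rewrite (coord_vbasis (memvf (q u0))) big1 // => i _; apply/eqP.
rewrite scaler_eq0; apply/orP; left; apply/eqP.
pose xi : cartan_dual G :=
  ((linfun (coord (vbasis {:cartan G}) i : cartan G -> C^o) : 'Hom(_, C^o)) \o q)%VF.
have xiE w : xi w = coord (vbasis {:cartan G}) i (q w) by rewrite comp_lfunE lfunE.
suff xi0 : xi = 0 by rewrite -xiE xi0 lfunE.
rewrite -(sharpK xi) (_ : sharpG xi = 0) ?linear0 //; apply: cartan_eq0 => a aP.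
by rewrite -ipE ip_sym ipE xiE qU ?linear0 // aU.
Qed.

(** Irreducibility as an induction principle. The X_a and H_a with a in S span a nonzero ideal,
    hence everything; but X_{-c} is orthogonal to this span when c is missed by S. *)
Lemma root_connected (S : pred (cartan_dual G)) a0 : a0 \in Phi G -> S a0 ->
    (forall a b, a \in Phi G -> b \in Phi G -> S a -> ip a b != 0 -> S b) ->
  forall b, b \in Phi G -> S b.
Proof.
move=> a0P Sa0 Scl c cP; apply: contraT => Sc.
pose X := [seq rootv a | a <- Phi G & S a] ++ [seq Hroot a | a <- Phi G & S a].
pose I := <<X>>%VS.
have rI a : a \in Phi G -> S a -> rootv a \in I.
  by move=> aP Sa; apply: memv_span; rewrite mem_cat map_f // mem_filter Sa.
have hI a : a \in Phi G -> S a -> Hroot a \in I.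
  by move=> aP Sa; apply: memv_span; rewrite mem_cat orbC map_f // mem_filter Sa.
have gen (U : {vspace G}) : (forall a, a \in Phi G -> S a -> rootv a \in U) ->
    (forall a, a \in Phi G -> S a -> Hroot a \in U) -> (I <= U)%VS.
  move=> rU hU; apply/span_subvP => y; rewrite mem_cat => /orP [] /mapP [a].
    by rewrite mem_filter => /andP [Sa aP] ->; apply: rU.
  by rewrite mem_filter => /andP [Sa aP] ->; apply: hU.
have idI : is_ideal I.
  move=> x y yI; rewrite bracket_anti rpredN memv_preim.
  suff -> : (br y @^-1: I)%VS = fullv by rewrite memvf.
  apply: root_decomp => [|b bP].
    apply/subvP => z zh; rewrite -memv_preim bracket_anti rpredN memv_preim.
    apply: (subvP (gen _ _ _)) yI => a aP Sa; rewrite -memv_preim -(vsprojK zh).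
      by rewrite (cartan_bracket _ (rootvP aP)) rpredZ // rI.
    rewrite (Hroot_sharp aP) (cartan_bracket _ (cartan_weight0 (subvsP (sharpG a)))).
    by rewrite lfunE /= scale0r mem0v.
  apply/subvP => _ /(root_space_line bP) [k ->]; rewrite -memv_preim brZr rpredZ //.
  rewrite bracket_anti rpredN memv_preim.
  apply: (subvP (gen _ _ _)) yI => a aP Sa; rewrite -memv_preim.
    have [ab0|ab0] := eqVneq (b + a) 0.
      have -> : b = - a by apply/eqP; rewrite -addr_eq0 ab0.
      by rewrite bracket_anti rpredN; apply: hI.
    have w := weight_space_bracket (rootvP bP) (rootvP aP).
    have [->|n0] := eqVneq (br (rootv b) (rootv a)) 0; first exact: mem0v.
    have abP := weight_root ab0 w n0.
    have [k' ->] := root_space_line abP w; apply/rpredZ/rI => //.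
    (* If a is orthogonal to a + b, then (a, b) = -(a, a) puts b in S, and b is not orthogonal to a
       + b as well, since a + b is not isotropic. *)
    have [aab|aab] := eqVneq (ip a (b + a)) 0; last exact: Scl aab.
    have Sb : S b.
      apply: (Scl a) => //; move/eqP: aab; rewrite ipDr addr_eq0 => /eqP ->.
      by rewrite oppr_eq0 ip_neq0.
    apply: (Scl b) => //; apply: contraNneq (ip_neq0 abP) => bab.
    by rewrite ipDl bab aab addr0.
  rewrite bracket_anti rpredN Hroot_sharp // (cartan_bracket _ (rootvP bP)) -ipE.
  have [->|ba0] := eqVneq (ip b a) 0; first by rewrite scale0r mem0v.
  by rewrite rpredZ // rI // (Scl a) // ip_sym.
have [_ /(_ _ idI) [I0|I1]] := sg_simple G.
  by have := rI _ a0P Sa0; rewrite I0 memv0 (negPf (rootv_neq0 a0P)).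
have : rootv c \in lker (form G (rootv (- c))).
  apply: (subvP (gen _ _ _)); rewrite ?I1 ?memvf // => a aP Sa; rewrite memv_ker; apply/eqP.
    apply: (form_weight _ (rootv_opp cP) (rootvP aP)).
    by rewrite addrC subr_eq0; apply: contraNneq Sc => <-.
  rewrite Hroot_sharp //.
  have c0 : - c + 0 != 0 by rewrite addr0 oppr_eq0 root_neq0.
  exact: (form_weight c0 (rootv_opp cP) (cartan_weight0 (subvsP _))).
by rewrite memv_ker form_sym rootv_norm // oner_eq0.
Qed.
End Irreducible.

(** * Positive definiteness on the real span of the roots *)

Section Positivity.
Context {R : realType}.
Local Notation C := (R[i]).
Variable G : @simple_lie R.
Local Notation sharpG := (sharp (sh G) (form G)).
Implicit Types (a b c : cartan_dual G).
(* This trace identity plays the part of the comparison with the Killing form. *)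
Variable K : C.
Hypothesis trK : forall u v : cartan G,
  \sum_(a <- Phip G) (a u : C) * (a v : C) = K * form G (vsval u) (vsval v).

(** Plays the part of the real span of the roots; as [C] is only partially ordered, reality has to
    be carried along. *)
Definition real_dual (xi : cartan_dual G) : Prop :=
  forall a, a \in Phi G -> ip a xi \is Num.real.

Lemma trace_ge0 xi : real_dual xi -> 0 <= K * ip xi xi.
Proof.
move=> xiR; rewrite /ip /dual_form -trK big_seq; apply: sumr_ge0 => a aP.
by rewrite -expr2 -ipE real_exprn_even_ge0 // xiR // Phip_sub.
Qed.

Lemma trace_neq0 xi : real_dual xi -> xi != 0 -> K * ip xi xi != 0.
Proof.
move=> xiR; apply: contraNneq; rewrite /ip /dual_form -trK big_seq.
move/eqP; rewrite psumr_eq0 => [/allP a0|a aP]; last first.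
  by rewrite -expr2 -ipE real_exprn_even_ge0 // xiR // Phip_sub.
rewrite -(sharpK xi) (_ : sharpG xi = 0) ?linear0 //; apply: cartan_eq0 => a aP.
have pos b : b \in Phip G -> b (sharpG xi) = 0.
  by move=> bP; have := a0 _ bP; rewrite bP mulf_eq0 orbb => /eqP.
have [/pos //|aN] := boolP (a \in Phip G).
have := Phip_half aP; rewrite aN => /pos; rewrite opp_lfunE => /eqP.
by rewrite oppr_eq0 => /eqP.
Qed.

(** Tested on a root of squared length 2, whose pairings with roots are integers. *)
Lemma trace_gt0 : 0 < K.
Proof.
have [b bP b2] := form_norm_eq G.
have bR : real_dual b.
  move=> a aP; have [n ->] := root_integer bP aP; rewrite {1}/ip b2 divff ?pnatr_eq0 //.
  by rewrite mulr1 rpred_int.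
have := trace_ge0 bR; rewrite le_eqVlt eq_sym (negPf (trace_neq0 bR (root_neq0 bP))) /=.
by rewrite {1}/ip b2 pmulr_lgt0 ?ltr0n.
Qed.

Lemma ip_ge0 xi : real_dual xi -> 0 <= ip xi xi.
Proof. by move/trace_ge0; rewrite pmulr_rge0 ?trace_gt0. Qed.

Lemma ip_definite xi : real_dual xi -> ip xi xi = 0 -> xi = 0.
Proof. by move=> /trace_neq0 h i0; apply: contraTeq isT => /h; rewrite i0 mulr0 eqxx. Qed.

(** The multiple 2b / (b, b) pairs integrally with all roots, so it is real whatever (b, b) may be;
    its squared length is 4 / (b, b). *)
Lemma root_gt0 b : b \in Phi G -> 0 < ip b b.
Proof.
move=> bP; have b0 := ip_neq0 bP.
have bR : real_dual ((2 / ip b b) *: b).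
  move=> a aP; have [n nE] := root_integer bP aP; rewrite ipZr nE.
  have -> : 2 / ip b b * (n%:~R * (ip b b / 2)) = n%:~R by field.
  exact: rpred_int.
have := ip_ge0 bR; rewrite ipZr ipZl.
have -> : 2 / ip b b * (2 / ip b b * ip b b) = 4 / ip b b by field.
by rewrite pmulr_rge0 ?ltr0n // invr_ge0 lt0r b0.
Qed.

Lemma root_real b : b \in Phi G -> real_dual b.
Proof.
move=> bP a aP; have [n ->] := root_integer bP aP.
by rewrite rpredM ?rpred_int // rpredM ?gtr0_real ?root_gt0 ?invr_gt0 ?ltr0n.
Qed.

Lemma real_dualB xi eta : real_dual xi -> real_dual eta -> real_dual (xi - eta).
Proof. by move=> xR eR a aP; rewrite ipDr ipNr rpredB ?xR ?eR. Qed.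

Lemma real_dualD xi eta : real_dual xi -> real_dual eta -> real_dual (xi + eta).
Proof. by move=> xR eR a aP; rewrite ipDr rpredD ?xR ?eR. Qed.

Lemma real_dualZ (k : C) xi : k \is Num.real -> real_dual xi -> real_dual (k *: xi).
Proof. by move=> kR xR a aP; rewrite ipZr rpredM ?xR. Qed.

End Positivity.

Lemma int_sq_lt2 (m : int) : m != 0 -> m * m < 2 -> m * m = 1.
Proof. move=> m0 m2; have [] : m = 1 \/ m = -1 by nia.
by move=> ->. by move=> ->. Qed.
Lemma int_2_3_4 (p : int) : 1 < p -> p <= 4%:Z ->
  p = 2%:Z \/ p = 3%:Z \/ p = 4%:Z.
Proof. lia. Qed.
Lemma int_sq_lt4 (m : int) : 0 < m -> m * m < 4 -> m = 1.
Proof. nia. Qed.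
Lemma int_A2_form (x y : int) : (x != 0) || (y != 0) -> 1 <= x * x + y * y - x * y.
Proof. nia. Qed.
Lemma int_double_sq (x y : int) : y = 2 * x -> y * y = 1 -> False.
Proof. nia. Qed.

(** * Short roots have squared length 1 in rank at least 3 *)

Section ShortRoots.
Context {R : realType}.
Local Notation C := (R[i]).
Variable G : @simple_lie R.
Local Notation sharpG := (sharp (sh G) (form G)).
Implicit Types (a b c : cartan_dual G).
Variable K : C.
Hypothesis trK : forall u v : cartan G,
  \sum_(a <- Phip G) (a u : C) * (a v : C) = K * form G (vsval u) (vsval v).

Lemma long_ip_int a b : a \in Phi G -> b \in Phi G -> is_long b ->
  exists m : int, ip a b = m%:~R.
Proof.
move=> aP bP /eqP b2; have [m ->] := root_integer bP aP.
by exists m; rewrite b2 divff ?pnatr_eq0 // mulr1.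
Qed.

Lemma dual_refl_long a b : a \in Phi G -> is_long b -> is_long (dual_refl a b).
Proof. by move=> aP; rewrite /is_long dual_refl_ip. Qed.

Lemma root_norm_le2 a : a \in Phi G -> ip a a <= 2.
Proof. exact: form_norm_le. Qed.

(** The property spreads along non-orthogonal roots: if b is a long neighbour of c and d is
    orthogonal to b but not to c, then s_c b is a long neighbour of d. *)
Lemma long_neighbour a : a \in Phi G ->
  exists2 b, b \in Phi G & is_long b && (ip a b != 0).
Proof.
move=> aP.
pose S a := has (fun b : cartan_dual G => is_long b && (ip a b != 0)) (Phi G).
suff /hasP [b bP bl] : S a by exists b.
have [b0 b0P b02] := form_norm_eq G.
have b0l : is_long b0 by rewrite /is_long /ip b02.
apply: (@root_connected _ _ S b0) => //.
  by apply/hasP; exists b0 => //; rewrite b0l ip_neq0.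
move=> c d cP dP /hasP [b bP /andP [bl cb]] cd; apply/hasP.
have [db|db] := eqVneq (ip d b) 0; last by exists b => //; rewrite bl db.
exists (dual_refl c b); first exact: dual_refl_Phi.
rewrite dual_refl_long //= /dual_refl ipDr db add0r ipNr ipZr oppr_eq0.
by rewrite !mulf_neq0 ?invr_neq0 ?ip_neq0 ?pnatr_eq0 // [ip _ _]ip_sym.
Qed.

(** * A G2 plane contains the whole root system *)

Section TripleBond.
Variables s1 s2 : cartan_dual G.
Hypothesis s1P : s1 \in Phi G.
Hypothesis l1P : s1 + s2 \in Phi G.
Hypothesis l2P : s1 *+ 2 - s2 \in Phi G.
Hypotheses (s11 : ip s1 s1 = 2 / 3) (s12 : ip s1 s2 = 1 / 3) (s22 : ip s2 s2 = 2 / 3).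

Definition in_plane c := exists k l : C, c = k *: s1 + l *: s2.

(* Over the span of [s1, s2] (the plane of a G2) the orthogonal projection of c
   is (2x - y) s1 + (2y - x) s2, of squared length 2 (x^2 - xy + y^2). *)
Lemma long_in_plane c : c \in Phi G -> is_long c ->
  (ip c s1 != 0) || (ip c s2 != 0) -> in_plane c.
Proof.
move=> cP cl.
have s1R := root_real trK s1P.
have cR := root_real trK cP.
have s2R : real_dual s2.
  by rewrite -[s2](addrK s1) [s2 + s1]addrC; apply: real_dualB => //; apply: (root_real trK).
have [x xE] := long_ip_int s1P cP cl.
have [z zE] := long_ip_int l1P cP cl.
have yE : ip s2 c = (z - x)%:~R.
  by rewrite rmorphB /= -zE -xE ipDl addrC addKr.
rewrite [ip c s1]ip_sym [ip c s2]ip_sym xE yE !intr_eq0; move: (z - x)%R yE => y yE xy0.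
pose d := c - ((2 * x%:~R - y%:~R) *: s1 + (2 * y%:~R - x%:~R) *: s2).
have dR : real_dual d.
  apply: real_dualB => //; apply: real_dualD; apply: real_dualZ => //;
    by rewrite rpredB ?rpredM ?rpred_int ?rpred_nat.
have dd : ip d d = 2 - 2 * (x * x + y * y - x * y)%:~R.
  rewrite /d !(ipDl, ipDr, ipNl, ipNr, ipZl, ipZr) (eqP cl).
  rewrite [ip c s1]ip_sym [ip c s2]ip_sym [ip s2 s1]ip_sym xE yE s11 s12 s22.
  by rewrite rmorphB rmorphD !rmorphM /=; field.
have q1 : (1 <= x * x + y * y - x * y)%R := int_A2_form xy0.
have dd0 : ip d d = 0.
  apply: le_anti; rewrite (ip_ge0 trK dR) andbT dd subr_le0.
  by rewrite ler_peMr // ler1z.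
have /eqP := ip_definite trK dR dd0; rewrite subr_eq0 => /eqP ->.
by exists (2 * x%:~R - y%:~R), (2 * y%:~R - x%:~R).
Qed.

(* If c is off the plane, a long root l of the plane not orthogonal to c is moved
   off the plane by s_c, hence becomes orthogonal to the plane; this makes the
   pairing of c with another long root of the plane half-integral. *)
Lemma root_in_plane c : c \in Phi G ->
  (ip c s1 != 0) || (ip c s2 != 0) -> in_plane c.
Proof.
move=> cP c12; have [cl|cl] := boolP (is_long c); first exact: long_in_plane.
have c0 := ip_neq0 cP; have cgt0 := root_gt0 trK cP.
have l1l : is_long (s1 + s2).
  by rewrite /is_long !(ipDl, ipDr) [ip s2 s1]ip_sym s11 s12 s22; apply/eqP; field.
have l2l : is_long (s1 *+ 2 - s2).
  rewrite /is_long -scaler_nat !(ipDl, ipDr, ipNl, ipNr, ipZl, ipZr) [ip s2 s1]ip_sym.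
  by rewrite s11 s12 s22; apply/eqP; field.
have [m1 m1E] := long_ip_int cP l1P l1l.
have [m2 m2E] := long_ip_int cP l2P l2l.
have l1e : ip c (s1 + s2) = ip c s1 + ip c s2 by rewrite ipDr.
have l2e : ip c (s1 *+ 2 - s2) = 2 * ip c s1 - ip c s2.
  by rewrite -scaler_nat ipDr ipNr ipZr.
have refl_case l m : l \in Phi G -> is_long l -> in_plane l -> ip c l = m%:~R ->
    m != 0 -> ~ in_plane c ->
    [/\ ip c s1 = m%:~R * (ip l s1 / 2), ip c s2 = m%:~R * (ip l s2 / 2) & m * m = 1].
  move=> lP ll [k [k' lE]] cm m0 cnP.
  have m0' : m%:~R != 0 :> C by rewrite intr_eq0.
  have tE : dual_refl c l = l - (2 * m%:~R / ip c c) *: c by rewrite /dual_refl [ip l c]ip_sym cm.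
  have co0 : 2 * m%:~R / ip c c != 0 :> C by rewrite !mulf_neq0 ?invr_neq0 ?pnatr_eq0.
  have tnP : ~ in_plane (dual_refl c l).
    move=> [p [p' pE]]; apply: cnP.
    set q := 2 * m%:~R / ip c c in tE co0.
    exists (q^-1 * (k - p)), (q^-1 * (k' - p')).
    rewrite -!scalerA -scalerDr; apply: (canRL (scalerK co0)).
    by rewrite !scalerBl addrACA -opprD -lE -pE tE opprB addrC subrK.
  have tP := dual_refl_Phi cP lP; have tl := dual_refl_long cP ll.
  have [t1 t2] : ip (dual_refl c l) s1 = 0 /\ ip (dual_refl c l) s2 = 0.
    have [t1|t1] := eqVneq (ip (dual_refl c l) s1) 0; last first.
      by case: tnP; apply: long_in_plane; rewrite ?t1.
    have [t2|t2] := eqVneq (ip (dual_refl c l) s2) 0; last first.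
      by case: tnP; apply: long_in_plane; rewrite ?t2 ?orbT.
    exact: (conj t1 t2).
  have tl0 : ip (dual_refl c l) l = 0 by rewrite {2}lE ipDr !ipZr t1 t2 !mulr0 addr0.
  have cc : ip c c = m%:~R * m%:~R.
    move: tl0; rewrite tE ipDl ipNl ipZl cm (eqP ll) => /eqP; rewrite subr_eq0.
    move: (ip c c) c0 {cgt0 co0 tE} => q q0 /eqP e.
    have -> : m%:~R * m%:~R = 2 * m%:~R / q * m%:~R * (q / 2) :> C by field.
    by rewrite -e; field.
  move: t1 t2; rewrite !tE !ipDl !ipNl !ipZl cc => /eqP; rewrite subr_eq0 => /eqP e1.
  move/eqP; rewrite subr_eq0 => /eqP e2; split; [by rewrite e1; field|by rewrite e2; field|].
  have clt : ip c c < 2 by rewrite lt_neqAle (root_norm_le2 cP) andbT.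
  have : (m * m)%:~R < 2%:Z%:~R :> C by rewrite rmorphM -cc.
  by rewrite ltr_int; exact: int_sq_lt2.
have par (x y : int) : x%:~R = y%:~R / 2 :> C -> y = 2 * x.
  move=> xy; apply/eqP; rewrite -(eqr_int C) rmorphM /= xy; apply/eqP.
  by field.
have s1p : in_plane (s1 + s2) by exists 1, 1; rewrite !scale1r.
have s2p : in_plane (s1 *+ 2 - s2) by exists 2, (-1); rewrite scaler_nat scaleN1r.
apply: contrapT => cnP.
have [m10|m10] := eqVneq m1 0; last first.
  have [e1 e2 mm] := refl_case _ _ l1P l1l s1p m1E m10 cnP.
  (* The two long roots have inner product 1, so c pairs to m1 / 2 with the other one; this is no
     integer when m1^2 = 1. *)
  have /par : m2%:~R = m1%:~R / 2 :> C.
    rewrite -m2E l2e e1 e2 !ipDl s11 s12 [ip s2 s1]ip_sym s12 s22; by field.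
  by move=> E; exact: (int_double_sq E mm).
have [m20|m20] := eqVneq m2 0; last first.
  have [e1 e2 mm] := refl_case _ _ l2P l2l s2p m2E m20 cnP.
  have /par : m1%:~R = m2%:~R / 2 :> C.
    rewrite -m1E l1e e1 e2 -scaler_nat !ipDl !ipNl !ipZl s11 s12 [ip s2 s1]ip_sym s12 s22.
    by field.
  by move=> E; exact: (int_double_sq E mm).
have E3 : 3 * ip c s1 = 0 :> C.
  transitivity (ip c (s1 + s2) + ip c (s1 *+ 2 - s2)); first by rewrite l1e l2e; ring.
  by rewrite m1E m2E m10 m20 addr0.
move: E3 => /eqP; rewrite mulf_eq0 pnatr_eq0 /= => /eqP c1.
have c2 : ip c s2 = 0 by rewrite -[LHS]add0r -c1 -l1e m1E m10.
by rewrite c1 c2 eqxx in c12.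
Qed.

(** By irreducibility no root can leave the plane, and the roots span. *)
Lemma triple_bond_rank : (rank G <= 2)%N.
Proof.
pose S c : bool := `[< in_plane c >].
have SP c : c \in Phi G -> S c.
  apply: (@root_connected _ _ S s1) => //.
    by apply/asboolP; exists 1, 0; rewrite scale1r scale0r addr0.
  move=> {}c d cP dP /asboolP [k [l cE]] cd; apply/asboolP/root_in_plane => //.
  rewrite -negb_and; apply: contra cd => /andP [/eqP d1 /eqP d2].
  by rewrite ip_sym cE ipDr !ipZr d1 d2 !mulr0 addr0.
have full : <<[:: sharpG s1; sharpG s2]>>%VS = fullv.
  apply: sharp_span => c /SP /asboolP [k [l ->]].
  rewrite span_cons span_seq1 sharpD !sharpZ.
  by apply: memv_add; apply/rpredZ/memv_line.
have := dim_span [:: sharpG s1; sharpG s2]; rewrite full /= dimvf.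
exact.
Qed.
End TripleBond.

(** For a long root b with (a, b) = 1 the Cartan integer p = 2 / (a, a) is 2, 3 or 4. The value 3
    produces a G2 plane, against the rank, and 4 forces b = 2a. *)
Lemma short_norm a : (3 <= rank G)%N -> a \in Phi G -> ~~ is_long a -> ip a a = 1.
Proof.
move=> rk aP al.
have [b bP /andP [bl ab0]] := long_neighbour aP.
wlog ab1 : b bP bl ab0 / (exists m : int, 0 < m /\ ip a b = m%:~R).
  move=> wl; have [m mE] := long_ip_int aP bP bl.
  have [m0|m0|m0] := ltrgt0P m; first by apply: (wl b) => //; exists m.
    apply: (wl (- b)); rewrite ?Phi_opp /is_long ?ipNl ?ipNr ?opprK ?oppr_eq0 //.
    by exists (- m); rewrite oppr_gt0 mE rmorphN.
  by rewrite mE m0 eqxx in ab0.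
case: ab1 => m [m0 mE].
have b2 := eqP bl; have a0 := ip_neq0 aP; have agt0 := root_gt0 trK aP.
have aR := root_real trK aP; have bR := root_real trK bP.
have alt2 : ip a a < 2 by rewrite lt_neqAle al root_norm_le2.
(* The component of a orthogonal to b; (d, d) >= 0 is the Cauchy-Schwarz inequality, giving m^2 <= 2
   (a, a) < 4 and later p <= 4. *)
pose d := a - (m%:~R / 2) *: b.
have dR : real_dual d by apply: real_dualB => //; apply: real_dualZ => //;
  rewrite rpredM ?rpred_int // rpredV rpred_nat.
have dd : ip d d = ip a a - (m * m)%:~R / 2.
  rewrite ip_subZ b2 mE rmorphM /=.
  by field.
have dd0 := ip_ge0 trK dR.
have m1 : m = 1.
  have : (m * m)%:~R < 4%:Z%:~R :> C.
    apply: (@le_lt_trans _ _ (2 * ip a a)); last first.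
      by rewrite -pmulrn (natrM _ 2 2) ltr_pM2l ?ltr0n.
    by move: dd0; rewrite dd subr_ge0 ler_pdivrMr ?ltr0n // => h; rewrite [2 * _]mulrC.
  by rewrite ltr_int; exact: int_sq_lt4.
have {}mE : ip a b = 1 by rewrite mE m1.
have {}dd : ip d d = ip a a - 1 / 2 by rewrite dd m1.
have [p pE] := root_integer aP bP; rewrite ip_sym mE in pE.
have pa : p%:~R * ip a a = 2 by rewrite -[RHS]mulr1 pE; field.
have p0 : 0 < p.
  rewrite -(ltr0z C) -(pmulr_lgt0 _ agt0) pa ltr0n //.
have p1 : 1 < p.
  rewrite -(ltr1z C) -(ltr_pM2r agt0) mul1r pa //.
have p4 : p <= 4%:Z.
  rewrite -(ler_int C) -(ler_pM2r agt0) pa.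
  have -> : 4%:Z%:~R * ip a a = 4 * (ip a a - 1 / 2) + 2 by rewrite -pmulrn; field.
  by rewrite lerDr mulr_ge0 ?ler0n // -dd.
have [p2|[p3|p4']] := int_2_3_4 p1 p4.
- apply: (@mulfI _ 2); first by rewrite pnatr_eq0.
  by rewrite mulr1 -{2}pa p2 -pmulrn.
- have a23 : ip a a = 2 / 3.
    by rewrite -pa p3 -pmulrn; field.
  have ba : a + (b - a) = b by rewrite addrC subrK.
  suff : (rank G <= 2)%N by rewrite leqNgt rk.
  (* With s1 = a and s2 = b - a the two long roots are s1 + s2 = b and 2 s1 - s2 = 3a - b = - s_a
     b. *)
  apply: (@triple_bond_rank a (b - a)); rewrite ?ba //.
  + have -> : a *+ 2 - (b - a) = - dual_refl a b.
      rewrite /dual_refl [ip b a]ip_sym mE a23 (_ : 2 * 1 / (2 / 3) = 3); last by field.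
      by rewrite !opprB -[3]/(3%:R) scaler_nat [a *+ 3]mulrSr addrA.
    exact/Phi_opp/dual_refl_Phi.
  + by rewrite ipDr ipNr mE a23; field.
  + by rewrite !(ipDr, ipDl, ipNl, ipNr) [ip b a]ip_sym mE b2 a23; field.
(* The case p = 4 is equality in Cauchy-Schwarz, so a = b / 2. *)
have dz : ip d d = 0.
  by rewrite dd -[X in _ - X](_ : (4%:Z%:~R * ip a a) / 4 = 1 / 2);
    [rewrite -pmulrn; field|rewrite -p4' pa; field].
have /eqP := ip_definite trK dR dz; rewrite /d m1 subr_eq0 => /eqP aE.
case/negP: (double_root aP).
rewrite {1 2}aE -scalerDl -[X in X *: _](_ : 1 = _) ?scale1r //; by field.
Qed.
End ShortRoots.

(** * The Weyl group action *)

Lemma count_ltn (T : eqType) (p q : pred T) s x :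
  (forall y, p y -> q y) -> x \in s -> q x -> ~~ p x -> (count p s < count q s)%N.
Proof.
move=> pq + qx px; elim: s => //= y s IH; rewrite inE => /predU1P [<-|/IH ih].
  by rewrite qx (negPf px) add0n add1n ltnS sub_count.
by rewrite -addnS leq_add //; case: (boolP (p y)) => // /pq ->.
Qed.

Section Words.
Context {R : realType}.
Local Notation C := (R[i]).
Variable G : @simple_lie R.
Implicit Types (a b c : cartan_dual G) (u : cartan G).

Lemma Re_realM (t : R) (z : C) : complex.Re (t%:C * z) = t * complex.Re z.
Proof. by case: z => x y /=; rewrite mul0r subr0. Qed.

(** One functional a is added at a time: if u0 fails on a, take u1 that works for a and use t u0 +
    u1, with t larger than all ratios of b(u1) to b(u0) in absolute value. *)
Lemma regular_vector (s : seq (cartan_dual G)) : (forall a, a \in s -> a != 0) ->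
  exists u, forall a, a \in s -> complex.Re (a u : C) != 0.
Proof.
elim: s => [|a s IH] s0; first by exists 0.
have [b bs|u0 u0P] := IH; first by rewrite s0 // inE bs orbT.
have [u1 u1P] : exists u1, complex.Re (a u1 : C) != 0.
  have [w aw] : exists w, a w != 0.
    apply: contrapT => aw; have /eqP[] := s0 a (mem_head _ _).
    apply/lfunP => w; rewrite lfunE /=; apply: contrapT => /eqP aw0.
    by apply: aw; exists w.
  exists ((a w : C)^-1 *: w); 
  have -> : (a ((a w : C)^-1 *: w) : C) = (a w)^-1 * a w by rewrite linearZ.
  by rewrite mulVf // oner_neq0.
have [a0|a0] := eqVneq (complex.Re (a u0 : C)) 0; last first.
  by exists u0 => b; rewrite inE => /predU1P [->|/u0P].
pose q b := complex.Re (b u1 : C) / complex.Re (b u0 : C).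
pose t := 1 + \sum_(b <- s) `|q b|.
exists (t%:C *: u0 + u1) => b.
have -> : complex.Re (b (t%:C *: u0 + u1) : C)
    = t * complex.Re (b u0 : C) + complex.Re (b u1 : C).
  by rewrite linearD linearZ /= raddfD /= Re_realM.
rewrite inE => /predU1P [->|bs]; first by rewrite a0 mulr0 add0r.
have b0 := u0P _ bs.
rewrite -[complex.Re (b u1)](mulfVK b0) -mulrDl mulf_neq0 // -/(q b).
rewrite gt_eqF // -ltrBlDr sub0r (le_lt_trans (ler_norm _)) // normrN.
rewrite (le_lt_trans (y := \sum_(b <- s) `|q b|)) ?ltrDr ?ltr01 //.
  by rewrite (big_rem b) //= lerDl sumr_ge0.
Qed.

Definition word (s : seq (cartan_dual G)) := all (fun a => a \in Phi G) s.
Definition refl_word s u := foldr (fun a w => refl a w) u s.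
Definition dual_refl_word s b := foldr (@dual_refl R G) b s.

Lemma refl_word_cat s t u : refl_word (s ++ t) u = refl_word s (refl_word t u).
Proof. exact: foldr_cat. Qed.

Lemma dual_refl_word_Phi s b : word s -> b \in Phi G -> dual_refl_word s b \in Phi G.
Proof. by elim: s => //= a s IH /andP [aP sP] bP; rewrite dual_refl_Phi // IH. Qed.

Lemma dual_refl_word_refl s b u : word s -> dual_refl_word s b (refl_word s u) = b u.
Proof.
elim: s => //= a s IH /andP [aP sP].
by rewrite -dual_refl_refl // reflK // IH.
Qed.

Lemma dual_refl_wordN s b : dual_refl_word s (- b) = - dual_refl_word s b.
Proof. by elim: s => //= a s ->; rewrite dual_reflN. Qed.

Lemma reflN a u : a \in Phi G -> refl (- a) u = refl a u.
Proof.
move=> aP; rewrite !reflE !coroot_hE ?Phi_opp // ipNr ipNl opprK sharpN opp_lfunE.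
by rewrite scalerN scaleNr scalerN opprK.
Qed.

Lemma refl_conj a b u : a \in Phi G -> b \in Phi G ->
  refl a (refl b u) = refl (dual_refl a b) (refl a u).
Proof.
move=> aP bP; rewrite [refl b u]reflE [RHS]reflE coroot_dual_refl //.
by rewrite -dual_refl_refl // reflK // linearB linearZ.
Qed.

Lemma refl_word_conj s b u : word s -> b \in Phi G ->
  refl_word s (refl b u) = refl (dual_refl_word s b) (refl_word s u).
Proof.
elim: s => //= a s IH /andP [aP sP] bP.
by rewrite IH // refl_conj // dual_refl_word_Phi.
Qed.

Lemma refl_wordK s u : word s -> refl_word s (refl_word (rev s) u) = u.
Proof.
elim: s u => //= a s IH u /andP [aP sP].
by rewrite rev_cons -cats1 refl_word_cat /= IH // reflK.
Qed.

Lemma word_rev s : word (rev s) = word s.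
Proof. exact: all_rev. Qed.

(** * Lifting relations between reflections to V[0] *)

Section Lift.
Variables (V : vectType C) (rho : 'Hom(G, 'End(V))).
Hypothesis rhoP : is_rep rho.
Hypothesis small : forall a, a \in Phi G -> weight_space rho (a + a : dual (sh G)) = 0%VS.
Variable K : C.
Hypothesis trK : forall u v : cartan G,
  \sum_(a <- Phip G) (a u : C) * (a v : C) = K * form G (vsval u) (vsval v).
Local Notation V0 := (weight_space rho (0 : dual (sh G))).

Definition zero_word s v := foldr (fun a => zero_refl rho a) v s.

Lemma zero_word_cat s t v : zero_word (s ++ t) v = zero_word s (zero_word t v).
Proof. exact: foldr_cat. Qed.

Lemma zero_word_V0 s v : word s -> v \in V0 -> zero_word s v \in V0.
Proof. by elim: s => //= a s IH /andP [aP sP] v0; rewrite zero_refl_V0 // IH. Qed.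

Lemma zero_word_conj s b v : word s -> b \in Phi G -> v \in V0 ->
  zero_word s (zero_refl rho b v) = zero_refl rho (dual_refl_word s b) (zero_word s v).
Proof.
elim: s => //= a s IH /andP [aP sP] bP v0.
by rewrite IH // zero_refl_conj // ?dual_refl_word_Phi // zero_word_V0.
Qed.

Lemma zero_wordK s v : word s -> v \in V0 -> zero_word s (zero_word (rev s) v) = v.
Proof.
elim: s v => //= a s IH v /andP [aP sP] v0.
rewrite rev_cons -cats1 zero_word_cat /=.
by rewrite IH ?zero_refl_V0 // zero_reflK.
Qed.

(** * Simple roots for a generic linear form *)

Section Order.
Variable u0 : cartan G.
Hypothesis u0P : forall a, a \in Phi G -> complex.Re (a u0 : C) != 0.

(* A generic linear form; the positive system it defines replaces [Phip]. *)
Definition ell a : R := complex.Re (a u0 : C).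

Lemma ellD a b : ell (a + b) = ell a + ell b.
Proof. by rewrite /ell add_lfunE raddfD. Qed.
Lemma ellN a : ell (- a) = - ell a.
Proof. by rewrite /ell opp_lfunE raddfN. Qed.
Lemma ellZ (n : int) a : ell (n%:~R *: a) = n%:~R * ell a.
Proof.
transitivity (complex.Re ((n%:~R : R)%:C * (a u0 : C))); last exact: Re_realM.
by rewrite rmorph_int /ell scale_lfunE.
Qed.
Lemma ell_neq0 a : a \in Phi G -> ell a != 0.
Proof. exact: u0P. Qed.

Definition is_simple_root a : Prop :=
  [/\ a \in Phi G, 0 < ell a &
      forall b c, b \in Phi G -> c \in Phi G -> 0 < ell b -> 0 < ell c -> a <> b + c].

(** If b - a were negative, a = b + (a - b) would decompose the simple root a. *)
Lemma simple_sub a b : is_simple_root a -> b \in Phi G -> 0 < ell b ->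
  b - a \in Phi G -> 0 < ell (b - a).
Proof.
move=> [aP a0 aS] bP b0 baP.
have [//|ba|/eqP ba] := ltrgt0P (ell (b - a)); last by rewrite (negPf (ell_neq0 baP)) in ba.
case: (aS b (a - b)); rewrite ?subrKC //; first by rewrite -opprB Phi_opp.
by rewrite -opprB ellN oppr_gt0.
Qed.

(** Induction on the Cartan integer n of b against a, in place of an expansion into simple roots.
    For n > 0, b - a is a positive root; for n > 1 it has integer n - 2, and a is stripped from s_a
    (b - a) = s_a b + a by [simple_sub]. *)
Lemma simple_reflection_gt0 a b : is_simple_root a -> b \in Phi G -> 0 < ell b ->
  b != a -> 0 < ell (dual_refl a b).
Proof.
move=> aS bP b0 ba; have [aP a0 _] := aS; have aa0 := ip_neq0 aP.
have sdE (n : int) c : ip c a = n%:~R * (ip a a / 2) -> dual_refl a c = c - n%:~R *: a.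
  by move=> E; rewrite /dual_refl E (_ : 2 * _ / _ = n%:~R) //; field.
have [[n|n] nE] := root_integer aP bP; last first.
  rewrite (sdE _ _ nE) ellD ellN ellZ NegzE rmorphN mulNr opprK.
  by rewrite addr_gt0 // mulr_gt0 // ltr0n.
elim/ltn_ind: n b bP b0 ba nE => -[|n] IH b bP b0 ba nE.
  by rewrite (sdE _ _ nE) scale0r subr0.
have baP : b - a \in Phi G.
  apply: contraT => baP.
  rewrite addrC in baP; have ab0 : - a + b != 0 by rewrite addrC subr_eq0.
  have [k kE] := root_string (Phi_opp aP) bP ab0 baP.
  move: kE; rewrite !ipNr ipNl opprK nE => /eqP.
  rewrite -mulNr -subr_eq0 -mulrBl !mulf_eq0 (negPf aa0) invr_eq0 pnatr_eq0 !orbF.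
  by rewrite -opprD oppr_eq0 -pmulrn -natrD pnatr_eq0.
have ba0 := simple_sub aS bP b0 baP.
case: n IH nE => [|n] IH nE; first by rewrite (sdE _ _ nE) scale1r.
have baa : b - a != a.
  by rewrite subr_eq; apply: contraNneq (double_root aP) => <-.
have nE' : ip (b - a) a = n%:~R * (ip a a / 2).
  rewrite ipDl ipNl nE -!pmulrn -!natr1; by field.
have sE : dual_refl a (b - a) = dual_refl a b + a.
  by rewrite (sdE _ _ nE) (sdE _ _ nE') -!pmulrn -!natr1 !scalerDl
    scale1r !opprD !addrA addrNK addrAC.
have := IH n _ _ baP ba0 baa nE'; rewrite sE ltnS leqnSn => /(_ isT) g0.
rewrite -[dual_refl a b](addrK a); apply: simple_sub g0 _ => //.
  by rewrite -sE dual_refl_Phi.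
by rewrite addrK dual_refl_Phi.
Qed.

(** Not the usual height, which presupposes a base: a natural number strictly increasing with [ell]
    on positive roots is enough for the inductions. *)
Definition height a := count (fun b => 0 < ell b < ell a) (Phi G).

Lemma height_lt a b : b \in Phi G -> 0 < ell b -> ell b < ell a ->
  (height b < height a)%N.
Proof.
move=> bP b0 ba; apply: (count_ltn (x := b)) => //.
- by move=> c /andP [-> /lt_trans]; apply.
- by rewrite b0.
by rewrite ltxx andbF.
Qed.

Lemma simple_or_sum a : a \in Phi G -> 0 < ell a -> is_simple_root a \/
  exists b c, [/\ b \in Phi G, c \in Phi G, 0 < ell b, 0 < ell c & a = b + c].
Proof.
move=> aP a0; case: (pselect (exists b c, [/\ b \in Phi G, c \in Phi G,
  0 < ell b, 0 < ell c & a = b + c])) => [|nex]; [by right|left].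
by split=> // b c bP cP b0 c0 abc; apply: nex; exists b, c.
Qed.

(** In a decomposition a = b + c one of the summands still pairs positively with xi. *)
Lemma simple_acute xi a : real_dual xi -> a \in Phi G -> 0 < ell a ->
  0 < ip a xi -> exists2 b, is_simple_root b & 0 < ip b xi.
Proof.
move=> xiR; have [n] := ubnP (height a); elim: n a => // n IH a an aP a0 axi.
have [aS|[b [c [bP cP b0 c0 aE]]]] := simple_or_sum aP a0; first by exists a.
have ba : ell b < ell a by rewrite aE ellD ltrDl.
have ca : ell c < ell a by rewrite aE ellD ltrDr.
have [bxi|bxi] := real_ltP (rpred0 _) (xiR _ bP).
  by apply: (IH b) => //; rewrite (leq_trans (height_lt bP b0 ba)).
apply: (IH c) => //; first by rewrite (leq_trans (height_lt cP c0 ca)).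
by apply: lt_le_trans axi _; rewrite aE ipDl gerDr.
Qed.

Definition simple_word (s : seq (cartan_dual G)) := forall a, a \in s -> is_simple_root a.

Lemma simple_wordW s : simple_word s -> word s.
Proof. by move=> sS; apply/allP => a /sS []. Qed.

(** Equality in W and on V[0] together: a word may then be replaced by a simple one before it is
    known that W acts on V[0]. *)
Definition same_word s t := (forall u, refl_word s u = refl_word t u) /\
  (forall v, v \in V0 -> zero_word s v = zero_word t v).

(** For a not simple, choose a simple d with (d, a) > 0: then s_d a is a lower positive root, and
    s_a = s_d s_{s_d a} s_d holds in W and on V[0]. *)
Lemma simple_word_root a : a \in Phi G ->
  exists2 s, simple_word s & same_word s [:: a].
Proof.
move=> aP; wlog a0 : a aP / 0 < ell a.
  move=> wl; have [/wl|aN|/eqP] := ltrgt0P (ell a); first exact.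
    have [|s sS [s1 s2]] := wl _ (Phi_opp aP); first by rewrite ellN oppr_gt0.
    exists s => //; split=> [u|v v0]; first by rewrite s1 /= reflN.
    by rewrite s2 //= zero_reflN.
  by rewrite (negPf (ell_neq0 aP)).
have [n] := ubnP (height a); elim: n a aP a0 => // n IH a aP a0 an.
have [aS|[b [c [bP cP b0 c0 aE]]]] := simple_or_sum aP a0.
  by exists [:: a] => // b; rewrite inE => /eqP ->.
have [d dS da] := simple_acute (root_real trK aP) aP a0 (root_gt0 trK aP).
have [dP d0 _] := dS; have dd0 := ip_neq0 dP.
have daN : a != d.
  by apply: contra_not_neq (fun E => E) _; case: dS => _ _ dS' ad;
     apply: (dS' b c) => //; rewrite -ad.
have sdP := dual_refl_Phi dP aP.
have sd0 := simple_reflection_gt0 dS aP a0 daN.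
have sda : ell (dual_refl d a) < ell a.
  have [m mE] := root_integer dP aP.
  have m0 : 0 < m.
    rewrite -(ltr0z C) -(pmulr_lgt0 _ (root_gt0 trK dP)).
    have -> : m%:~R * ip d d = ip a d * 2 by rewrite mE; field.
    by rewrite mulr_gt0 ?ltr0n // ip_sym.
  rewrite /dual_refl (_ : 2 * ip a d / ip d d = m%:~R); last by rewrite mE; field.
  by rewrite ellD ellN ellZ gtrDl oppr_lt0 mulr_gt0 // ltr0z.
have [|s sS [s1 s2]] := IH _ sdP sd0.
  by rewrite (leq_trans (height_lt sdP sd0 sda)).
exists (d :: rcons s d).
  move=> x; rewrite inE mem_rcons inE => /predU1P [->|/predU1P [->|/sS]] //.
have sW := simple_wordW sS.
have catE : d :: rcons s d = d :: (s ++ [:: d]) by rewrite cats1.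
split=> [u|v v0].
  rewrite catE /= refl_word_cat s1 /=.
  by rewrite -[in LHS](dual_reflK a dP) -refl_conj ?dual_refl_Phi // dual_reflK // reflK.
rewrite catE /= zero_word_cat s2 ?zero_refl_V0 //=.
by rewrite zero_refl_conj ?zero_refl_V0 ?dual_refl_Phi // dual_reflK // zero_reflK.
Qed.

Lemma word_simple s : word s -> exists2 t, simple_word t & same_word s t.
Proof.
elim: s => [|a s IH] /=; first by exists [::].
move=> /andP [aP sP]; have [t tS [t1 t2]] := IH sP.
have [r rS [r1 r2]] := simple_word_root aP.
exists (r ++ t); first by move=> b; rewrite mem_cat => /orP [/rS|/tS].
have tV v : v \in V0 -> zero_word t v \in V0 by apply/zero_word_V0/simple_wordW.
split=> [u|v v0]; rewrite ?refl_word_cat ?zero_word_cat /=.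
  by rewrite r1 /= -t1.
by rewrite r2 ?tV //= -t2.
Qed.

(** Somewhere along the word a simple reflection turns a positive root negative, and it does this
    only to its own root. *)
Lemma deletion s a : simple_word s -> a \in Phi G -> 0 < ell a ->
    ell (dual_refl_word s a) < 0 ->
  exists s1 b s2, s = s1 ++ b :: s2 /\ dual_refl_word s2 a = b.
Proof.
elim: s => [|b s IH] sS aP a0 /=; first by rewrite ltNge (ltW a0).
move=> neg; have sS' : simple_word s by move=> c cs; apply: sS; rewrite inE cs orbT.
have bS : is_simple_root b by apply: sS; rewrite mem_head.
have sP := dual_refl_word_Phi (simple_wordW sS') aP.
have [pos|ng|/eqP] := ltrgt0P (ell (dual_refl_word s a)); last by rewrite (negPf (ell_neq0 sP)).
  have [E|ne] := eqVneq (dual_refl_word s a) b; first by exists [::], b, s.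
  by have := simple_reflection_gt0 bS sP pos ne; rewrite ltNge (ltW neg).
by have [s1 [c [s2 [-> E]]]] := IH sS' aP a0 ng; exists (b :: s1), c, s2.
Qed.

(* By [deletion], s a = s1 b s2 a and s2 a = b s2 as elements of W; the lifts
   satisfy the same relation, so the two copies of b cancel. *)
Lemma simple_word_trivial s : simple_word s -> (forall u, refl_word s u = u) ->
  forall v, v \in V0 -> zero_word s v = v.
Proof.
have [n] := ubnP (size s); elim: n s => // n IH s; case/lastP: s => // s a.
rewrite size_rcons ltnS => sn saS sa1 v v0.
have sS : simple_word s by move=> b bs; apply: saS; rewrite mem_rcons inE bs orbT.
have [aP a0 _] : is_simple_root a by apply: saS; rewrite mem_rcons mem_head.
have sdE t b c : dual_refl_word (rcons t b) c = dual_refl_word t (dual_refl b c).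
  by rewrite /dual_refl_word -cats1 foldr_cat.
have : dual_refl_word (rcons s a) a = a.
  apply/lfunP => u; rewrite -[in LHS](sa1 u) dual_refl_word_refl //; exact: simple_wordW.
rewrite sdE dual_refl_self // dual_refl_wordN => /eqP; rewrite eqr_oppLR => /eqP sa.
have [|s1 [b [s2 [sE s2E]]]] := deletion sS aP a0; first by rewrite sa ellN oppr_lt0.
have [bS s1S s2S] : [/\ is_simple_root b, simple_word s1 & simple_word s2].
  split; first by apply: sS; rewrite sE mem_cat mem_head orbT.
    by move=> c cs; apply: sS; rewrite sE mem_cat cs.
  by move=> c cs; apply: sS; rewrite sE mem_cat inE cs !orbT.
have bP : b \in Phi G by case: bS.
have s1W := simple_wordW s1S; have s2W := simple_wordW s2S.
have -> : zero_word (rcons s a) v = zero_word (s1 ++ s2) v.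
  rewrite sE -cats1 -catA !zero_word_cat /=.
  by rewrite (zero_word_conj s2W aP v0) s2E zero_reflK ?zero_word_V0.
apply: IH => //.
- by rewrite (leq_trans _ sn) // sE !size_cat /= addnS ltnS.
- by move=> c; rewrite mem_cat => /orP [/s1S|/s2S].
move=> u; rewrite -[RHS]sa1 sE -cats1 -catA !refl_word_cat /=.
by rewrite (refl_word_conj _ s2W aP) s2E reflK.
Qed.

End Order.

(** The word t^-1 s is trivial on h; rewritten in simple reflections, it is trivial on V[0]. *)
Lemma same_refl_word s t : word s -> word t ->
    (forall u, refl_word s u = refl_word t u) ->
  forall v, v \in V0 -> zero_word s v = zero_word t v.
Proof.
move=> sW tW st v v0.
have [u0 u0P] := regular_vector (@root_neq0 R G).
have rW : word (rev t ++ s) by rewrite /word all_cat -/(word _) word_rev tW.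
have [r rS [r1 r2]] := word_simple u0P rW.
have r1' u : refl_word r u = u.
  rewrite -r1 refl_word_cat st.
  by rewrite -{2}[t]revK refl_wordK // word_rev.
have := r2 v v0; rewrite (simple_word_trivial u0P rS r1' v0).
rewrite zero_word_cat => E.
by rewrite -[in RHS]E zero_wordK // zero_word_V0.
Qed.

End Lift.
End Words.

(** * The commutator of K and Q on the Cartan subalgebra *)

Section CommLemmas.
Context {R : realType}.
Local Notation C := (R[i]).
Variable M : vectType C.
Implicit Types A B D : 'End(M).

Lemma commE A B v : comm A B v = A (B v) - B (A v).
Proof. by rewrite /comm add_lfunE opp_lfunE !comp_lfunE. Qed.
Lemma symmE A B v : symm A B v = A (B v) + B (A v).
Proof. by rewrite /symm add_lfunE !comp_lfunE. Qed.

Lemma comm_linear A : linear (comm A).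
Proof.
move=> k B D; apply/lfunP => v; 
rewrite commE [RHS]add_lfunE scale_lfunE !commE !add_lfunE !scale_lfunE linearP /=.
by rewrite scalerBr opprD addrACA.
Qed.
HB.instance Definition _ A :=
  GRing.isLinear.Build C 'End(M) 'End(M) *:%R (comm A) (comm_linear A).

Lemma commBr A B D : comm A (B - D) = comm A B - comm A D.
Proof. exact: linearB. Qed.
Lemma commZr k A B : comm A (k *: B) = k *: comm A B.
Proof. exact: linearZ. Qed.

Lemma comm_comm A B D : comm A (comm B D) = comm (comm A B) D + comm B (comm A D).
Proof.
apply/lfunP => v; rewrite [RHS]add_lfunE !commE !linearB /= !opprK.
rewrite [RHS](AC ((2*2)*(2*2)) (((1*7)*(6*4))*((2*5)*(3*8)))) /=.
by rewrite !addNr !addr0.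
Qed.

Lemma comm_symm A B D : comm A (symm B D) = symm (comm A B) D + symm B (comm A D).
Proof.
apply/lfunP => v; rewrite [RHS]add_lfunE commE !symmE !commE linearD !linearB /=.
rewrite opprD [RHS](AC ((2*2)*(2*2)) (((1*7)*(6*4))*((2*5)*(3*8)))) /=.
by rewrite addNr subrr !addr0.
Qed.

Lemma symmC A B : symm A B = symm B A.
Proof. by rewrite /symm addrC. Qed.

Lemma symm_linear A : linear (symm A).
Proof.
move=> k B D; apply/lfunP => v.
rewrite symmE [RHS]add_lfunE scale_lfunE !symmE !add_lfunE !scale_lfunE linearP /=.
by rewrite scalerDr addrACA.
Qed.
HB.instance Definition _ A :=
  GRing.isLinear.Build C 'End(M) 'End(M) *:%R (symm A) (symm_linear A).

Lemma commDl A B D : comm (A + B) D = comm A D + comm B D.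
Proof.
apply/lfunP => v; rewrite commE [RHS]add_lfunE !commE !add_lfunE linearD /=.
by rewrite opprD addrACA.
Qed.
Lemma commZl k A D : comm (k *: A) D = k *: comm A D.
Proof.
apply/lfunP => v; rewrite commE [RHS]scale_lfunE !commE !scale_lfunE linearZ /=.
by rewrite scalerBr.
Qed.
Lemma symmZl k A D : symm (k *: A) D = k *: symm A D.
Proof. by rewrite symmC linearZ /= symmC. Qed.
Lemma symmZr k A D : symm A (k *: D) = k *: symm A D.
Proof. exact: linearZ. Qed.
Lemma symmDr A B D : symm D (A + B) = symm D A + symm D B.
Proof. exact: linearD. Qed.
Lemma symmDl A B D : symm (A + B) D = symm A D + symm B D.
Proof. by rewrite symmC linearD /= ![symm D _]symmC. Qed.
End CommLemmas.

(** * The Casimir tensor and its invariance *)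

Section Casimir.
Context {R : realType}.
Local Notation C := (R[i]).
Variable G : @simple_lie R.
Local Notation br := (bracket G).
Local Notation gsp := (@weight_space R G (sh G) G br).
Local Notation sharpG := (sharp (sh G) (form G)).
Implicit Types (a b c : cartan_dual G) (x y z : G).
Variables (u : 'I_(rank G) -> cartan G) (ud : 'I_(rank G) -> cartan_dual G).
Hypothesis u_ud : dual_bases u ud.

Lemma dual_bases_expand (w : cartan G) : w = \sum_i ud i w *: u i.
Proof.
pose X := [tuple u i | i < rank G].
have XE (i : 'I_(rank G)) : X`_i = u i.
  by rewrite -tnth_nth tnth_mktuple.
have Xfree : free X.
  apply/freeP => k kX i.
  have := congr1 (ud i) kX; rewrite linear0 linear_sum (bigD1 i) //= big1 ?addr0 => [|j ji].
    by rewrite XE linearZ /= u_ud eqxx [_ *: _]mulr1.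
  by rewrite XE linearZ /= u_ud eq_sym (negPf ji) [_ *: _]mulr0.
have /span_basis Xspan : basis_of {:cartan G} X.
  by rewrite basisEfree Xfree subvf size_tuple dimvf leqnn.
have wX : w \in <<X>>%VS by rewrite Xspan memvf.
rewrite {1}(coord_span wX); apply: eq_bigr => i _; rewrite XE; congr (_ *: _).
have := congr1 (ud i) (coord_span wX); rewrite linear_sum (bigD1 i) //= big1 ?addr0 => [->|j ji].
  by rewrite XE linearZ /= u_ud eqxx [_ *: _]mulr1.
by rewrite XE linearZ /= u_ud eq_sym (negPf ji) [_ *: _]mulr0.
Qed.

(** Dual bases of g for the form: the sum of the p.1 (x) p.2 is the Casimir tensor, root part and
    Cartan part. *)
Definition dual_pairs : seq (G * G) :=
  [seq (rootv a, rootv (- a)) | a <- Phi G]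
  ++ [seq (vsval (u i), vsval (sharpG (ud i))) | i <- index_enum 'I_(rank G)].

Lemma sum_dual_pairs (W : nmodType) (F : G * G -> W) :
  \sum_(p <- dual_pairs) F p = \sum_(a <- Phi G) F (rootv a, rootv (- a))
    + \sum_i F (vsval (u i), vsval (sharpG (ud i))).
Proof. by rewrite big_cat !big_map. Qed.

Lemma formBl x y z : form G (x - y) z = form G x z - form G y z.
Proof. by rewrite formDl formNl. Qed.

Lemma form_suml (I : Type) (r : seq I) (F : I -> G) z :
  form G (\sum_(i <- r) F i) z = \sum_(i <- r) form G (F i) z.
Proof. by rewrite linear_sum sum_lfunE. Qed.

Lemma form_root_cartan a (w : cartan G) : a \in Phi G -> form G (rootv a) (vsval w) = 0.
Proof.
move=> aP; have a0 : a + 0 != 0 by rewrite addr0 root_neq0.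
exact: (form_weight a0 (rootvP aP) (cartan_weight0 (subvsP w))).
Qed.

Lemma form_root_weight a b x : a \in Phi G -> b != - a -> x \in gsp b ->
  form G (rootv a) x = 0.
Proof.
move=> aP ba xb; apply: form_weight (rootvP aP) xb.
by rewrite addrC addr_eq0.
Qed.

Lemma dual_pairs_expandr x : x = \sum_(p <- dual_pairs) form G x p.1 *: p.2.
Proof.
apply/eqP; rewrite -subr_eq0; apply/eqP/form_eq0_on => [y yh|b y bP yb].
  rewrite -(vsprojK yh); set w := vsproj _ y.
  rewrite formBl form_suml sum_dual_pairs big_seq big1 ?add0r => [|a aP]; last first.
    by rewrite formZl form_root_cartan ?Phi_opp ?mulr0.
  under eq_bigr => i _ do rewrite formZl /= form_sharp.
  rewrite {1}[w]dual_bases_expand linear_sum linear_sum /= -sumrB big1 // => i _.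
  by rewrite formZr mulrC subrr.
have NbP := Phi_opp bP.
rewrite formBl form_suml sum_dual_pairs [X in _ - (_ + X)]big1 ?addr0 => [|i _]; last first.
  have b0 : 0 + b != 0 by rewrite add0r root_neq0.
  by rewrite formZl /= (form_weight b0 (cartan_weight0 (subvsP _)) yb) mulr0.
rewrite (bigD1_seq b) ?Phi_uniq //= big1_seq ?addr0 => [|a /andP [ab aP]]; last first.
  rewrite formZl /= (form_root_weight _ _ yb) ?mulr0 ?Phi_opp // opprK eq_sym //.
have [k ->] := root_space_line bP yb.
by rewrite formZl !formZr [form G (rootv (- b)) _]form_sym rootv_norm // mulr1 mulrC subrr.
Qed.

Lemma dual_pairs_expandl x : x = \sum_(p <- dual_pairs) form G x p.2 *: p.1.
Proof.
apply/eqP; rewrite -subr_eq0; apply/eqP/form_nondegenerate => y.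
rewrite formBl form_suml {1}[y]dual_pairs_expandr linear_sum /= -sumrB big1 // => p _.
by rewrite formZl formZr [form G y _]form_sym mulrC subrr.
Qed.

Lemma linear_sum_scale (U W : lmodType C) (f : U -> W) (I : Type) (r : seq I)
    (k : I -> C) (v : I -> U) : linear f ->
  f (\sum_(i <- r) k i *: v i) = \sum_(i <- r) k i *: f (v i).
Proof.
move=> fl; have f0 : f 0 = 0.
  by have := fl (- 1) 0 0; rewrite scaleN1r oppr0 addr0 scaleN1r addNr.
by elim: r => [|i r IH]; rewrite ?big_nil // !big_cons fl IH.
Qed.

(** Invariance tested on an arbitrary bilinear map. Once [z, p.1] and [z, p.2] are expanded in the
    dual bases, the coefficients cancel by invariance of the form. *)
Lemma casimir_invariant (W : lmodType C) (Psi : G -> G -> W) z :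
    (forall y, linear (Psi^~ y)) -> (forall x, linear (Psi x)) ->
  \sum_(p <- dual_pairs) (Psi (br z p.1) p.2 + Psi p.1 (br z p.2)) = 0.
Proof.
move=> Pl Pr; rewrite big_split /=.
under eq_bigr => p _ do
  rewrite [X in Psi X _]dual_pairs_expandl (linear_sum_scale _ _ _ (Pl _)).
under [X in _ + X]eq_bigr => p _ do
  rewrite [X in Psi _ X]dual_pairs_expandr (linear_sum_scale _ _ _ (Pr _)).
rewrite exchange_big /= -big_split big1 //= => p _.
rewrite -big_split big1 //= => q _.
rewrite -scalerDl bracket_anti formNl form_inv [form G (br z _) _]form_sym.
by rewrite addNr scale0r.
Qed.

End Casimir.

(** * The equivariant defect of the K-Q relation *)

Section DModuleFacts.
Context {R : realType}.
Local Notation C := (R[i]).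
Variables (G : @simple_lie R) (lambda : C) (V : D_module G lambda).
Local Notation br := (bracket G).
Local Notation gsp := (@weight_space R G (sh G) G br).
Local Notation sharpG := (sharp (sh G) (form G)).
Implicit Types (a b c : cartan_dual G) (x y z : G).

Lemma opX_rep : is_rep (opX V).
Proof. by case: (D_K V) => psi [<- _ psiM] x y v; rewrite -(psiM 0%N 0%N) commE. Qed.

Lemma equivariant_comm (Y : 'Hom(G, 'End(V))) :
  (forall x y, comm (opX V x) (Y y) = Y (br x y)) -> equivariant (opX V) Y.
Proof. by move=> XY x y v; rewrite -XY commE subrK. Qed.

Lemma opXD x y : opX V (x + y) = opX V x + opX V y.
Proof. exact: linearD. Qed.
Lemma opXZ (k : C) x : opX V (k *: x) = k *: opX V x.
Proof. exact: linearZ. Qed.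

Lemma opX_X x y : comm (opX V x) (opX V y) = opX V (br x y).
Proof. by case: (D_K V) => psi [<- _ psiM]; rewrite psiM. Qed.

Lemma opX_K x y : comm (opX V x) (opK V y) = opK V (br x y).
Proof. by case: (D_K V) => psi [<- <- psiM]; rewrite psiM. Qed.

Lemma opX_Q x y : comm (opX V x) (opQ V y) = opQ V (br x y).
Proof. by case: (D_Q V) => psi [<- <- psiM]; rewrite psiM. Qed.

Lemma opK_comm0 x y : br x y = 0 -> comm (opK V x) (opK V y) = 0.
Proof. by case: (D_K V) => psi [_ <- psiM] xy; rewrite psiM xy linear0. Qed.

Lemma opQ_comm0 x y : br x y = 0 -> comm (opQ V x) (opQ V y) = 0.
Proof. by case: (D_Q V) => psi [_ <- psiM] xy; rewrite psiM xy linear0. Qed.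

Variables (u : 'I_(rank G) -> cartan G) (ud : 'I_(rank G) -> cartan_dual G).
Hypothesis u_ud : dual_bases u ud.

Definition casimir_sum x y : 'End(V) :=
  \sum_(p <- dual_pairs u ud) symm (opX V (br x p.1)) (opX V (br p.2 y)).

(* The defect of the relation for [K x, Q y], completed by the Cartan part of
   the Casimir tensor so as to be equivariant. *)
Definition KQ_defect x y : 'End(V) :=
  comm (opK V x) (opQ V y) - opP V (br x y) - (lambda / 4) *: casimir_sum x y.

(** By the Jacobi identity z also acts on the two tensor factors p.1 and p.2; these terms cancel by
    [casimir_invariant]. *)
Lemma casimir_sum_equivariant z x y :
  comm (opX V z) (casimir_sum x y) = casimir_sum (br z x) y + casimir_sum x (br z y).
Proof.
pose Psi p q := symm (opX V (br x p)) (opX V (br q y)).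
have Pl q : linear (Psi^~ q).
  by move=> k p p'; rewrite /Psi brDr brZr opXD opXZ symmDl symmZl.
have Pr p : linear (Psi p).
  by move=> k q q'; rewrite /Psi brDl brZl opXD opXZ symmDr symmZr.
have inv := casimir_invariant u_ud z Pl Pr.
rewrite /casimir_sum linear_sum /=.
pose T p := symm (opX V (br (br z x) p.1)) (opX V (br p.2 y))
  + symm (opX V (br x p.1)) (opX V (br p.2 (br z y))).
rewrite (eq_bigr (fun p => T p + (Psi (br z p.1) p.2 + Psi p.1 (br z p.2)))).
  by rewrite big_split /= [X in _ + X]inv addr0 big_split.
move=> p _; rewrite comm_symm !opX_X (bracket_deriv z x) (bracket_deriv z p.2).
rewrite !opXD symmDl symmDr /Psi /T.
by rewrite [RHS](AC (2*2) ((1*3)*(4*2))).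
Qed.

Lemma KQ_defect_equivariant z x y :
  comm (opX V z) (KQ_defect x y) = KQ_defect (br z x) y + KQ_defect x (br z y).
Proof.
rewrite /KQ_defect 2!commBr commZr comm_comm opX_K opX_Q D_P.
rewrite casimir_sum_equivariant bracket_deriv linearD scalerDr !opprD.
by rewrite [RHS](AC (3*3) ((1*4)*(2*5)*(3*6))).
Qed.

Lemma linear_combine (W : lmodType C) (k l : C) (A A' B B' D D' : W) :
  k *: A + A' - (k *: B + B') - l *: (k *: D + D')
    = k *: (A - B - l *: D) + (A' - B' - l *: D').
Proof.
rewrite scalerDr scalerA mulrC -scalerA !scalerBr !opprD.
by rewrite [LHS](AC (2*2*2) ((1*3*5)*(2*4*6))).
Qed.

Lemma KQ_defect_linearl y : linear (KQ_defect^~ y).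
Proof.
move=> k x x'; rewrite /KQ_defect.
have -> : casimir_sum (k *: x + x') y = k *: casimir_sum x y + casimir_sum x' y.
  rewrite /casimir_sum scaler_sumr -big_split; apply: eq_bigr => p _ /=.
  by rewrite brDl brZl opXD opXZ symmDl symmZl.
rewrite (linearP (opK V)) commDl commZl brDl brZl (linearP (opP V)).
exact: linear_combine.
Qed.

Lemma KQ_defect_linearr x : linear (KQ_defect x).
Proof.
move=> k y y'; rewrite /KQ_defect.
have -> : casimir_sum x (k *: y + y') = k *: casimir_sum x y + casimir_sum x y'.
  rewrite /casimir_sum scaler_sumr -big_split; apply: eq_bigr => p _ /=.
  by rewrite brDr brZr opXD opXZ symmDr symmZr.
rewrite (linearP (opQ V)) (linearP (comm _)) brDr brZr (linearP (opP V)).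
exact: linear_combine.
Qed.

Lemma casimir_sumE x y : casimir_sum x y = root_sum (opX V) x y
  + \sum_i symm (opX V (br x (vsval (u i)))) (opX V (br (vsval (sharpG (ud i))) y)).
Proof. by rewrite /casimir_sum sum_dual_pairs. Qed.

(** The term of the relation with coefficient - lambda (a, b) / 4 is the Cartan part of the Casimir
    sum: each dual pair contributes - a(u_i) b(u^i). *)
Lemma KQ_defect_roots a b : a \in Phi G -> b \in Phi G -> a != - b ->
  KQ_defect (rootv a) (rootv b) = 0.
Proof.
move=> aP bP ab; rewrite /KQ_defect D_KQ // casimir_sumE.
have -> : \sum_i symm (opX V (br (rootv a) (vsval (u i))))
    (opX V (br (vsval (sharpG (ud i))) (rootv b)))
  = - ip a b *: symm (opX V (rootv a)) (opX V (rootv b)).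
  rewrite ipE [sharpG b](dual_bases_expand u_ud) linear_sum -sumrN scaler_suml.
  apply: eq_bigr => i _.
  rewrite bracket_anti (cartan_bracket (u i) (rootvP aP)) -scaleNr.
  rewrite (cartan_bracket (sharpG (ud i)) (rootvP bP)).
  rewrite !opXZ symmZl symmZr scalerA; congr (_ *: _).
  by rewrite linearZ /= -ipE ip_sym ipE mulrC mulrN.
set A := opP V _; set S := symm _ _; set Q := root_sum _ _ _.
have -> : (lambda / 4) *: (Q + - ip a b *: S) = (lambda / 4) *: Q - (lambda * (ip a b / 4)) *: S.
  by rewrite scalerDr scalerA mulrN scaleNr; rewrite [lambda / 4 * _]mulrAC -mulrA.
rewrite -[A - _ + _]addrA [A + _]addrC addrK.
by rewrite [_ *: Q - _]addrC subrr.
Qed.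

(** Otherwise irreducibility would leave only the roots a and -a, which span a line. *)
Lemma root_neighbour a : (2 <= rank G)%N -> a \in Phi G ->
  exists2 b, b \in Phi G & [&& b != a, b != - a & ip a b != 0].
Proof.
move=> rk aP; apply: contrapT => nex.
pose S c := (c == a) || (c == - a).
have SP c : c \in Phi G -> S c.
  apply: (@root_connected _ _ S a) => //; first by rewrite /S eqxx.
  move=> {}c d cP dP Sc cd; apply: contrapT => /negP; rewrite negb_or => /andP [d1 d2].
  apply: nex; exists d => //; rewrite d1 d2 /=; apply: contraNneq cd => ad0.
  by case/orP: Sc => /eqP ->; rewrite ?ipNl ad0 ?oppr0.
have full : <[sharpG a]>%VS = fullv.
  apply: sharp_span => c /SP /orP [] /eqP ->; rewrite ?sharpN ?rpredN memv_line //.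
have := dim_vline (sharpG a); rewrite full dimvf => E.
by move: rk; rewrite /rank; have -> : \dim (sh G) = dim (cartan G) by []; rewrite E; case: eqP.
Qed.

(** If neither b + c nor b - c is a root, the Cartan integers of b against c and against -c are both
    non-negative, so (b, c) = 0. *)
Lemma root_sum_neighbour b : (2 <= rank G)%N -> b \in Phi G ->
  exists2 c, c \in Phi G & [/\ c != b, c != - b & b + c \in Phi G].
Proof.
move=> rk bP; have [c cP /and3P [cb cNb bc]] := root_neighbour rk bP.
have [bcP|bcN] := boolP (b + c \in Phi G); first by exists c.
exists (- c); first exact: Phi_opp.
rewrite eqr_opp eqr_oppLR; split; [exact: cNb|exact: cb|apply: contraT => bNc].
have cb0 : c + b != 0 by rewrite addr_eq0.
have Ncb0 : - c + b != 0 by rewrite addrC subr_eq0 (eq_sym b c); exact: cb.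
rewrite addrC in bcN; rewrite addrC in bNc.
have [k kE] := root_string cP bP cb0 bcN.
have [m mE] := root_string (Phi_opp cP) bP Ncb0 bNc.
move: mE bc; rewrite ipNr ipNl ipNr opprK kE => /eqP; rewrite eq_sym -subr_eq0 opprK -mulrDl.
rewrite mulf_eq0 -natrD pnatr_eq0 addn_eq0 => /orP [/andP [_ /eqP ->]|/eqP ->];
  by rewrite ?mul0r ?mulr0 eqxx.
Qed.

Lemma sharp_ind (P : cartan G -> Prop) : P 0 ->
  (forall k w w', P w -> P w' -> P (k *: w + w')) ->
  (forall a, a \in Phi G -> P (sharpG a)) -> forall w, P w.
Proof.
move=> P0 PD Pa w.
have full : <<[seq sharpG a | a <- Phi G]>>%VS = fullv.
  by apply: sharp_span => a aP; apply/memv_span/map_f.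
have wX : w \in <<in_tuple [seq sharpG a | a <- Phi G]>>%VS by rewrite full memvf.
rewrite (coord_span wX); elim/big_rec: _ => // i w' _; apply: PD.
have : [seq sharpG a | a <- Phi G]`_i \in [seq sharpG a | a <- Phi G] by rewrite mem_nth.
by case/mapP => a aP ->; apply: Pa.
Qed.
Lemma linear_zero (U W : lmodType C) (f : U -> W) : linear f -> f 0 = 0.
Proof. by move=> /(_ (- 1) 0 0); rewrite scaleN1r oppr0 addr0 scaleN1r addNr. Qed.

Lemma linear_scale (U W : lmodType C) (f : U -> W) k p : linear f -> f (k *: p) = k *: f p.
Proof. by move=> fl; rewrite -[k *: p]addr0 fl (linear_zero fl) addr0. Qed.

End DModuleFacts.

(** * Values of the defect on the Cartan subalgebra *)

Section KQCartan.
Context {R : realType}.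
Local Notation C := (R[i]).
Variables (G : @simple_lie R) (lambda : C) (V : D_module G lambda).
Local Notation br := (bracket G).
Local Notation gsp := (@weight_space R G (sh G) G br).
Local Notation sharpG := (sharp (sh G) (form G)).
Implicit Types (a b c : cartan_dual G) (x y z : G).
Variables (u : 'I_(rank G) -> cartan G) (ud : 'I_(rank G) -> cartan_dual G).
Hypothesis u_ud : dual_bases u ud.
Local Notation defect := (KQ_defect V u ud).

Lemma defect0r x : defect x 0 = 0.
Proof. exact: (linear_zero (KQ_defect_linearr V u ud x)). Qed.
Lemma defect0l y : defect 0 y = 0.
Proof. exact: (linear_zero (KQ_defect_linearl V u ud y)). Qed.
Lemma defectZr k x y : defect x (k *: y) = k *: defect x y.
Proof. exact: (linear_scale k y (KQ_defect_linearr V u ud x)). Qed.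
Lemma defectZl k x y : defect (k *: x) y = k *: defect x y.
Proof. exact: (linear_scale k x (KQ_defect_linearl V u ud y)). Qed.
Lemma defectNr x y : defect x (- y) = - defect x y.
Proof. by rewrite -scaleN1r defectZr scaleN1r. Qed.
Lemma defect_equivariant0 z x y : defect x y = 0 ->
  defect (br z x) y + defect x (br z y) = 0.
Proof. by move=> xy; rewrite -(KQ_defect_equivariant V u_ud) xy; exact: (linear0 (comm _)). Qed.
Lemma defect_roots0 a b : a \in Phi G -> b \in Phi G -> a != - b ->
  defect (rootv a) (rootv b) = 0.
Proof. exact: KQ_defect_roots. Qed.
Lemma defect_cartan (w w' : cartan G) : defect (vsval w) (vsval w')
  = comm (opK V (vsval w)) (opQ V (vsval w'))
    - (lambda / 4) *: root_sum (opX V) (vsval w) (vsval w').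
Proof.
have hh (v v' : cartan G) : br (vsval v) (vsval v') = 0.
  by rewrite (cartan_bracket v (cartan_weight0 (subvsP v'))) lfunE /= scale0r.
rewrite /KQ_defect hh linear0 subr0 casimir_sumE [X in _ *: (_ + X)]big1 ?addr0 // => i _.
by rewrite !hh linear0 linear0.
Qed.
Opaque KQ_defect.

Lemma bracket_roots a b : a \in Phi G -> b \in Phi G -> a + b != 0 ->
  exists2 k : C, br (rootv a) (rootv b) = k *: rootv (a + b)
    & k != 0 -> a + b \in Phi G.
Proof.
move=> aP bP ab0; have w := weight_space_bracket (rootvP aP) (rootvP bP).
have [E|n0] := eqVneq (br (rootv a) (rootv b)) 0.
  by exists 0; rewrite ?scale0r ?eqxx.
have abP := weight_root ab0 w n0.
by have [k kE] := root_space_line abP w; exists k.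
Qed.

(** Apply X_a to F(X_{-a}, X_b) = 0. The term F(X_{-a}, [X_a, X_b]) vanishes since a + b differs
    from a; the other slot is symmetric. *)
Lemma KQ_defect_sharp_root a b : a \in Phi G -> b \in Phi G -> a != b -> a != - b ->
  defect (vsval (sharpG a)) (rootv b) = 0 /\
  defect (rootv b) (vsval (sharpG a)) = 0.
Proof.
move=> aP bP ab aNb; have NaP := Phi_opp aP.
have NaNb : - a != - b by rewrite eqr_opp.
have ab0 : a + b != 0 by rewrite addr_eq0.
have bNa : b != - - a by rewrite opprK eq_sym.
have El := defect_equivariant0 (rootv a) (defect_roots0 NaP bP NaNb).
have Er := defect_equivariant0 (rootv a) (defect_roots0 bP NaP bNa).
rewrite -/(Hroot a) Hroot_sharp // in El; rewrite -/(Hroot a) Hroot_sharp // in Er.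
have b0 := root_neq0 bP.
have side : - a != - (a + b) by rewrite eqr_opp -subr_eq0 opprD addrA subrr add0r oppr_eq0.
have side' : a + b != - - a by rewrite opprK -subr_eq0 addrAC subrr add0r.
have [k E abP] := bracket_roots aP bP ab0; rewrite E defectZr in El.
rewrite E defectZl in Er; have [k0|/abP {}abP] := eqVneq k 0.
  by rewrite k0 scale0r addr0 in El; rewrite k0 scale0r add0r in Er.
rewrite (defect_roots0 NaP abP side) scaler0 addr0 in El.
by rewrite (defect_roots0 abP NaP side') scaler0 add0r in Er.
Qed.

(** The case excluded before, w proportional to H_b, comes from H_b = H_{b+c} - H_c; a suitable c
    exists in rank at least 2. *)
Lemma KQ_defect_cartan_root (w : cartan G) b : (2 <= rank G)%N -> b \in Phi G ->
  defect (vsval w) (rootv b) = 0 /\ defect (rootv b) (vsval w) = 0.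
Proof.
move=> rk bP; move: w; apply: (@sharp_ind R G (fun w => defect (vsval w) (rootv b) = 0 /\
  defect (rootv b) (vsval w) = 0)) => [|k w w' [l r] [l' r']|a aP].
- by rewrite [vsval 0]linear0 defect0l defect0r.
- by rewrite linearP KQ_defect_linearl KQ_defect_linearr l r l' r' scaler0 addr0.
have Fb : defect (vsval (sharpG b)) (rootv b) = 0 /\
    defect (rootv b) (vsval (sharpG b)) = 0.
  have [c cP [cb cNb bcP]] := root_sum_neighbour rk bP.
  have d1 : b + c != b by rewrite -subr_eq0 addrAC subrr add0r root_neq0.
  have d2 : b + c != - b.
    rewrite -addr_eq0 addrAC addr_eq0; apply: contraNneq (double_root bP) => ->.
    exact: Phi_opp.
  have [l r] := KQ_defect_sharp_root cP bP cb cNb.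
  have [l' r'] := KQ_defect_sharp_root bcP bP d1 d2.
  have -> : sharpG b = - 1 *: sharpG c + sharpG (b + c).
    by rewrite sharpD scaleN1r addrC addrK.
  by rewrite linearP KQ_defect_linearl KQ_defect_linearr l r l' r' scaler0 addr0.
have [->|ab] := eqVneq a b; first exact: Fb.
have [->|aNb] := eqVneq a (- b); last exact: KQ_defect_sharp_root.
have -> : sharpG (- b) = - 1 *: sharpG b by rewrite sharpN scaleN1r.
by case: Fb => l r; rewrite linearZ /= defectZl defectZr l r scaler0.
Qed.

Definition KQ_central a := defect (rootv (- a)) (rootv a).

Lemma KQ_defect_sharpr (w : cartan G) a : (2 <= rank G)%N -> a \in Phi G ->
  defect (vsval w) (vsval (sharpG a)) = a w *: KQ_central a.
Proof.
move=> rk aP; have NaP := Phi_opp aP.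
have [l _] := KQ_defect_cartan_root w rk aP.
have := defect_equivariant0 (rootv (- a)) l.
rewrite [br _ (vsval w)]bracket_anti (cartan_bracket w (rootv_opp aP)) opp_lfunE scaleNr opprK.
rewrite defectZl [br (rootv (- a)) _]bracket_anti -/(Hroot a) Hroot_sharp // defectNr => E.
by move/eqP: E; rewrite subr_eq0 eq_sym => /eqP.
Qed.

Lemma KQ_defect_sharpl (w : cartan G) a : (2 <= rank G)%N -> a \in Phi G ->
  defect (vsval (sharpG a)) (vsval w) = a w *: KQ_central a.
Proof.
move=> rk aP; have NaP := Phi_opp aP.
have [_ r] := KQ_defect_cartan_root w rk NaP.
have := defect_equivariant0 (rootv a) r.
rewrite [br _ (vsval w)]bracket_anti (cartan_bracket w (rootvP aP)) -scaleNr.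
rewrite defectZr -/(Hroot a) Hroot_sharp // scaleNr => /eqP.
by rewrite subr_eq0 => /eqP.
Qed.

(** F(H_c, H_d), computed from either argument, is (c, d) times the constant of c and (c, d) times
    that of d; connectedness does the rest. *)
Lemma KQ_central_const a b : (2 <= rank G)%N -> a \in Phi G -> b \in Phi G ->
  KQ_central b = KQ_central a.
Proof.
move=> rk aP bP; apply/eqP.
apply: (@root_connected _ _ (fun c => KQ_central c == KQ_central a) a) bP => //.
move=> c d cP dP /eqP <- cd.
have := KQ_defect_sharpr (sharpG c) rk dP.
rewrite (KQ_defect_sharpl (sharpG d) rk cP) -!ipE [ip d c]ip_sym => /eqP.
by rewrite -subr_eq0 -scalerBr scaler_eq0 (negPf cd) /= subr_eq0 eq_sym.
Qed.

Lemma KQ_cartan (b : cartan_dual G) (w w' : cartan G) : (2 <= rank G)%N -> b \in Phi G ->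
  comm (opK V (vsval w)) (opQ V (vsval w'))
    = (form G (vsval w) (vsval w') : C) *: opZ V b
      + (lambda / 4) *: root_sum (opX V) (vsval w) (vsval w').
Proof.
move=> rk bP.
have defE := defect_cartan.
have FE (v : cartan G) :
    defect (vsval w) (vsval v) = (form G (vsval w) (vsval v) : C) *: KQ_central b.
  move: v; apply: (@sharp_ind R G (fun v => defect (vsval w) (vsval v)
    = (form G (vsval w) (vsval v) : C) *: KQ_central b)) => [|k v v' l l'|a aP].
  - by rewrite linear0 defect0r linear0 scale0r.
  - by rewrite linearP KQ_defect_linearr l l' linearP scalerDl scalerA.
  by rewrite KQ_defect_sharpr // form_sym form_sharp (KQ_central_const rk bP aP).
have -> : opZ V b = KQ_central b.
  rewrite /opZ Hroot_sharp // -defE KQ_defect_sharpr // -ipE scalerA mulVf ?scale1r //.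
  exact: ip_neq0.
by rewrite -FE defE subrK.
Qed.

End KQCartan.

(** * The constant term of k *)

Local Open Scope classical_set_scope.

Section PowerSeriesLimit.
Variable K : numFieldType.

Lemma geometric_sum_le2 (q : K) N : 0 <= q -> q <= 2^-1 ->
  \sum_(n < N) q ^+ n <= 2.
Proof.
move=> q0 q2; have s0 : 0 <= \sum_(n < N) q ^+ n.
  by apply: sumr_ge0 => n _; rewrite exprn_ge0.
have q1 : 2^-1 <= 1 - q.
  have h : 2^-1 = 1 - 2^-1 :> K by field.
  by rewrite h lerD2l lerN2.
have : 2^-1 * \sum_(n < N) q ^+ n <= 1.
  apply: (le_trans (ler_wpM2r s0 q1)).
  by rewrite -opprB mulNr -subrX1 opprB gerBl exprn_ge0.
by rewrite mulrC ler_pdivrMr ?ltr0n // mul1r.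
Qed.

(** Abel's estimate: if the a_n s^n are bounded by M at one radius s, then |a_0 - f(x)| <= 2 M |x| /
    s for 0 < |x| <= s / 2. *)
Lemma pseries_lim0 (a : nat -> K) (f : K -> K) (r : K) : 0 < r ->
    (forall x, x != 0 -> `|x| < r ->
      (series (fun n => a n * x ^+ n : K^o) : nat -> K^o) @ \oo --> (f x : K^o)) ->
  (f x : K^o) @[x --> (0 : K^o)^'] --> (a 0%N : K^o).
Proof.
move=> r0 fS; pose s := r / 2.
have s0 : 0 < s by rewrite divr_gt0 // ltr0n.
have sr : `|s| < r by rewrite gtr0_norm // gtr_pMr // invf_lt1 ?ltr1n ?ltr0n.
have [M M0 MP] : exists2 M, 0 < M & forall n, `|a n * s ^+ n| <= M.
  have /cvgP/cvg_series_cvg_0/cvgr0Pnorm_le := fS s (lt0r_neq0 s0) sr.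
  move=> /(_ 1 ltr01) [N _ NP]; exists (1 + \sum_(n < N) `|a n * s ^+ n|).
    by rewrite ltr_pwDl ?ltr01 // sumr_ge0.
  move=> n; have [nN|/NP nN] := ltnP n N; last first.
    by rewrite (le_trans nN) // lerDl sumr_ge0.
  rewrite (bigD1 (Ordinal nN)) //= addrCA lerDl addr_ge0 ?ler01 //.
  by rewrite sumr_ge0.
have bound x : x != 0 -> `|x| <= s / 2 -> `|a 0%N - f x| <= 2 * M * (`|x| / s).
  move=> x0 xs; have xr : `|x| < r.
    rewrite (le_lt_trans xs) // (le_lt_trans _ sr) // gtr0_norm //.
    by rewrite ler_piMr ?ltW // invf_lt1 ?ltr1n ?ltr0n.
  set q := `|x| / s; have q0 : 0 <= q by rewrite divr_ge0 // ltW.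
  have q2 : q <= 2^-1 by rewrite ler_pdivrMr // mulrC.
  have aq n : `|a n * x ^+ n| <= M * q ^+ n.
    have -> : `|a n * x ^+ n| = `|a n * s ^+ n| * q ^+ n.
      rewrite !normrM !normrX (gtr0_norm s0) -mulrA -exprMn /q.
      by rewrite mulrC [in RHS]mulrCA divff ?mulr1 ?gt_eqF // mulrC.
    by rewrite ler_wpM2r ?exprn_ge0.
  have part N : `|a 0%N - series (fun n => a n * x ^+ n : K^o) N.+1| <= 2 * M * q.
    rewrite /series /= big_mkord big_ord_recl expr0 mulr1 opprD addrA subrr sub0r normrN.
    apply: (le_trans (ler_norm_sum _ _ _)).
    apply: (@le_trans _ _ (\sum_(n < N) M * q * q ^+ n)).
      by apply: ler_sum => n _; rewrite -mulrA -exprS; exact: aq.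
    rewrite -mulr_sumr (_ : 2 * M * q = M * q * 2); last by ring.
    by apply: ler_wpM2l; [rewrite mulr_ge0 // ltW|exact: geometric_sum_le2].
  apply/ler_addgt0Pr => e e0.
  have /cvgrPdist_lt/(_ e e0) [N _ NP] := fS x x0 xr.
  rewrite -[a 0%N](subrK (series (fun n => a n * x ^+ n : K^o) N.+1)) -addrA.
  apply: (le_trans (ler_normD _ _)); rewrite lerD ?part //.
  by rewrite distrC ltW // NP //= leqnSn.
apply/cvgrPdist_le => e e0.
have c0 : 0 < e * s / (2 * M).
  by apply: divr_gt0; apply: mulr_gt0 => //; rewrite ltr0n.
near=> x; apply: le_trans (bound x _ _) _.
- by near: x; exact: nbhs_dnbhs_neq.
- by near: x; apply: dnbhs0_le; rewrite divr_gt0 ?ltr0n.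
rewrite mulrA ler_pdivrMr // mulrC -ler_pdivlMr ?mulr_gt0 ?ltr0n //.
by near: x; exact: dnbhs0_le.
Unshelve. all: by end_near.
Qed.
End PowerSeriesLimit.

Section Theta.
Context {R : realType}.
Local Notation C := (R[i]).

(* The expansion of k at x = 0 forces (theta(x)/x)^-1 = 1 + L x + o(x); the
   function being even, L = 0. This replaces theta''(0) = 0. *)
Lemma k_coeff0 (tau : C) (theta : C -> C) (kc : C -> nat -> C) (z : C) :
  is_theta tau theta -> is_k_coeff tau theta kc -> ~ lattice tau z ->
  kc z 0%N = dlog theta z.
Proof.
move=> [drv odd zeros d0 _] /(_ z) kz zL; have [r r0 kS] := kz zL.
have kl := pseries_lim0 r0 kS.
have tz : theta z != 0 by apply/eqP => /zeros.
have t0 : theta 0 = 0 by apply/zeros; exists 0, 0; rewrite mul0r addr0.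
have quot y : ((theta (y + x) - theta y) / x : C^o) @[x --> (0 : C^o)^'] -->
    (cderive theta y : C^o).
  have := drv y; rewrite /derivable => /cvg_ex [l ldef].
  have ldef' : (fun h : C => h^-1 *: (theta (h + y) - theta y) : C^o) @ (0 : C^o)^' --> (l : C^o).
    by apply: cvg_trans ldef; apply: near_eq_cvg; near=> h; rewrite /= [h *: _]mulr1.
  have -> : cderive theta y = l.
    by rewrite /cderive /derive1; apply: cvg_lim ldef'; exact: norm_hausdorff.
  apply: cvg_trans ldef'; apply: near_eq_cvg; near=> h.
  by rewrite /= (addrC y) [h^-1 *: _]mulrC.
pose g (x : C) := (theta x / x : C^o).
have gl : g x @[x --> (0 : C^o)^'] --> (1 : C^o).
  have := quot 0; rewrite d0 t0; apply: cvg_trans; apply: near_eq_cvg; near=> h.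
  by rewrite /g add0r subr0.
have gVl : (g x)^-1 @[x --> (0 : C^o)^'] --> (1 : C^o)^-1 by apply: cvgV gl; rewrite ?oner_eq0.
(* Where theta(x) is nonzero this is 1/theta(x) - 1/x, which is odd and does not involve z. Its
   limit at 0 is thus both L and -L. *)
pose phi (x : C) := (((g x)^-1 - 1) / x : C^o).
have phiE x : x != 0 ->
    phi x = kfun theta z x - (theta (z + x) - theta z) / x / theta z * (g x)^-1.
  move=> x0; rewrite /phi /kfun /g.
  (* With 0^-1 = 0 the identity persists where theta(x) = 0, so zeros near 0 call for no separation
     argument. *)
  have [->|tx] := eqVneq (theta x) 0.
    by rewrite mulr0 !mul0r !invr0 !mulr0 !sub0r subr0 mulNr mul1r.
  by field; rewrite tz tx x0.
pose L := kc z 0%N - cderive theta z / theta z.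
have phil : phi x @[x --> (0 : C^o)^'] --> (L : C^o).
  have E : phi x @[x --> (0 : C^o)^'] -->
      (kc z 0%N - cderive theta z / theta z * 1^-1 : C^o).
    apply: cvg_trans (cvgB kl (cvgM (cvgM (quot z) (cvg_cst ((theta z)^-1 : C^o))) gVl)).
    by apply: near_eq_cvg; near=> x; rewrite phiE //; near: x; exact: (@nbhs_dnbhs_neq C^o 0).
  by move: E; rewrite invr1 mulr1.
have philN : phi (- x) @[x --> (0 : C^o)^'] --> (L : C^o).
  apply/cvgrPdist_le => e e0; have /cvgrPdist_le/(_ e e0) := phil.
  rewrite near_withinE => /nbhs_ballP [d /= dgt0 H].
  near=> x; apply: H; rewrite ?oppr_eq0.
    rewrite -ball_normE /= sub0r opprK.
    by near: x; exact: (@dnbhs0_lt _ C^o _ dgt0).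
  by near: x; exact: (@nbhs_dnbhs_neq C^o 0).
have philN' : phi (- x) @[x --> (0 : C^o)^'] --> (- L : C^o).
  apply: cvg_trans (cvgN phil); apply: near_eq_cvg; near=> x.
  by rewrite /phi /g odd invrN mulrNN mulrN.
have LL : L = - L by apply: cvg_unique philN philN'.
have : L *+ 2 = 0 by rewrite mulr2n {1}LL addNr.
by move/eqP; rewrite mulrn_eq0 subr_eq0 => /eqP.
Unshelve. all: by end_near.
Qed.
End Theta.

Local Close Scope classical_set_scope.

Lemma perm_half (T : zmodType) (s p : seq T) : uniq s -> uniq p ->
    {subset p <= s} -> (forall a, a \in s -> - a \in s) ->
    (forall a, a \in s -> (- a \in p) = (a \notin p)) ->
  perm_eq s (p ++ [seq - a | a <- p]).
Proof.
move=> us up ps sN half; apply: uniq_perm => //.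
  rewrite cat_uniq up map_inj_uniq ?up ?andbT; last exact: oppr_inj.
  by apply/hasPn => _ /mapP [a aP ->]; rewrite /= half ?aP // ps.
move=> a; rewrite mem_cat; apply/idP/orP => [aS|[/ps //|/mapP [b /ps bS ->]]].
  have [aP|aNP] := boolP (a \in p); [by left|right].
  by apply/mapP; exists (- a); rewrite ?opprK // half.
exact: sN.
Qed.

Section Restriction.
Context {R : realType}.
Local Notation C := (R[i]).
Variables (M : vectType C) (U : {vspace M}).

Lemma restrE (A : 'End(M)) (v : subvs_of U) :
  A (vsval v) \in U -> vsval (restr U A v) = A (vsval v).
Proof. by move=> AU; rewrite /restr !comp_lfunE !lfunE /= vsprojK. Qed.

Lemma vsvalB (p q : subvs_of U) : vsval (p - q) = vsval p - vsval q.
Proof. by []. Qed.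

Lemma restr_linear : linear (restr U).
Proof.
move=> k A B; apply/lfunP => v; rewrite [RHS]add_lfunE scale_lfunE /restr !comp_lfunE.
by rewrite add_lfunE scale_lfunE linearP.
Qed.

Lemma restr_id : restr U \1%VF = \1%VF.
Proof.
by apply/lfunP => v; apply: subvs_inj; rewrite /= restrE ?id_lfunE // subvsP.
Qed.
End Restriction.

(** * The Cherednik module and the connections *)

Section ZeroWeightSpace.
Context {R : realType}.
Local Notation C := (R[i]).
Variables (G : @simple_lie R) (lambda : C) (V : D_module G lambda).
Hypothesis V_small : is_small V.
Local Notation br := (bracket G).
Local Notation sharpG := (sharp (sh G) (form G)).
Local Notation on_V0 := (restr (zero_space V)).
Implicit Types (a b : cartan_dual G) (w : 'End(cartan G)).
Let rhoP := @opX_rep R G lambda V.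
Let eqvK : equivariant (opX V) (opK V) := equivariant_comm (@opX_K R G lambda V).
Let eqvQ : equivariant (opX V) (opQ V) := equivariant_comm (@opX_Q R G lambda V).

Definition cartan_action (Y : 'Hom(G, 'End(V))) (x : cartan G) : 'End(V0 V) :=
  on_V0 (Y (vsval x)).

Lemma cartan_action_linear Y : linear (cartan_action Y).
Proof. by move=> k x y; rewrite /cartan_action !linearP restr_linear. Qed.
HB.instance Definition _ Y := GRing.isLinear.Build C (cartan G) 'End(V0 V) *:%R
  (cartan_action Y) (cartan_action_linear Y).

Lemma cartan_actionE Y (x : cartan G) (v : V0 V) : equivariant (opX V) Y ->
  vsval (cartan_action Y x v) = Y (vsval x) (vsval v).
Proof.
move=> eqv; rewrite restrE // ; apply: (cartan_op_V0 x eqv); exact: subvsP.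
Qed.

Definition zero_word_op (s : seq (cartan_dual G)) : 'End(V) :=
  foldr (fun a A => (zero_refl (opX V) a \o A)%VF) \1%VF s.

Lemma zero_word_opE s v : zero_word_op s v = zero_word (opX V) s v.
Proof. by elim: s => [|a s IH] /=; rewrite ?id_lfunE // comp_lfunE IH. Qed.

(* An arbitrary expression of w as a product of reflections is chosen; the
   action does not depend on it, by [same_refl_word]. *)
Definition weyl_action w : 'End(V0 V) :=
  if pselect (exists s, word s /\ forall x, w x = refl_word s x) is left ex
  then on_V0 (zero_word_op (projT1 (cid ex))) else 0.

Lemma weyl_word w : weyl w -> exists s, word s /\ forall x, w x = refl_word s x.
Proof.
elim=> [|a w' aP _ [s [sW sE]]]; first by exists [::]; split=> // x; rewrite id_lfunE.
by exists (a :: s); split=> [|x]; rewrite /= ?aP // comp_lfunE sE.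
Qed.

Lemma zero_word_equivariant Y s (x : cartan G) v : equivariant (opX V) Y -> word s ->
    v \in zero_space V ->
  zero_word (opX V) s (Y (vsval x) v) = Y (vsval (refl_word s x)) (zero_word (opX V) s v).
Proof.
move=> eqv; elim: s => //= a s IH /andP [aP sP] v0.
by rewrite IH // (zero_refl_equivariant rhoP V_small _ eqv aP) // zero_word_V0.
Qed.

Lemma refl_form a (x y : cartan G) : a \in Phi G ->
  form G (vsval (refl a x)) (vsval (refl a y)) = form G (vsval x) (vsval y).
Proof.
move=> aP; have ef := sl2_pair_exists aP.
by rewrite -!(tits_cartan _ aP ef) (tits_adj_form _ _ aP ef).
Qed.

(** Words of reflections preserve the form, so [sharp] intertwines the two actions of W. *)
Lemma sharp_refl_word (xi : cartan_dual G) w s : word s ->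
  (forall x, w x = refl_word s x) -> w (sharpG (xi \o w)%VF) = sharpG xi.
Proof.
move=> sW wE; apply: flat_inj; rewrite sharpK; apply/lfunP => y.
have formw x z : form G (vsval (refl_word s x)) (vsval (refl_word s z))
    = form G (vsval x) (vsval z).
  by elim: (s) sW => //= a t IH /andP [aP tW]; rewrite refl_form // IH.
rewrite flatE wE -{1}(refl_wordK y sW) formw form_sharp comp_lfunE wE.
by rewrite refl_wordK.
Qed.

Variable K : C.
Hypothesis trK : forall u v : cartan G,
  \sum_(a <- Phip G) (a u : C) * (a v : C) = K * form G (vsval u) (vsval v).

Lemma weyl_actionE w s (v : V0 V) : word s -> (forall x, w x = refl_word s x) ->
  vsval (weyl_action w v) = zero_word (opX V) s (vsval v).
Proof.
move=> sW wE; rewrite /weyl_action; case: pselect => [ex|[]]; last by exists s.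
case: (cid ex) => t [tW tE] /=; have v0 := subvsP v.
rewrite restrE zero_word_opE; last exact: (zero_word_V0 rhoP tW v0).
by apply: (same_refl_word rhoP V_small trK) => // x; rewrite -tE wE.
Qed.

Lemma weyl_action_root a (v : V0 V) : a \in Phi G ->
  vsval (weyl_action (refl a) v) = zero_refl (opX V) a (vsval v).
Proof. by move=> aP; rewrite (@weyl_actionE _ [:: a]) //= aP. Qed.

Lemma kappa_V0 a v : a \in Phi G -> v \in zero_space V ->
  kappa V a v = ip a a *: (v - zero_refl (opX V) a v).
Proof.
move=> aP v0; rewrite zero_reflE opprB addrC subrK scalerA mulrCA divff ?ip_neq0 // mulr1.
rewrite /kappa symmE scaler_nat mulr2n; congr (_ + _).
apply/eqP; rewrite -subr_eq0 -rhoP -/(Hroot a) Hroot_sharp //.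
by rewrite (rep_cartan0 _ v0).
Qed.

Lemma kappa_reflection a : a \in Phi G ->
  on_V0 (kappa V a) = ip a a *: (\1%VF - weyl_action (refl a)).
Proof.
move=> aP; apply/lfunP => v; apply: subvs_inj.
have v0 : vsval v \in zero_space V := subvsP v.
transitivity (ip a a *: (vsval v - vsval (weyl_action (refl a) v))); last first.
  by rewrite scale_lfunE add_lfunE opp_lfunE id_lfunE.
rewrite weyl_action_root // [LHS]restrE kappa_V0 //.
by apply: rpredZ; apply: rpredB => //; exact: (zero_refl_V0 rhoP aP v0).
Qed.

Lemma sum_Phi_even (W : zmodType) (F : cartan_dual G -> W) :
    (forall a, a \in Phi G -> F (- a) = F a) ->
  \sum_(a <- Phi G) F a = (\sum_(a <- Phip G) F a) *+ 2.
Proof.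
move=> Fe; have perm := perm_half (@Phi_uniq R G) (@Phip_uniq R G)
  (@Phip_sub R G) (@Phi_opp R G) (@Phip_half R G).
rewrite (perm_big _ perm) big_cat big_map mulr2n /=; congr (_ + _).
by apply: eq_big_seq => a /Phip_sub; apply: Fe.
Qed.

Lemma kappaN a : kappa V (- a) = kappa V a.
Proof. by rewrite /kappa opprK symmC. Qed.

(** [x, X_a] = a(x) X_a and [X_{-a}, y] = a(y) X_{-a}; the terms of a and -a agree, whence the
    factor 2. *)
Lemma root_sum_cartan (x y : cartan G) (v : V) :
  root_sum (opX V) (vsval x) (vsval y) v
    = (\sum_(a <- Phip G) ((a x : C) * (a y : C)) *: kappa V a v) *+ 2.
Proof.
rewrite -sum_Phi_even => [|a aP]; last by rewrite kappaN !opp_lfunE mulrNN.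
rewrite /root_sum sum_lfunE; apply: eq_big_seq => a aP.
rewrite (cartan_bracket x (rootvP aP)) bracket_anti (cartan_bracket y (rootv_opp aP)).
rewrite opp_lfunE scaleNr opprK !opXZ symmZl symmZr scalerA.
by rewrite scale_lfunE.
Qed.

End ZeroWeightSpace.

(** * The Cherednik relations on V[0] *)

Section Main.
Context {R : realType}.
Local Notation C := (R[i]).
Variables (G : @simple_lie R) (lambda hbar hl hs : C).
Variables (u : 'I_(rank G) -> cartan G) (ud : 'I_(rank G) -> cartan_dual G).
Variables (V : D_module G lambda) (beta : cartan_dual G) (c : cartan_dual G -> C).
Local Notation sharpG := (sharp (sh G) (form G)).
Local Notation on_V0 := (restr (zero_space V)).
Hypothesis rank_ge3 : (3 <= rank G)%N.
Hypothesis hlP : is_trace_constant (fun a : cartan_dual G => is_long a) hl.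
Hypothesis hsP : is_trace_constant (fun a : cartan_dual G => ~~ is_long a) hs.
Hypothesis u_ud : dual_bases u ud.
Hypothesis V_small : is_small V.
Hypothesis beta_root : beta \in Phi G.
Hypothesis Z_scalar : opZ V beta = (hbar - lambda / 2 * (2 * hl + hs)) *: \1%VF.
Hypothesis c_eq :
  forall a : cartan_dual G, a \in Phi G -> 2 * c a = lambda / 2 * ip a a ^+ 2.

Lemma trace_hl_hs (x y : cartan G) :
  \sum_(a <- Phip G) (a x : C) * (a y : C) = (hl + hs) * form G (vsval x) (vsval y).
Proof. by rewrite (bigID (fun a : cartan_dual G => is_long a)) /= hlP hsP mulrDl. Qed.

Lemma trace_norm (x y : cartan G) :
  \sum_(a <- Phip G) ip a a * ((a x : C) * (a y : C))
    = (2 * hl + hs) * form G (vsval x) (vsval y).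
Proof.
rewrite (bigID (fun a : cartan_dual G => is_long a)) /= mulrDl -mulrA -hlP -hsP mulr_sumr.
congr (_ + _); first by apply: eq_bigr => a /eqP ->.
rewrite big_seq_cond [RHS]big_seq_cond; apply: eq_bigr => a /andP [/Phip_sub aP al].
by rewrite (short_norm trace_hl_hs rank_ge3 aP al) mul1r.
Qed.

Let rhoP := @opX_rep R G lambda V.
Let eqvK : equivariant (opX V) (opK V) := equivariant_comm (@opX_K R G lambda V).
Let eqvQ : equivariant (opX V) (opQ V) := equivariant_comm (@opX_Q R G lambda V).

Definition x_action : 'Hom(cartan_dual G, 'End(V0 V)) :=
  linfun (cartan_action (opQ V) \o sharpG).
Definition y_action : 'Hom(cartan G, 'End(V0 V)) := linfun (cartan_action (opK V)).

Lemma x_action_cartan xi : x_action xi = cartan_action (opQ V) (sharpG xi).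
Proof. by rewrite /x_action lfunE. Qed.

Lemma y_action_cartan x : y_action x = cartan_action (opK V) x.
Proof. by rewrite /y_action lfunE. Qed.

Lemma x_actionE xi (v : V0 V) : vsval (x_action xi v) = opQ V (vsval (sharpG xi)) (vsval v).
Proof. by rewrite x_action_cartan cartan_actionE. Qed.

Lemma y_actionE x (v : V0 V) : vsval (y_action x v) = opK V (vsval x) (vsval v).
Proof. by rewrite y_action_cartan cartan_actionE. Qed.

Lemma weyl_action1 : weyl_action V \1%VF = \1%VF.
Proof.
apply/lfunP => v; apply: subvs_inj; rewrite id_lfunE.
by rewrite [LHS](weyl_actionE V_small trace_hl_hs (s := [::])) // => x; rewrite id_lfunE.
Qed.

Lemma weyl_actionM w w' : weyl w -> weyl w' ->
  weyl_action V (w \o w')%VF = (weyl_action V w \o weyl_action V w')%VF.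
Proof.
move=> /weyl_word [s [sW sE]] /weyl_word [t [tW tE]]; apply/lfunP => v; apply: subvs_inj.
rewrite [LHS](weyl_actionE V_small trace_hl_hs (s := s ++ t)); first last.
- by move=> x; rewrite comp_lfunE tE sE refl_word_cat.
- by rewrite /word all_cat; apply/andP; split; [exact: sW|exact: tW].
rewrite comp_lfunE [RHS](weyl_actionE V_small trace_hl_hs _ sW sE).
by rewrite (weyl_actionE V_small trace_hl_hs _ tW tE) zero_word_cat.
Qed.

Lemma weyl_action_x w xi : weyl w ->
  (weyl_action V w \o x_action (xi \o w)%VF)%VF = (x_action xi \o weyl_action V w)%VF.
Proof.
move=> /weyl_word [s [sW sE]]; apply/lfunP => v; apply: subvs_inj.
rewrite [in LHS]comp_lfunE [in RHS]comp_lfunE.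
rewrite [LHS](weyl_actionE V_small trace_hl_hs _ sW sE) !x_actionE.
rewrite (weyl_actionE V_small trace_hl_hs _ sW sE).
rewrite (zero_word_equivariant V_small _ eqvQ sW) ?subvsP //.
by rewrite -sE (sharp_refl_word _ sW sE).
Qed.

Lemma weyl_action_y w x : weyl w ->
  (weyl_action V w \o y_action x)%VF = (y_action (w x) \o weyl_action V w)%VF.
Proof.
move=> /weyl_word [s [sW sE]]; apply/lfunP => v; apply: subvs_inj.
rewrite !comp_lfunE [LHS](weyl_actionE V_small trace_hl_hs _ sW sE) !y_actionE.
rewrite (weyl_actionE V_small trace_hl_hs _ sW sE).
by rewrite (zero_word_equivariant V_small _ eqvK sW) ?subvsP // sE.
Qed.

Lemma cartan_commute (x y : cartan G) : bracket G (vsval x) (vsval y) = 0.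
Proof. by rewrite (cartan_bracket x (cartan_weight0 (subvsP y))) lfunE /= scale0r. Qed.

Lemma cartan_action_commute Y (x y : cartan G) : equivariant (opX V) Y ->
    comm (Y (vsval x)) (Y (vsval y)) = 0 ->
  comm (cartan_action Y x) (cartan_action Y y) = 0.
Proof.
move=> eqv Yxy; apply/lfunP => v; apply: subvs_inj.
have := congr1 (fun A : 'End(V) => A (vsval v)) Yxy.
by rewrite !commE vsvalB !cartan_actionE // !zero_lfunE.
Qed.

Lemma x_action_commute xi eta : comm (x_action xi) (x_action eta) = 0.
Proof.
rewrite !x_action_cartan; apply: (cartan_action_commute eqvQ).
exact/opQ_comm0/cartan_commute.
Qed.

Lemma y_action_commute x y : comm (y_action x) (y_action y) = 0.
Proof.
rewrite !y_action_cartan; apply: (cartan_action_commute eqvK).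
exact/opK_comm0/cartan_commute.
Qed.

(** Matches the coefficient of s_a in the Cherednik relation with the one from the root sum, using
    c_a = lambda (a, a)^2 / 4 and xi(coroot of a) = 2 (xi, a) / (a, a). *)
Lemma xy_coefficient a (x : cartan G) (xi : cartan_dual G) : a \in Phi G ->
  c a * (a x : C) * (xi (coroot_h a) : C)
    = lambda / 2 * (ip a a * ((a x : C) * (a (sharpG xi) : C))).
Proof.
move=> aP; have aa0 := ip_neq0 aP; rewrite root_coroot // ip_sym ipE.
have -> : c a = lambda / 4 * ip a a ^+ 2.
  by apply: (@mulfI _ 2); rewrite ?pnatr_eq0 // c_eq //; field.
by field.
Qed.

(** The identity parts of the kappa_a add up, by [trace_norm], to lambda/2 (2 hl + hs)(x, y), which
    cancels the shift in the scalar of Z and leaves hbar. *)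
Lemma yx_relation (x : cartan G) (xi : cartan_dual G) :
  comm (y_action x) (x_action xi) = (hbar * (xi x : C)) *: \1%VF
    - \sum_(a <- Phip G)
        (c a * (a x : C) * (xi (coroot_h a) : C)) *: weyl_action V (refl a).
Proof.
apply/lfunP => v; apply: subvs_inj.
have v0 : vsval v \in zero_space V := subvsP v.
rewrite commE vsvalB !(y_actionE, x_actionE) -commE.
rewrite (KQ_cartan V u_ud x (sharpG xi) (ltnW rank_ge3) beta_root) Z_scalar.
rewrite [LHS]add_lfunE !scale_lfunE id_lfunE root_sum_cartan.
have -> : vsval (((hbar * (xi x : C)) *: \1%VF - \sum_(a <- Phip G)
    (c a * (a x : C) * (xi (coroot_h a) : C)) *: weyl_action V (refl a)) v)
  = (hbar * (xi x : C)) *: vsval v - \sum_(a <- Phip G)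
    (c a * (a x : C) * (xi (coroot_h a) : C)) *: vsval (weyl_action V (refl a) v).
  rewrite add_lfunE opp_lfunE scale_lfunE id_lfunE sum_lfunE vsvalB.
  congr (_ - _); rewrite [LHS]linear_sum; apply: eq_bigr => a _.
  by rewrite scale_lfunE.
set y := sharpG xi; set f := form G (vsval x) (vsval y).
have fE : xi x = f by rewrite /f form_sym form_sharp.
pose m a := lambda / 2 * (ip a a * ((a x : C) * (a y : C))).
rewrite [in RHS](eq_big_seq (fun a => m a *: zero_refl (opX V) a (vsval v))); last first.
  move=> a /Phip_sub aP.
  by rewrite (weyl_action_root V_small trace_hl_hs) // xy_coefficient.
have -> : (lambda / 4) *: ((\sum_(a <- Phip G) ((a x : C) * (a y : C)) *: kappa V a (vsval v)) *+ 2)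
    = (lambda / 2 * ((2 * hl + hs) * f)) *: vsval v
      - \sum_(a <- Phip G) m a *: zero_refl (opX V) a (vsval v).
  rewrite -trace_norm mulr_sumr scaler_suml -sumrB -scaler_nat scalerA scaler_sumr.
  apply: eq_big_seq => a /Phip_sub aP.
  by rewrite kappa_V0 // !scalerA -scalerBr; congr (_ *: _); rewrite /m; field.
by rewrite fE scalerA addrA -scalerDl; congr (_ *: _ - _); ring.
Qed.

Definition zero_space_module : cherednik_module hbar c (V0 V) :=
  CherednikModule weyl_action1 weyl_actionM weyl_action_x weyl_action_y
    x_action_commute y_action_commute yx_relation.

Lemma zero_space_module_tits (a : cartan_dual G) (e f : G) (v : V0 V) :
  a \in Phi G -> sl2_pair a e f ->
  vsval (ch_w zero_space_module (refl a) v) = tits V e f (vsval v).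
Proof.
move=> aP ef; rewrite (weyl_action_root V_small trace_hl_hs) //.
by rewrite -(tits_zero_refl rhoP V_small aP ef (subvsP v)).
Qed.

Lemma zero_space_module_xu (x : cartan G) :
  ch_xu zero_space_module x = cartan_action (opQ V) x.
Proof. by rewrite /ch_xu /= x_action_cartan flatK. Qed.

Lemma zero_space_module_y (x : cartan G) :
  ch_y zero_space_module x = cartan_action (opK V) x.
Proof. exact: y_action_cartan. Qed.

End Main.

Local Open Scope classical_set_scope.

(** * Power series in ad T applied to affine combinations *)

Section AdSeries.
Context {R : realType}.
Local Notation C := (R[i]).
Variable M : vectType C.
Implicit Types T S L : 'End(M).

Lemma iter_comm_linear T n : linear (iter n (comm T)).
Proof.
elim: n => [|n IH] k S S'; first by [].
by rewrite !iterS (IH k S S') [LHS]linearP.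
Qed.

Lemma iter_comm_id T n : iter n.+1 (comm T) \1%VF = 0.
Proof.
elim: n => [|n IH]; last by rewrite iterS IH linear0.
by rewrite /= /comm comp_lfun1l comp_lfun1r subrr.
Qed.

(** On the identity only the degree 0 term survives; the order n + 1 makes sure that it is
    present. *)
Lemma ad_psum_affine (a : nat -> C) T (k : C) S n :
  ad_psum a T (k *: (\1%VF - S)) n.+1
    = k *: (a 0%N *: \1%VF - ad_psum a T S n.+1).
Proof.
have -> : a 0%N *: \1%VF = ad_psum a T \1%VF n.+1.
  rewrite /ad_psum big_ord_recl big1 ?addr0 // => i _.
  by rewrite lift0 iter_comm_id scaler0.
rewrite /ad_psum -sumrB scaler_sumr; apply: eq_bigr => i _.
have itl := iter_comm_linear T i.
rewrite (linear_scale k _ itl) -scaleN1r addrC itl addrC scalerA mulrC -scalerA.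
by rewrite scaleN1r -scalerBr.
Qed.

Lemma ad_series_affine (a : nat -> C) T S S' L (k : C) (A : 'End(M)) :
    (forall n, ad_psum a T S' n.+1 = A + k *: ad_psum a T S n.+1) ->
  ad_series a T S L -> ad_series a T S' (A + k *: L).
Proof.
move=> SS' SL phi; rewrite -(cvg_shiftS (fun n => phi (ad_psum a T S' n) : C^o)) /=.
have -> : (fun n => phi (ad_psum a T S' n.+1) : C^o)
    = (fun n => (phi A : C^o) + k *: (phi (ad_psum a T S n.+1) : C^o)).
  by apply: funext => n; rewrite SS' linearD linearZ.
rewrite linearD linearZ; apply: cvgD; first exact: cvg_cst.
apply: cvgZr; have := SL phi.
by rewrite -(cvg_shiftS (fun n => phi (ad_psum a T S n) : C^o)).
Qed.
End AdSeries.

Local Close Scope classical_set_scope.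

(** * Comparison of the two connections *)

Section Connections.
Context {R : realType}.
Local Notation C := (R[i]).
Variables (G : @simple_lie R) (lambda hbar hv hl hs : C).
Variables (u : 'I_(rank G) -> cartan G) (ud : 'I_(rank G) -> cartan_dual G).
Variables (V : D_module G lambda) (beta : cartan_dual G) (c : cartan_dual G -> C).
Variables (theta : C -> C) (kc : C -> nat -> C) (N : cherednik_module hbar c (V0 V)).
Local Notation on_V0 := (restr (zero_space V)).
Hypothesis ip0 : forall a, a \in Phip G -> ip a a != 0.
Hypothesis c_eq : forall a, a \in Phip G -> 2 * c a = lambda / 2 * ip a a ^+ 2.
Hypothesis kappa_refl : forall a, a \in Phip G ->
  on_V0 (kappa V a) = ip a a *: (\1%VF - ch_w N (refl a)).
Hypothesis argE : forall a, a \in Phip G -> casimir_arg V a = kz_arg N a.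
Hypothesis chyE : forall x, on_V0 (opK V (vsval x)) = ch_y N x.
Hypothesis ZE : on_V0 (opZ V beta) = (hbar - lambda / 2 * (2 * hl + hs)) *: \1%VF.
Variables z w : cartan G.
Hypothesis kc0 : forall a, a \in Phip G -> kc (a z) 0%N = dlog theta (a z).
Local Notation dl a := (dlog theta (a z)).

(** L and L' are arbitrary, so truncations and limits are treated alike. In the scalar form, the
    identity parts of the kappa_a give - (a, a) and the shift in Z gives (2 hl + hs) / hv. *)
Lemma casimir_kz_form (L L' : cartan_dual G -> 'End(V0 V)) :
    (forall a, a \in Phip G -> L a = ip a a *: (dl a *: \1%VF - L' a)) ->
  casimir_form theta hv u ud beta L z w
    = kz_form theta hv u ud N L' z w
      + scalar_form theta hv lambda hl hs z w *: \1%VF.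
Proof.
move=> LE; rewrite /casimir_form /kz_form /scalar_form.
have -> : \sum_i (ud i w : C) *: on_V0 (opK V (vsval (u i)))
    = \sum_i (ud i w : C) *: ch_y N (u i).
  by apply: eq_bigr => i _; rewrite chyE.
move: (\sum_i _) => Y; rewrite [RHS]addrAC; congr (_ + _).
rewrite mulr_sumr !scaler_sumr scaler_suml -!sumrN -!big_split /=.
apply: eq_big_seq => a aP; rewrite LE // ZE !scalerA.
have -> : 2 * c a / ip a a = lambda / 2 * ip a a by rewrite c_eq //; field; exact: ip0.
rewrite scalerBr scalerA opprB -[LHS]addrA -[RHS]addrA.
congr (_ + _); first by congr (_ *: _); ring.
rewrite -opprD -scalerDl -[LHS]scaleNr [RHS]addrC -scalerBl; congr (_ *: _); ring.
Qed.

Lemma casimir_kz_psum a n : a \in Phip G ->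
  ad_psum (kc (a z)) (casimir_arg V a) (on_V0 (kappa V a)) n.+1
    = ip a a *: (dl a *: \1%VF
        - ad_psum (kc (a z)) (kz_arg N a) (ch_w N (refl a)) n.+1).
Proof. by move=> aP; rewrite argE // kappa_refl // ad_psum_affine kc0. Qed.

Lemma casimir_kz_trunc n :
  casimir_trunc theta kc hv u ud V beta n.+1 z w
    = kz_trunc theta kc hv u ud N n.+1 z w
      + scalar_form theta hv lambda hl hs z w *: \1%VF.
Proof. by apply: casimir_kz_form => a; apply: casimir_kz_psum. Qed.

Lemma casimir_kz_conn (A : 'End(V0 V)) :
  casimir_conn theta kc hv u ud V beta z w A <->
  exists2 B, kz_conn theta kc hv u ud N z w B &
    A = B + scalar_form theta hv lambda hl hs z w *: \1%VF.
Proof.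
split=> [[L LP ->]|[_ [L LP ->] ->]].
  (* The affine relation L = (a, a)(theta'/theta - L') solved for L', so that convergence passes
     from the Casimir side to the KZ side. *)
  pose L' (a : cartan_dual G) : 'End(V0 V) := dl a *: \1%VF + - (ip a a)^-1 *: L a.
  have L'P (a : cartan_dual G) : a \in Phip G ->
      ad_series (kc (a z)) (kz_arg N a) (ch_w N (refl a)) (L' a).
    move=> aP; have := LP a aP; rewrite (argE aP); apply: ad_series_affine => n.
    have := casimir_kz_psum n aP; rewrite (argE aP) => ->.
    by rewrite scalerA mulNr mulVf ?ip0 // scaleN1r opprB addrC subrK.
  exists (kz_form theta hv u ud N L' z w); first by exists L'; [exact: L'P|reflexivity].
  apply: casimir_kz_form => a aP; rewrite /L' opprD addrA subrr sub0r scaleNr opprK.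
  by rewrite scalerA divff ?scale1r // ip0.
pose L' (a : cartan_dual G) : 'End(V0 V) := ip a a *: (dl a *: \1%VF) + - ip a a *: L a.
have L'P (a : cartan_dual G) : a \in Phip G ->
    ad_series (kc (a z)) (casimir_arg V a) (on_V0 (kappa V a)) (L' a).
  move=> aP; have := LP a aP; rewrite -(argE aP); apply: ad_series_affine => n.
  by rewrite (casimir_kz_psum n aP) (argE aP) scalerBr scaleNr.
exists L'; first exact: L'P.
by apply/esym/casimir_kz_form => a aP; rewrite /L' scalerBr scaleNr.
Qed.

End Connections.

Theorem theorem5 (R : realType) (G : @simple_lie R) (lambda hbar : R[i])
  (hv hl hs : R[i]) (u : 'I_(rank G) -> cartan G)
  (ud : 'I_(rank G) -> cartan_dual G)
  (V : D_module G lambda) (beta : cartan_dual G) (c : cartan_dual G -> R[i])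
  (tau : R[i]) (theta : R[i] -> R[i]) (kc : R[i] -> nat -> R[i])
  (rank_ge3 : (3 <= rank G)%N)
  (hvP : is_dual_coxeter G hv)
  (hlP : is_trace_constant (fun a : cartan_dual G => is_long a) hl)
  (hsP : is_trace_constant (fun a : cartan_dual G => ~~ is_long a) hs)
  (u_ud : dual_bases u ud)
  (V_small : is_small V)
  (beta_root : beta \in Phi G)
  (Z_scalar : opZ V beta = (hbar - lambda / 2 * (2 * hl + hs)) *: \1%VF)
  (c_inv : weyl_invariant c)
  (c_eq : forall a : cartan_dual G, a \in Phi G -> 2 * c a = lambda / 2 * ip a a ^+ 2)
  (tau_upper : 0 < complex.Im tau)
  (thetaP : is_theta tau theta)
  (kcP : is_k_coeff tau theta kc) :
  exists N : cherednik_module hbar c (V0 V),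
    [/\ forall (a : cartan_dual G) (e f : G) (v : V0 V), a \in Phi G -> sl2_pair a e f ->
          vsval (ch_w N (refl a) v) = tits V e f (vsval v),
        forall (x : cartan G) (v : V0 V),
          vsval (ch_xu N x v) = opQ V (vsval x) (vsval v),
        forall (x : cartan G) (v : V0 V),
          vsval (ch_y N x v) = opK V (vsval x) (vsval v) &
        forall z w : cartan G, regular tau z ->
          (forall n : nat,
             casimir_trunc theta kc hv u ud V beta n.+1 z w =
               kz_trunc theta kc hv u ud N n.+1 z w
               + scalar_form theta hv lambda hl hs z w *: \1%VF) /\
          (forall A : 'End(V0 V),
             casimir_conn theta kc hv u ud V beta z w A <->
             exists2 B, kz_conn theta kc hv u ud N z w B &
               A = B + scalar_form theta hv lambda hl hs z w *: \1%VF)].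
Proof.
pose N := zero_space_module rank_ge3 hlP hsP u_ud V_small beta_root Z_scalar c_eq.
have eqvQ : equivariant (opX V) (opQ V) := equivariant_comm (@opX_Q R G lambda V).
have xuE x : ch_xu N x = cartan_action (opQ V) x by exact: zero_space_module_xu.
have yE x : ch_y N x = cartan_action (opK V) x by exact: zero_space_module_y.
exists N; split.
- by move=> a e f v aP ef; apply: zero_space_module_tits.
- by move=> x v; rewrite xuE cartan_actionE.
- by move=> x v; exact: y_actionE.
move=> z w zreg.
have trK := trace_hl_hs hlP hsP.
have ip0 (a : cartan_dual G) : a \in Phip G -> ip a a != 0.
  by move=> /Phip_sub; apply: ip_neq0.
have c_eq' (a : cartan_dual G) : a \in Phip G -> 2 * c a = lambda / 2 * ip a a ^+ 2.
  by move=> /Phip_sub; apply: c_eq.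
have kappaE (a : cartan_dual G) : a \in Phip G ->
    restr (zero_space V) (kappa V a) = ip a a *: (\1%VF - ch_w N (refl a)).
  by move=> /Phip_sub aP; exact: (kappa_reflection V_small trK aP).
have argE (a : cartan_dual G) : a \in Phip G -> casimir_arg V a = kz_arg N a.
  by move=> /Phip_sub aP; rewrite /casimir_arg /kz_arg xuE corootE.
have ZE : restr (zero_space V) (opZ V beta)
    = (hbar - lambda / 2 * (2 * hl + hs)) *: \1%VF.
  by rewrite Z_scalar (linear_scale _ \1%VF (restr_linear (zero_space V))) restr_id.
have kc0 (a : cartan_dual G) : a \in Phip G -> kc (a z) 0%N = dlog theta (a z).
  by move=> /Phip_sub/zreg; exact: k_coeff0.
have chyE x : restr (zero_space V) (opK V (vsval x)) = ch_y N x by rewrite yE.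
split=> [n|A].
  exact: (casimir_kz_trunc hv u ud ip0 c_eq' kappaE argE chyE ZE w kc0 n).
exact: (casimir_kz_conn hv u ud ip0 c_eq' kappaE argE chyE ZE w kc0 A).
Qed.
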